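(* Let $n\ge2$, let $\Gamma=([n],w)$ be a weighted hypergraph with non-negative weights, let $k\in\mathbb{Z}_{\ge1}$ and write $\rho_k=\rho_{(k,0,\ldots,0,-k)}$. Let $\rho\colon\mathrm{U}(n)\to\mathrm{U}(V)$ be an irreducible (unitary) representation of $\mathrm{U}(n)$, and let $\alpha$ be any eigenvalue of ${\cal L}(\Gamma,\rho)$ restricted to the orthogonal complement $\mathrm{TorInv}(\rho)^\perp$ (which is invariant under ${\cal L}(\Gamma,\rho)$). Then $\lambda_{\min}(\Gamma,\rho_k)\le\alpha$. In particular, if $\rho$ is unbalanced, then $\lambda_{\min}(\Gamma,\rho_k)\le\lambda_{\min}(\Gamma,\rho)$ for all $k\ge1$.
   Context: A weighted hypergraph $\Gamma=([n],w)$ assigns $w_B\ge0$ to every $B\subseteq[n]$. $\mathrm{U}_B\le\mathrm{U}(n)$ is the subgroup of unitaries coinciding with the identity outside the minor indexed by $B$, with Haar probability measure $\mu_B$. For a finite-dimensional representation $\rho$ on $V$, ${\cal L}(\Gamma,\rho)=\sum_Bw_B\big[I-\int_{\mathrm{U}_B}\rho(A)\,d\mu_B(A)\big]$, and $\lambda_{\min}(\Gamma,\rho)$ is its smallest eigenvalue. Irreducible representations $\rho_\mu$ of $\mathrm{U}(n)$ are indexed by non-increasing highest weights $\mu\in\mathbb{Z}^n$; $\rho_\mu$ is balanced if $\sum_i\mu_i=0$ and unbalanced otherwise. $T_n\le\mathrm{U}(n)$ is the subgroup of diagonal unitary matrices (the torus), and $\mathrm{TorInv}(\rho)=\{v\in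 V:\rho(A)v=v\ \forall A\in T_n\}$ is the torus-invariant subspace. *)

(* Defs.v *)
From mathcomp Require Import all_boot all_algebra.
From mathcomp Require Import complex.
From mathcomp Require Import reals.
Set Implicit Arguments. Unset Strict Implicit. Unset Printing Implicit Defensive.
Import GRing.Theory Num.Theory.
Local Open Scope ring_scope.
Local Open Scope complex_scope.

(* The complex numbers are R[i] for R : realType. Vectors of V = C^d are
   column vectors 'cV_d with the standard Hermitian inner product. *)

Definition adjmx (R : realType) (m p : nat) (A : 'M[R[i]]_(m, p)) : 'M[R[i]]_(p, m) :=
  (map_mx (@conjc R) A)^T.

Definition unitary (R : realType) (n : nat) (A : 'M[R[i]]_n) : Prop :=
  A *m adjmx A = 1%:M.

Definition UB (R : realType) (n : nat) (B : {set 'I_n}) (A : 'M[R[i]]_n) : Prop :=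
  unitary A /\ forall i j : 'I_n, ~~ ((i \in B) && (j \in B)) -> A i j = (i == j)%:R.

Definition torus (R : realType) (n : nat) (A : 'M[R[i]]_n) : Prop :=
  unitary A /\ forall i j : 'I_n, i != j -> A i j = 0.

Definition cont_on (R : realType) (n q r : nat) (G : 'M[R[i]]_n -> Prop)
    (f : 'M[R[i]]_n -> 'M[R[i]]_(q, r)) : Prop :=
  forall A, G A -> forall e : R, 0 < e -> exists2 dl : R, 0 < dl &
    forall A', G A' -> (forall i j, `|A' i j - A i j| < dl%:C) ->
      forall k l, `|f A' k l - f A k l| < e%:C.

Definition scal_cont_on (R : realType) (n : nat) (G : 'M[R[i]]_n -> Prop)
    (f : 'M[R[i]]_n -> R[i]) : Prop :=
  cont_on G (fun A => (f A)%:M : 'M[R[i]]_1).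

(* I is (an extension to all functions of) the Haar probability integral of
   the compact group G: a positive, normalised, left- and right-invariant
   linear functional on the continuous functions on G.  By Riesz and the
   uniqueness of Haar measure, on continuous functions on G it coincides with
   f |-> \int_G f dmu_G. *)
Record is_haar_integral (R : realType) (n : nat) (G : 'M[R[i]]_n -> Prop)
    (I : ('M[R[i]]_n -> R[i]) -> R[i]) : Prop := {
  haar_local : forall f g, scal_cont_on G f -> scal_cont_on G g ->
      (forall A, G A -> f A = g A) -> I f = I g;
  haar_add : forall f g, scal_cont_on G f -> scal_cont_on G g ->
      I (fun A => f A + g A) = I f + I g;
  haar_scale : forall (c : R[i]) f, scal_cont_on G f ->
      I (fun A => c * f A) = c * I f;
  haar_pos : forall f, scal_cont_on G f -> (forall A, G A -> 0 <= f A) -> 0 <= I f;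
  haar_one : I (fun _ => 1) = 1;
  haar_linv : forall g f, G g -> scal_cont_on G f -> I (fun A => f (g *m A)) = I f;
  haar_rinv : forall g f, G g -> scal_cont_on G f -> I (fun A => f (A *m g)) = I f
}.

(* a finite-dimensional (continuous) unitary representation of U(n) on C^d;
   only the values of rho on U(n) matter *)
Definition is_unitary_rep (R : realType) (n d : nat)
    (rho : 'M[R[i]]_n -> 'M[R[i]]_d) : Prop :=
  [/\ forall A B, unitary A -> unitary B -> rho (A *m B) = rho A *m rho B,
      forall A, unitary A -> unitary (rho A)
    & cont_on (@unitary R n) rho].

(* irreducible: V <> 0 and the only invariant subspaces (spanned by the
   columns of W) are 0 and V *)
Definition irreducible_rep (R : realType) (n d : nat)
    (rho : 'M[R[i]]_n -> 'M[R[i]]_d) : Prop :=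
  (0 < d)%N /\
  forall W : 'M[R[i]]_d,
    (forall A, unitary A -> ((rho A *m W)^T <= W^T)%MS) ->
    \rank W = 0%N \/ \rank W = d.

Definition is_weight (R : realType) (n d : nat) (rho : 'M[R[i]]_n -> 'M[R[i]]_d)
    (lam : 'I_n -> int) : Prop :=
  exists2 v : 'cV[R[i]]_d, v != 0 &
    forall t : 'I_n -> R[i], (forall i, `|t i| = 1) ->
      rho (diag_mx (\row_i t i)) *m v = (\prod_i t i ^ lam i) *: v.

(* dominance order: mu - lam is a nonnegative integer combination of the
   positive roots e_i - e_j (i < j) *)
Definition dominated (n : nat) (lam mu : 'I_n -> int) : Prop :=
  \sum_i lam i = \sum_i mu i /\
  forall j : nat, \sum_(i : 'I_n | (i < j)%N) lam i <= \sum_(i : 'I_n | (i < j)%N) mu i.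

Definition has_highest_weight (R : realType) (n d : nat)
    (rho : 'M[R[i]]_n -> 'M[R[i]]_d) (mu : 'I_n -> int) : Prop :=
  [/\ irreducible_rep rho, is_weight rho mu &
      forall lam, is_weight rho lam -> dominated lam mu].

Definition wk (n k : nat) : 'I_n -> int :=
  fun i => if val i == 0%N then (k%:Z)%R else if val i == n.-1 then (- k%:Z)%R else 0%R.

Definition laplacian (R : realType) (n d : nat) (w : {set 'I_n} -> R)
    (haar : {set 'I_n} -> ('M[R[i]]_n -> R[i]) -> R[i])
    (rho : 'M[R[i]]_n -> 'M[R[i]]_d) : 'M[R[i]]_d :=
  \sum_(B : {set 'I_n}) (w B)%:C *: (1%:M - \matrix_(i, j) haar B (fun A => rho A i j)).

Definition is_eigenvalue (R : realType) (d : nat) (M : 'M[R[i]]_d) (a : R[i]) : Prop :=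
  exists2 v : 'cV[R[i]]_d, v != 0 & M *m v = a *: v.

Definition is_lambda_min (R : realType) (d : nat) (M : 'M[R[i]]_d) (a : R[i]) : Prop :=
  is_eigenvalue M a /\ forall b, is_eigenvalue M b -> a <= b.

Definition torinv (R : realType) (n d : nat) (rho : 'M[R[i]]_n -> 'M[R[i]]_d)
    (v : 'cV[R[i]]_d) : Prop :=
  forall A, torus A -> rho A *m v = v.

Definition in_torinv_perp (R : realType) (n d : nat) (rho : 'M[R[i]]_n -> 'M[R[i]]_d)
    (v : 'cV[R[i]]_d) : Prop :=
  forall u, torinv rho u -> adjmx u *m v = 0.

Definition is_eigenvalue_on_torinv_perp (R : realType) (n d : nat)
    (rho : 'M[R[i]]_n -> 'M[R[i]]_d) (M : 'M[R[i]]_d) (a : R[i]) : Prop :=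
  exists2 v : 'cV[R[i]]_d, v != 0 & in_torinv_perp rho v /\ M *m v = a *: v.

(* Main.v *)
(** Let [P_B] be the orthogonal projection onto the [U_B]-invariants, so that the
    Laplacian is [sum_B w_B (1 - P_B)]; the torus commutes with every [P_B].

    Lower bound.  If [v] is a Laplace eigenvector orthogonal to the torus
    invariants, then applying the projections [P_{i}] one after the other must
    eventually kill it, and the last nonzero vector is an eigenvector for the same
    eigenvalue [alpha] with [P_{j} v' = 0] for some [j].  As [P_B = P_B P_{j}] for
    [j \in B], this gives [alpha >= sum_(B | j \in B) w_B].

    Upper bound.  For each [j] the representation [rho_k] contains a nonzero vector
    fixed by [U_B] for all [B] avoiding [j]; its Rayleigh quotient is at most
    [sum_(B | j \in B) w_B].

    Existence of this vector.  Only the highest weight of [rho_k] is known, so it is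
    extracted from the differential of [rho_k].  Let [x] be a translate of a highest
    weight vector, attached to the orthonormal pair [(e_j + e_q) / sqrt 2] and
    [(e_j - e_q) / sqrt 2].  Along a complex reflection in a hyperplane containing
    [e_j], the coefficient [<x, rho(g) x>] satisfies a first order linear
    differential equation, whence [<x, rho(g) x> = |x|^2 |(1 + g_qq) / 2|^(2k)]
    on the stabiliser of [e_j].  This has a positive integral, so the projection
    of [x] onto the invariants of that stabiliser is nonzero. *)
Require Import Defs.
From mathcomp Require Import all_boot all_order all_algebra all_fingroup.
From mathcomp Require Import complex.
From mathcomp Require Import reals.
From mathcomp Require Import ring lra.
Set Implicit Arguments. Unset Strict Implicit. Unset Printing Implicit Defensive.
Import Order.TTheory GRing.Theory Num.Theory.
Local Open Scope ring_scope.
Local Open Scope complex_scope.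

(** * Hermitian inner product and complex reflections *)

Section Hermitian.
Variable R : realType.
Local Notation C := R[i].
Local Notation "x ^*" := (@conjc _ x) : ring_scope.

(** The choice of the orthonormal pair comes from a model. Inside the tensor product of the k-th
    symmetric powers of C^n and of its dual, a unit highest weight vector attached to an orthonormal
    pair [a], [c] has coefficient [<a, g a>^k] times the conjugate of [<c, g c>^k]. For [g] fixing
    [e_j] and the pair built from [e_j] and [e_q], both entries equal [(1 + g_qq) / 2], so the
    coefficient is nonnegative. As [rho_k] is given only through its highest weight, this formula is
    recovered from a differential equation rather than read off the model. The exponential map is
    avoided: the one-parameter groups are the circles [t |-> refl u t], on which Fejer means show
    [rho] to be a Laurent polynomial in [t]. Derivatives along these circles are extended linearly
    to all matrices, and a Lipschitz bound for [rho] at the identity makes the extension consistent.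
    Identities on the circle then become identities between polynomials, and the equation is solved
    there. *)

Lemma conjcD (x y : C) : (x + y)^* = x^* + y^*. Proof. exact: rmorphD. Qed.
Lemma conjcN (x : C) : (- x)^* = - x^*. Proof. exact: rmorphN. Qed.
Lemma conjcB (x y : C) : (x - y)^* = x^* - y^*. Proof. exact: rmorphB. Qed.
Lemma conjcM (x y : C) : (x * y)^* = x^* * y^*. Proof. exact: rmorphM. Qed.
Lemma conjcV (x : C) : (x^-1)^* = (x^*)^-1. Proof. exact: conjc_inv. Qed.
Lemma conjcX (x : C) m : (x ^+ m)^* = x^* ^+ m. Proof. exact: rmorphXn. Qed.
Lemma conjci : 'i^* = - 'i :> C.
Proof. by apply/eqP; rewrite eq_complex /= oppr0 !eqxx. Qed.

Lemma adjmxE m p (A : 'M[C]_(m, p)) i j : adjmx A i j = (A j i)^*.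
Proof. by rewrite !mxE. Qed.

Lemma adjmxK m p (A : 'M[C]_(m, p)) : adjmx (adjmx A) = A.
Proof. by apply/matrixP => i j; rewrite !mxE conjcK. Qed.

Lemma adjmxM m p q (A : 'M[C]_(m, p)) (B : 'M_(p, q)) :
  adjmx (A *m B) = adjmx B *m adjmx A.
Proof. by rewrite /adjmx map_mxM trmx_mul. Qed.

Lemma adjmxD m p (A B : 'M[C]_(m, p)) : adjmx (A + B) = adjmx A + adjmx B.
Proof. by rewrite /adjmx map_mxD linearD. Qed.

Lemma adjmxN m p (A : 'M[C]_(m, p)) : adjmx (- A) = - adjmx A.
Proof. by rewrite /adjmx map_mxN linearN. Qed.

Lemma adjmxZ m p a (A : 'M[C]_(m, p)) : adjmx (a *: A) = a^* *: adjmx A.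
Proof. by apply/matrixP => i j; rewrite !mxE rmorphM. Qed.

Lemma adjmx0 m p : adjmx (0 : 'M[C]_(m, p)) = 0.
Proof. by apply/matrixP => i j; rewrite !mxE rmorph0. Qed.

Lemma adjmx_sum m p I (r : seq I) (P : pred I) (F : I -> 'M[C]_(m, p)) :
  adjmx (\sum_(i <- r | P i) F i) = \sum_(i <- r | P i) adjmx (F i).
Proof. exact: (big_morph _ (@adjmxD m p) (adjmx0 m p)). Qed.

Lemma adjmx_scalar n (a : C) : adjmx (a%:M : 'M_n) = (a^*)%:M.
Proof. by rewrite /adjmx map_scalar_mx tr_scalar_mx. Qed.

Lemma adjmx1 n : adjmx (1%:M : 'M[C]_n) = 1%:M.
Proof. by rewrite adjmx_scalar rmorph1. Qed.

Definition ip d (u v : 'cV[C]_d) : C := (adjmx u *m v) 0 0.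

Lemma ipE d (u v : 'cV[C]_d) : ip u v = \sum_i (u i 0)^* * v i 0.
Proof. by rewrite /ip mxE; apply: eq_bigr => i _; rewrite adjmxE. Qed.

Lemma ip_mx d (u v : 'cV[C]_d) : adjmx u *m v = (ip u v)%:M.
Proof. by rewrite [LHS]mx11_scalar. Qed.

Lemma ipDr d (u v w : 'cV[C]_d) : ip u (v + w) = ip u v + ip u w.
Proof. by rewrite /ip mulmxDr mxE. Qed.

Lemma ipDl d (u v w : 'cV[C]_d) : ip (u + v) w = ip u w + ip v w.
Proof. by rewrite /ip adjmxD mulmxDl mxE. Qed.

Lemma ipZr d a (u v : 'cV[C]_d) : ip u (a *: v) = a * ip u v.
Proof. by rewrite /ip -scalemxAr mxE. Qed.

Lemma ipZl d a (u v : 'cV[C]_d) : ip (a *: u) v = a^* * ip u v.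
Proof. by rewrite /ip adjmxZ -scalemxAl mxE. Qed.

Lemma ipBr d (u v w : 'cV[C]_d) : ip u (v - w) = ip u v - ip u w.
Proof. by rewrite ipDr -scaleN1r ipZr mulN1r. Qed.

Lemma ipBl d (u v w : 'cV[C]_d) : ip (u - v) w = ip u w - ip v w.
Proof. by rewrite ipDl -scaleN1r ipZl rmorphN1 mulN1r. Qed.

Lemma ip0r d (u : 'cV[C]_d) : ip u 0 = 0.
Proof. by rewrite /ip mulmx0 mxE. Qed.

Lemma ip0l d (u : 'cV[C]_d) : ip 0 u = 0.
Proof. by rewrite /ip adjmx0 mul0mx mxE. Qed.

Lemma ip_sumr d (u : 'cV[C]_d) I (r : seq I) (P : pred I) F :
  ip u (\sum_(i <- r | P i) F i) = \sum_(i <- r | P i) ip u (F i).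
Proof. exact: (big_morph _ (@ipDr _ u) (ip0r u)). Qed.

Lemma ip_conj d (u v : 'cV[C]_d) : (ip u v)^* = ip v u.
Proof. by rewrite /ip -adjmxE adjmxM adjmxK. Qed.

Lemma ip_adjl d e (A : 'M[C]_(e, d)) u v : ip (adjmx A *m u) v = ip u (A *m v).
Proof. by rewrite /ip adjmxM adjmxK mulmxA. Qed.

Lemma ip_adjr d e (A : 'M[C]_(e, d)) u v : ip u (adjmx A *m v) = ip (A *m u) v.
Proof. by rewrite -[in RHS](adjmxK A) ip_adjl. Qed.

Lemma ipnE d (u : 'cV[C]_d) : ip u u = \sum_i `|u i 0| ^+ 2.
Proof. by rewrite ipE; apply: eq_bigr => i _; rewrite sqr_normc mulrC. Qed.

Lemma ip_ge0 d (u : 'cV[C]_d) : 0 <= ip u u.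
Proof. by rewrite ipnE sumr_ge0 // => i _; rewrite exprn_ge0. Qed.

Lemma ip_eq0 d (u : 'cV[C]_d) : (ip u u == 0) = (u == 0).
Proof.
apply/eqP/eqP => [|->]; last exact: ip0r.
rewrite ipnE => /eqP; rewrite psumr_eq0 => [/allP u0|i _]; last exact: exprn_ge0.
apply/colP => i; have := u0 i (mem_index_enum _).
by rewrite expf_eq0 normr_eq0 /= mxE => /eqP.
Qed.

Lemma ip_gt0 d (u : 'cV[C]_d) : u != 0 -> 0 < ip u u.
Proof. by rewrite lt_def ip_ge0 ip_eq0 andbT. Qed.

Lemma unitary_adjl n (A : 'M[C]_n) : unitary A -> adjmx A *m A = 1%:M.
Proof. exact: mulmx1C. Qed.

Lemma unitary1 n : unitary (1%:M : 'M[C]_n).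
Proof. by rewrite /unitary adjmx1 mulmx1. Qed.

Lemma unitaryM n (A B : 'M[C]_n) : unitary A -> unitary B -> unitary (A *m B).
Proof.
move=> uA uB; rewrite /unitary adjmxM mulmxA -(mulmxA A B) uB mulmx1; exact: uA.
Qed.

Lemma unitary_adj n (A : 'M[C]_n) : unitary A -> unitary (adjmx A).
Proof. by move=> uA; rewrite /unitary adjmxK unitary_adjl. Qed.

Lemma ip_unitary n (A : 'M[C]_n) u v : unitary A -> ip (A *m u) (A *m v) = ip u v.
Proof. by move=> uA; rewrite -ip_adjr mulmxA unitary_adjl // mul1mx. Qed.

Lemma conjc_unit (t : C) : `|t| = 1 -> t * t^* = 1.
Proof. by move=> t1; rewrite -sqr_normc t1 expr1n. Qed.

Lemma unit_neq0 (t : C) : `|t| = 1 -> t != 0.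
Proof. by move=> t1; rewrite -normr_eq0 t1 oner_eq0. Qed.

Lemma conjc_unitV (t : C) : `|t| = 1 -> t^* = t^-1.
Proof.
move=> t1; apply: (mulfI (unit_neq0 t1)).
by rewrite conjc_unit // divff // unit_neq0.
Qed.

Lemma normc1_conj (t : C) : t * t^* = 1 -> `|t| = 1.
Proof.
by rewrite -sqr_normc => /eqP; rewrite sqrp_eq1 ?normr_ge0 // => /eqP.
Qed.

Lemma conjcB1 (t : C) : (t - 1)^* = t^* - 1.
Proof. by rewrite rmorphB rmorph1. Qed.

(** For a unit vector [u], [t |-> refl u t] is a homomorphism from the circle to U(n) with
    derivative [u *m adjmx u] at 1; it plays the role of a one-parameter group. *)
Definition refl n (u : 'cV[C]_n) (t : C) : 'M[C]_n :=
  1%:M + (t - 1) *: (u *m adjmx u).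

Lemma ip1_mx n (u : 'cV[C]_n) : ip u u = 1 -> adjmx u *m u = 1%:M.
Proof. by rewrite ip_mx => ->. Qed.

Lemma proj1_idem n (u : 'cV[C]_n) : ip u u = 1 ->
  u *m adjmx u *m (u *m adjmx u) = u *m adjmx u.
Proof.
by move=> u1; rewrite mulmxA -(mulmxA u) (ip1_mx u1) mulmx1.
Qed.

Lemma reflM n (u : 'cV[C]_n) s t : ip u u = 1 ->
  refl u s *m refl u t = refl u (s * t).
Proof.
move=> u1; rewrite /refl mulmxDl mul1mx mulmxDr mulmx1 -scalemxAl -scalemxAr.
rewrite proj1_idem // scalerA -addrA; congr (_ + _).
rewrite addrA -!scalerDl; congr (_ *: _); ring.
Qed.

Lemma refl1 n (u : 'cV[C]_n) : refl u 1 = 1%:M.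
Proof. by rewrite /refl subrr scale0r addr0. Qed.

Lemma adj_refl n (u : 'cV[C]_n) t : adjmx (refl u t) = refl u (t^*).
Proof. by rewrite /refl adjmxD adjmx1 adjmxZ adjmxM adjmxK conjcB1. Qed.

Lemma refl_unitary n (u : 'cV[C]_n) t :
  ip u u = 1 -> `|t| = 1 -> unitary (refl u t).
Proof. by move=> u1 t1; rewrite /unitary adj_refl reflM // conjc_unit ?refl1. Qed.

Lemma refl_conj n (A : 'M[C]_n) u t : unitary A ->
  refl (A *m u) t = A *m refl u t *m adjmx A.
Proof.
move=> uA; rewrite /refl mulmxDr mulmx1 mulmxDl uA adjmxM; congr (_ + _).
by rewrite -scalemxAr -scalemxAl !mulmxA.
Qed.

Lemma refl_mul n (u v : 'cV[C]_n) t :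
  refl u t *m v = v + ((t - 1) * ip u v) *: u.
Proof.
rewrite /refl mulmxDl mul1mx -scalemxAl -mulmxA ip_mx mul_mx_scalar.
by rewrite scalerA.
Qed.

(* The complex reflection is taken along the direction [q - p]. *)
Lemma refl_transitive n (p q : 'cV[C]_n) :
  ip p p = 1 -> ip q q = 1 -> p != q ->
  exists (u : 'cV[C]_n) (t : C),
    [/\ ip u u = 1, `|t| = 1, refl u t *m p = q &
        forall y, ip y p = ip y q -> ip y u = 0].
Proof.
move=> p1 q1 pq.
have nz : ip (q - p) (q - p) != 0 by rewrite ip_eq0 subr_eq0 eq_sym.
set z := ip p q.
have zE : ip q p = z^* by rewrite ip_conj.
have NE : ip (q - p) (q - p) = (1 - z) + (1 - z^*).
  by rewrite ipBl !ipBr p1 q1 zE -/z; ring.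
have z1 : 1 - z != 0.
  apply/eqP => z1; move: nz; rewrite NE.
  have -> : 1 - z^* = (1 - z)^* by rewrite rmorphB rmorph1.
  by rewrite z1 rmorph0 addr0 eqxx.
have z1' : 1 - z^* != 0.
  have -> : 1 - z^* = (1 - z)^* by rewrite rmorphB rmorph1.
  by rewrite conjc_eq0.
pose r := sqrtC (ip (q - p) (q - p)).
have r0 : r != 0 by rewrite sqrtC_eq0.
have rge0 : 0 <= r by rewrite sqrtC_ge0 ip_ge0.
have rr : r^* = r.
  by have /conj_Creal := ger0_real rge0.
(* The factor is forced: [p] moves by exactly [q - p] when [(t - 1) * ip (q - p) p = ip (q - p) (q -
   p)], and [ip (q - p) p] is the conjugate of [z] minus 1. *)
exists (r^-1 *: (q - p)), (- ((1 - z) / (1 - z^*))); split.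
- rewrite ipZl ipZr conjc_inv rr mulrA -invfM -expr2 sqrtCK mulVf //.
- rewrite normrN normrM normrV ?unitfE // -(normcJ (1 - z)) rmorphB rmorph1 divff //.
  by rewrite normr_eq0.
- rewrite refl_mul ipZl conjc_inv rr scalerA ipBl p1 zE.
  suff -> : (- ((1 - z) / (1 - z^*)) - 1) * (r^-1 * (z^* - 1)) / r = 1.
    by rewrite scale1r addrC subrK.
  rewrite (_ : _ / r = (- ((1 - z) / (1 - z^*)) - 1) * (z^* - 1) / r ^+ 2); last first.
    by field; rewrite r0 z1'.
  rewrite /r sqrtCK NE.
  by field; rewrite -NE nz z1'.
- by move=> y yy; rewrite ipZr ipBr yy subrr mulr0.
Qed.

End Hermitian.

(** * Haar integrals *)

Section Continuity.
Variables (R : realType) (n : nat) (G : 'M[R[i]]_n -> Prop).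
Local Notation C := R[i].
Local Notation "x ^*" := (@conjc _ x) : ring_scope.
Implicit Types f g : 'M[C]_n -> C.

Lemma scal_contP f : scal_cont_on G f <->
  (forall A, G A -> forall e : R, 0 < e -> exists2 dl : R, 0 < dl &
    forall A', G A' -> (forall i j, `|A' i j - A i j| < dl%:C) ->
      `|f A' - f A| < e%:C).
Proof.
split=> cf A GA e e0; have [dl dl0 h] := cf A GA e e0; exists dl => // A' GA' AA'.
- by have := h A' GA' AA' 0 0; rewrite !mxE eqxx.
- by move=> k l; rewrite !mxE !ord1 eqxx; apply: h.
Qed.

Lemma scal_cont_ext f g : (forall A, G A -> f A = g A) ->
  scal_cont_on G f -> scal_cont_on G g.
Proof.
move=> fg /scal_contP cf; apply/scal_contP => A GA e /(cf A GA) [d d0 h].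
by exists d => // A' GA' AA'; rewrite -!fg //; apply: h.
Qed.

Lemma scal_cont_const (c : C) : scal_cont_on G (fun=> c).
Proof.
by apply/scal_contP => A _ e e0; exists 1 => // *; rewrite subrr normr0 ltcR.
Qed.

Lemma scal_cont_coord i j : scal_cont_on G (fun A => A i j).
Proof. by apply/scal_contP => A _ e e0; exists e. Qed.

Lemma scal_cont_add f g : scal_cont_on G f -> scal_cont_on G g ->
  scal_cont_on G (fun A => f A + g A).
Proof.
move=> /scal_contP cf /scal_contP cg; apply/scal_contP => A GA e e0.
have e2 : 0 < e / 2 by rewrite divr_gt0.
have [d1 d10 h1] := cf A GA _ e2; have [d2 d20 h2] := cg A GA _ e2.
exists (Num.min d1 d2) => [|A' GA' AA']; first by rewrite lt_min d10.
have -> : f A' + g A' - (f A + g A) = (f A' - f A) + (g A' - g A) by ring.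
apply: le_lt_trans (ler_normD _ _) _.
rewrite [e]splitr rmorphD ltrD //; [apply: h1|apply: h2] => // i j.
all: by apply: lt_le_trans (AA' i j) _; rewrite lecR ge_min lexx ?orbT.
Qed.

Lemma scal_cont_conj f : scal_cont_on G f -> scal_cont_on G (fun A => (f A)^*).
Proof.
move=> /scal_contP cf; apply/scal_contP => A GA e /(cf A GA) [d d0 h].
by exists d => // A' GA' AA'; rewrite -rmorphB normcJ; apply: h.
Qed.

Lemma normc_real (z : C) : exists2 r : R, 0 <= r & `|z| = r%:C.
Proof.
have /complex_realP [r rE] := normr_real z.
by exists r => //; rewrite -ler0c -rE.
Qed.

Lemma scal_cont_mul f g : scal_cont_on G f -> scal_cont_on G g ->
  scal_cont_on G (fun A => f A * g A).
Proof.
move=> /scal_contP cf /scal_contP cg; apply/scal_contP => A GA e e0.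
have [F F0 FE] := normc_real (f A); have [K K0 KE] := normc_real (g A).
have S0 : 0 < F + K + 2 by lra.
(* Errors below [eta <= 1] in both factors change the product by at most [eta * (F + K + 1)], which
   is strictly below [e]. *)
pose eta := Num.min 1 (e / (F + K + 2)).
have eta0 : 0 < eta by rewrite lt_min ltr01 divr_gt0.
have eta1 : eta <= 1 by rewrite ge_min lexx.
have etae : eta * (F + K + 2) <= e by rewrite -ler_pdivlMr // ge_min lexx orbT.
have [d1 d10 h1] := cf A GA _ eta0; have [d2 d20 h2] := cg A GA _ eta0.
exists (Num.min d1 d2) => [|A' GA' AA']; first by rewrite lt_min d10.
have ha : `|f A' - f A| < eta%:C.
  by apply: h1 => // i j; apply: lt_le_trans (AA' i j) _; rewrite lecR ge_min lexx.
have hb : `|g A' - g A| < eta%:C.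
  by apply: h2 => // i j; apply: lt_le_trans (AA' i j) _; rewrite lecR ge_min lexx orbT.
have [a a0 aE] := normc_real (f A' - f A).
have [b b0 bE] := normc_real (g A' - g A).
rewrite aE ltcR in ha; rewrite bE ltcR in hb.
have -> : f A' * g A' - f A * g A = ((f A' - f A) * g A + f A * (g A' - g A))
   + (f A' - f A) * (g A' - g A) by ring.
apply: (@le_lt_trans _ _ ((a * K + F * b) + a * b)%:C); last by rewrite ltcR; nra.
rewrite rmorphD; apply: le_trans (ler_normD _ _) _; apply: lerD.
  rewrite rmorphD; apply: le_trans (ler_normD _ _) _.
  by rewrite !normrM aE KE FE bE !rmorphM.
by rewrite normrM aE bE rmorphM.
Qed.

Lemma scal_cont_opp f : scal_cont_on G f -> scal_cont_on G (fun A => - f A).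
Proof.
move=> /scal_contP cf; apply/scal_contP => A GA e /(cf A GA) [d d0 h].
by exists d => // A' GA' AA'; rewrite -opprD normrN; apply: h.
Qed.

Lemma scal_cont_exp f m : scal_cont_on G f -> scal_cont_on G (fun A => f A ^+ m).
Proof.
move=> cf; elim: m => [|m IH]; first exact: scal_cont_const.
rewrite (_ : (fun A => f A ^+ m.+1) = (fun A => f A * f A ^+ m)).
  exact: scal_cont_mul.
by apply: boolp.funext => A; rewrite exprS.
Qed.

Lemma scal_cont_sum I (r : seq I) (F : I -> 'M[C]_n -> C) :
  (forall i, scal_cont_on G (F i)) ->
  scal_cont_on G (fun A => \sum_(i <- r) F i A).
Proof.
move=> cF; elim: r => [|i r IH].
  rewrite (_ : (fun A => _) = fun=> 0); first exact: scal_cont_const.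
  by apply: boolp.funext => A; rewrite big_nil.
rewrite (_ : (fun A => _) = (fun A => F i A + \sum_(i <- r) F i A)).
  exact: scal_cont_add.
by apply: boolp.funext => A; rewrite big_cons.
Qed.

Lemma scal_cont_entry q r (f : 'M[C]_n -> 'M[C]_(q, r)) k l :
  cont_on G f -> scal_cont_on G (fun A => f A k l).
Proof.
move=> cf; apply/scal_contP => A GA e /(cf A GA) [d d0 h].
by exists d => // A' GA' AA'; apply: h.
Qed.

End Continuity.

Lemma scal_cont_weaken (R : realType) (n : nat) (G H : 'M[R[i]]_n -> Prop)
    (f : 'M[R[i]]_n -> R[i]) :
  (forall A, G A -> H A) -> scal_cont_on H f -> scal_cont_on G f.
Proof.
move=> GH /scal_contP cf; apply/scal_contP => A GA e e0.
have [d d0 h] := cf A (GH _ GA) e e0.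
by exists d => // A' GA' AA'; apply: h => //; apply: GH.
Qed.

Section HaarTheory.
Variables (R : realType) (n : nat) (G : 'M[R[i]]_n -> Prop).
Variable I : ('M[R[i]]_n -> R[i]) -> R[i].
Hypothesis hI : is_haar_integral G I.
Local Notation C := R[i].
Local Notation "x ^*" := (@conjc _ x) : ring_scope.
Implicit Types f g : 'M[C]_n -> C.

Lemma haar_const (c : C) : I (fun=> c) = c.
Proof.
have := haar_scale hI c (@scal_cont_const _ _ G 1); rewrite (haar_one hI) mulr1 => h.
by rewrite -[RHS]h; congr I; apply: boolp.funext => A; rewrite mulr1.
Qed.

Lemma haar_sum J (r : seq J) (F : J -> 'M[C]_n -> C) :
  (forall i, scal_cont_on G (F i)) ->
  I (fun A => \sum_(i <- r) F i A) = \sum_(i <- r) I (F i).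
Proof.
move=> cF; elim: r => [|i r IH].
  rewrite big_nil -[RHS](haar_const 0).
  by congr I; apply: boolp.funext => A; rewrite big_nil.
rewrite big_cons -IH -(haar_add hI) //; last exact: scal_cont_sum.
by congr I; apply: boolp.funext => A; rewrite big_cons.
Qed.

Lemma haar_scaler f (c : C) : scal_cont_on G f ->
  I (fun A => f A * c) = I f * c.
Proof.
move=> cf; rewrite mulrC -(haar_scale hI) //.
by congr I; apply: boolp.funext => A; rewrite mulrC.
Qed.

Lemma haar_opp f : scal_cont_on G f -> I (fun A => - f A) = - I f.
Proof.
move=> cf; rewrite -mulN1r -(haar_scale hI) //.
by congr I; apply: boolp.funext => A; rewrite mulN1r.
Qed.

Lemma haar_le f g : scal_cont_on G f -> scal_cont_on G g ->
  (forall A, G A -> f A <= g A) -> I f <= I g.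
Proof.
move=> cf cg fg; rewrite -subr_ge0 -haar_opp // -(haar_add hI) //; last first.
  exact: scal_cont_opp.
apply: (haar_pos hI) => [|A GA]; last by rewrite subr_ge0 fg.
by apply: scal_cont_add => //; apply: scal_cont_opp.
Qed.

(* A real function is [((f + 1)^2 - (f - 1)^2) / 4], so positivity alone makes
   its integral real. *)
Lemma haar_conj f : scal_cont_on G f -> I (fun A => (f A)^*) = (I f)^*.
Proof.
have real_int g : scal_cont_on G g -> (forall A, (g A)^* = g A) -> (I g)^* = I g.
  move=> cg rg.
  have csq (c : C) : scal_cont_on G (fun A => (g A + c) ^+ 2).
    by apply: scal_cont_exp; apply: scal_cont_add => //; apply: scal_cont_const.
  have sq (c : C) : c^* = c -> (I (fun A => (g A + c) ^+ 2))^* = I (fun A => (g A + c) ^+ 2).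
    move=> rc; have : 0 <= I (fun A => (g A + c) ^+ 2).
      apply: (haar_pos hI) => // A _.
      by rewrite expr2 -{2}(rg A) -{2}rc -rmorphD mulcJ_ge0.
    by case: (I _) => a b; rewrite lecE /= => /andP [/eqP -> _]; rewrite oppr0.
  have -> : I g = 4^-1 * (I (fun A => (g A + 1) ^+ 2) - I (fun A => (g A + -1) ^+ 2)).
    rewrite -haar_opp // -(haar_add hI) //; last exact: scal_cont_opp.
    rewrite -(haar_scale hI); last first.
      by apply: scal_cont_add => //; apply: scal_cont_opp.
    by congr I; apply: boolp.funext => A; field.
  by rewrite conjcM conjcB conjcV conjc_nat !sq ?conjcN ?conjc1.
move=> cf.
pose u A := f A + (f A)^*; pose v A := 'i * (f A - (f A)^*).
have cfc := scal_cont_conj cf.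
have cu : scal_cont_on G u by apply: scal_cont_add.
have cd : scal_cont_on G (fun A => f A - (f A)^*).
  by apply: scal_cont_add => //; apply: scal_cont_opp.
have cv : scal_cont_on G v by apply: scal_cont_mul => //; apply: scal_cont_const.
have ru : (I u)^* = I u.
  by apply: real_int => // A; rewrite /u conjcD conjcK addrC.
have rv : (I v)^* = I v.
  apply: real_int => // A; rewrite /v conjcM conjcB conjcK conjci; ring.
move: ru rv.
have -> : I u = I f + I (fun A => (f A)^*) by apply: (haar_add hI).
have -> : I v = 'i * (I f - I (fun A => (f A)^*)).
  by rewrite -haar_opp // -(haar_add hI) //; [exact: (haar_scale hI)|exact: scal_cont_opp].
rewrite conjcM conjcB !conjcD conjci.
set a := I f; set b := I _ => e1.
rewrite mulNr -mulrN => /(mulfI _) e2.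
have {}e2 : - (a^* - b^*) = a - b.
  by apply: e2; apply/eqP; case=> /eqP; rewrite oner_eq0.
have : 2 * b = 2 * a^*.
  have -> : 2 * b = (a + b) - (a - b) by ring.
  by rewrite -e1 -e2; ring.
by move/mulfI; apply; rewrite pnatr_eq0.
Qed.

End HaarTheory.

(** * Matrix-valued integrals and averages of a representation *)

Section MatrixIntegral.
Variables (R : realType) (n : nat) (G : 'M[R[i]]_n -> Prop).
Variable I : ('M[R[i]]_n -> R[i]) -> R[i].
Hypothesis hI : is_haar_integral G I.
Local Notation C := R[i].
Local Notation "x ^*" := (@conjc _ x) : ring_scope.

Definition mcont p q (F : 'M[C]_n -> 'M[C]_(p, q)) :=
  forall i j, scal_cont_on G (fun A => F A i j).

Definition mxint p q (F : 'M[C]_n -> 'M[C]_(p, q)) : 'M[C]_(p, q) :=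
  \matrix_(i, j) I (fun A => F A i j).

Lemma mcont_mull p q r (X : 'M[C]_(p, q)) (F : 'M[C]_n -> 'M[C]_(q, r)) :
  mcont F -> mcont (fun A => X *m F A).
Proof.
move=> cF i j.
rewrite (_ : (fun A => _) = fun A => \sum_k X i k * F A k j); last first.
  by apply: boolp.funext => A; rewrite mxE.
by apply: scal_cont_sum => k; apply: scal_cont_mul => //; apply: scal_cont_const.
Qed.

Lemma mcont_mulr p q r (F : 'M[C]_n -> 'M[C]_(p, q)) (X : 'M[C]_(q, r)) :
  mcont F -> mcont (fun A => F A *m X).
Proof.
move=> cF i j.
rewrite (_ : (fun A => _) = fun A => \sum_k F A i k * X k j); last first.
  by apply: boolp.funext => A; rewrite mxE.
by apply: scal_cont_sum => k; apply: scal_cont_mul => //; apply: scal_cont_const.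
Qed.

Lemma mxint_mull p q r (X : 'M[C]_(p, q)) (F : 'M[C]_n -> 'M[C]_(q, r)) :
  mcont F -> mxint (fun A => X *m F A) = X *m mxint F.
Proof.
move=> cF; apply/matrixP => i j; rewrite !mxE.
rewrite (_ : (fun A => _) = fun A => \sum_k X i k * F A k j); last first.
  by apply: boolp.funext => A; rewrite mxE.
rewrite (haar_sum hI) => [|k]; last first.
  by apply: scal_cont_mul => //; apply: scal_cont_const.
by apply: eq_bigr => k _; rewrite mxE (haar_scale hI).
Qed.

Lemma mxint_mulr p q r (F : 'M[C]_n -> 'M[C]_(p, q)) (X : 'M[C]_(q, r)) :
  mcont F -> mxint (fun A => F A *m X) = mxint F *m X.
Proof.
move=> cF; apply/matrixP => i j; rewrite !mxE.
rewrite (_ : (fun A => _) = fun A => \sum_k F A i k * X k j); last first.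
  by apply: boolp.funext => A; rewrite mxE.
rewrite (haar_sum hI) => [|k]; last first.
  by apply: scal_cont_mul => //; apply: scal_cont_const.
by apply: eq_bigr => k _; rewrite mxE (haar_scaler hI).
Qed.

Lemma mxint_const p q (X : 'M[C]_(p, q)) : mxint (fun=> X) = X.
Proof. by apply/matrixP => i j; rewrite mxE (haar_const hI). Qed.

Lemma mxint_local p q (F H : 'M[C]_n -> 'M[C]_(p, q)) :
  mcont F -> (forall A, G A -> F A = H A) -> mxint F = mxint H.
Proof.
move=> cF FH; have cH : mcont H.
  by move=> i j; apply: scal_cont_ext (cF i j) => A GA; rewrite FH.
apply/matrixP => i j; rewrite !mxE.
by apply: (haar_local hI) => // A GA; rewrite FH.
Qed.

Lemma mxint_linv p q (F : 'M[C]_n -> 'M[C]_(p, q)) g :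
  G g -> mcont F -> mxint (fun A => F (g *m A)) = mxint F.
Proof.
move=> Gg cF; apply/matrixP => i j; rewrite !mxE.
exact: (haar_linv hI Gg (cF i j)).
Qed.

Lemma mxint_rinv p q (F : 'M[C]_n -> 'M[C]_(p, q)) g :
  G g -> mcont F -> mxint (fun A => F (A *m g)) = mxint F.
Proof.
move=> Gg cF; apply/matrixP => i j; rewrite !mxE.
exact: (haar_rinv hI Gg (cF i j)).
Qed.

Lemma mxint_eq p d q (X : 'M[C]_(p, d)) (F : 'M[C]_n -> 'M[C]_d) (Y : 'M[C]_(d, q)) Z :
  mcont F -> (forall A, G A -> X *m F A *m Y = Z) -> X *m mxint F *m Y = Z.
Proof.
move=> cF h; rewrite -mxint_mull // -mxint_mulr; last exact: mcont_mull.
rewrite -[RHS]mxint_const; apply: mxint_local => //.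
by apply: mcont_mulr; apply: mcont_mull.
Qed.

Variables (d : nat) (rho : 'M[C]_n -> 'M[C]_d).
Hypothesis hrho : is_unitary_rep rho.
Hypothesis GU : forall A, G A -> unitary A.
Hypothesis Gadj : forall A, G A -> G (adjmx A).

Lemma repM A B : unitary A -> unitary B -> rho (A *m B) = rho A *m rho B.
Proof. by case: hrho => h _ _; apply: h. Qed.

Lemma rep_unitary A : unitary A -> unitary (rho A).
Proof. by case: hrho => _ h _; apply: h. Qed.

Lemma rep1 : rho 1%:M = 1%:M.
Proof.
have u1 := rep_unitary (@unitary1 R n).
have := repM (@unitary1 R n) (@unitary1 R n); rewrite mulmx1 => e.
by rewrite -u1 {2}e -mulmxA u1 mulmx1.
Qed.

Lemma rep_adj A : unitary A -> rho (adjmx A) = adjmx (rho A).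
Proof.
move=> uA; have ua := unitary_adj uA.
rewrite -[LHS]mul1mx -(unitary_adjl (rep_unitary uA)) -mulmxA -repM //.
by rewrite uA rep1 mulmx1.
Qed.

Lemma mcont_rep : mcont rho.
Proof.
move=> i j; apply: (scal_cont_weaken GU); apply: scal_cont_entry.
by case: hrho.
Qed.

Lemma mxint_rep_fixl A : G A -> rho A *m mxint rho = mxint rho.
Proof.
move=> GA; rewrite -(mxint_mull _ mcont_rep) -[RHS](mxint_linv GA mcont_rep).
apply: mxint_local => [|B GB]; first exact/mcont_mull/mcont_rep.
by rewrite repM //; apply: GU.
Qed.

Lemma mxint_rep_fixr A : G A -> mxint rho *m rho A = mxint rho.
Proof.
move=> GA; rewrite -(mxint_mulr _ mcont_rep) -[RHS](mxint_rinv GA mcont_rep).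
apply: mxint_local => [|B GB]; first exact/mcont_mulr/mcont_rep.
by rewrite repM //; apply: GU.
Qed.

Lemma mxint_rep_eq p q (X : 'M[C]_(p, d)) (Y : 'M[C]_(d, q)) Z :
  (forall A, G A -> X *m rho A *m Y = Z) -> X *m mxint rho *m Y = Z.
Proof. exact/mxint_eq/mcont_rep. Qed.

Lemma mxint_rep_fixing q (Y : 'M[C]_(d, q)) :
  (forall A, G A -> rho A *m Y = Y) -> mxint rho *m Y = Y.
Proof.
move=> h; rewrite -[mxint _]mul1mx; apply: mxint_rep_eq => A GA.
by rewrite mul1mx h.
Qed.

(** Invariance under inversion is not an axiom of the integral. Instead, left invariance and closure
    of [G] under adjoints give [adjmx P *m rho A = adjmx P] on [G]; integrating,
    [adjmx P *m P = adjmx P], whose left side is self-adjoint. *)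
Lemma mxint_rep_herm : adjmx (mxint rho) = mxint rho.
Proof.
set P := mxint rho.
have fix_adj A : G A -> adjmx P *m rho A *m 1%:M = adjmx P.
  move=> GA; rewrite mulmx1 -[A]adjmxK rep_adj; last exact/GU/Gadj.
  by rewrite -adjmxM mxint_rep_fixl //; apply: Gadj.
have := mxint_rep_eq fix_adj; rewrite mulmx1 -/P => e.
by rewrite -[RHS]adjmxK -[in RHS]e adjmxM adjmxK e.
Qed.

Lemma mxint_rep_idem : mxint rho *m mxint rho = mxint rho.
Proof. exact/mxint_rep_fixing/mxint_rep_fixl. Qed.

End MatrixIntegral.

(** * The Laplacian *)

Section Spectral.
Variable R : realType.
Local Notation C := R[i].
Local Notation "x ^*" := (@conjc _ x) : ring_scope.

Lemma spectral_decomposition n (A : 'M[C]_n) : A *m adjmx A = adjmx A *m A ->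
  exists (U : 'M[C]_n) (t : 'rV[C]_n),
    unitary U /\ A = U *m diag_mx t *m adjmx U.
Proof.
move=> nA; have adjE m p (B : 'M[C]_(m, p)) : map_mx Num.conj B^T = adjmx B.
  by apply/matrixP => i j; rewrite !mxE.
have /orthomx_spectralP AE : A \is normalmx.
  by apply/normalmxP; rewrite adjE.
have uP := spectral_unitarymx A.
exists (adjmx (spectralmx A)), (spectral_diag A); split.
  by apply: unitary_adj; move/unitarymxP: uP; rewrite adjE.
by rewrite adjmxK -adjE -invmx_unitary.
Qed.

Lemma ip_diag n (t : 'rV[C]_n) x y :
  ip x (diag_mx t *m y) = \sum_i t 0 i * ((x i 0)^* * y i 0).
Proof.
rewrite ipE; apply: eq_bigr => i _; rewrite mxE (bigD1 i) //= big1 => [|j ji].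
  by rewrite mxE eqxx mulr1n addr0; ring.
by rewrite mxE eq_sym (negbTE ji) mulr0n mul0r.
Qed.

(** The Rayleigh bound is kept with the eigenvalue so that any single test vector bounds it from
    above. *)
Definition is_min_eigenvalue d (M : 'M[C]_d) (a : C) :=
  is_lambda_min M a /\ forall y, a * ip y y <= ip y (M *m y).

Lemma hermitian_min_eigenvalue d (M : 'M[C]_d) : (0 < d)%N -> adjmx M = M ->
  exists a, is_min_eigenvalue M a.
Proof.
case: d M => // d M _ hM.
have [U [t [uU ME]]] : exists (U : 'M[C]_d.+1) (t : 'rV[C]_d.+1),
    unitary U /\ M = U *m diag_mx t *m adjmx U.
  by apply: spectral_decomposition; rewrite hM.
(* The order of [C] compares only numbers with equal imaginary parts, so the eigenvalues must be
   shown real before a least one can be chosen. *)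
have real_ip y : ip y (M *m y) \is Num.real.
  apply/complex_realP; have := ip_conj y (M *m y).
  rewrite -{2}hM ip_adjl; case: (ip _ _) => a b [] /eqP.
  by rewrite eq_sym -addr_eq0 -mulr2n mulrn_eq0 /= => /eqP ->; exists a.
pose f i : 'cV[C]_d.+1 := U *m delta_mx i 0.
have eigen i : f i != 0 /\ M *m f i = t 0 i *: f i.
  rewrite /f.
  have d0 : (delta_mx i 0 : 'cV[C]_d.+1) != 0.
    by apply/eqP => /matrixP /(_ i 0) /eqP; rewrite !mxE !eqxx oner_eq0.
  split; first by rewrite -ip_eq0 ip_unitary // ip_eq0.
  rewrite ME -!mulmxA (mulmxA (adjmx U)) (unitary_adjl uU) mul1mx scalemxAr.
  congr (_ *m _); apply/colP => k; rewrite !mxE (bigD1 k) //= big1 => [|j jk].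
    rewrite !mxE eqxx addr0 andbT; case: eqP => [->|_]; first by rewrite mulr1.
    by rewrite !mulr0.
  by rewrite !mxE eq_sym (negbTE jk) mul0r.
have real_t i : t 0 i \is Num.real.
  have [nz e] := eigen i; have := real_ip (f i).
  have N0 : ip (f i) (f i) != 0 by rewrite ip_eq0.
  rewrite e ipZr => h; rewrite -(mulfK N0 (t 0 i)) realM // realV ger0_real //.
  exact: ip_ge0.
pose r i : R := complex.Re (t 0 i).
have tE i : t 0 i = (r i)%:C by rewrite RRe_real.
case: (@arg_minP _ _ _ 0 xpredT r isT) => i0 _ hmin.
have ray y : (t 0 i0) * ip y y <= ip y (M *m y).
  have -> : y = U *m (adjmx U *m y) by rewrite mulmxA uU mul1mx.
  move: (adjmx U *m y) => z.
  rewrite ME -!mulmxA (mulmxA (adjmx U)) (unitary_adjl uU) mul1mx !ip_unitary //.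
  rewrite ip_diag ipE mulr_sumr; apply: ler_sum => i _.
  apply: ler_wpM2r; first by rewrite mulrC mulcJ_ge0.
  by rewrite !tE lecR hmin.
exists (t 0 i0); split=> //; split.
  by have [nz e] := eigen i0; exists (f i0).
move=> b [y y0 yb]; have := ray y; rewrite yb ipZr ler_pM2r //; exact: ip_gt0.
Qed.

End Spectral.

(** * The Laplacian as a sum of averaging projections *)

Section Laplacian.
Variables (R : realType) (n : nat).
Local Notation C := R[i].
Local Notation "x ^*" := (@conjc _ x) : ring_scope.
Variables (w : {set 'I_n} -> R) (hw : forall B, 0 <= w B).
Variable haar : {set 'I_n} -> ('M[C]_n -> C) -> C.
Hypothesis hhaar : forall B, is_haar_integral (UB B) (haar B).
Variables (d : nat) (rho : 'M[C]_n -> 'M[C]_d).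
Hypothesis hrho : is_unitary_rep rho.

Lemma UB_unitary B (A : 'M[C]_n) : UB B A -> unitary A.
Proof. by case. Qed.

Lemma UB_adj B (A : 'M[C]_n) : UB B A -> UB B (adjmx A).
Proof.
move=> [uA hA]; split=> [|i j ij]; first exact: unitary_adj.
by rewrite adjmxE hA 1?andbC // conjc_nat eq_sym.
Qed.

Lemma UB_sub (B B' : {set 'I_n}) (A : 'M[C]_n) : B \subset B' -> UB B A -> UB B' A.
Proof.
move=> sB [uA hA]; split=> // i j ij; apply: hA; apply: contra ij.
by case/andP=> /(subsetP sB) -> /(subsetP sB) ->.
Qed.

Lemma torus_diag (s : 'M[C]_n) i j : torus s -> s i j = (s i i) *+ (i == j).
Proof. by move=> [_ hs]; case: eqP => [->|/eqP /hs]. Qed.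

Lemma torus_adj (s : 'M[C]_n) : torus s -> torus (adjmx s).
Proof.
move=> [us hs]; split=> [|i j ij]; first exact: unitary_adj.
by rewrite adjmxE hs 1?eq_sym // conjc0.
Qed.

Lemma torus_mull p (s : 'M[C]_n) (A : 'M_(n, p)) i j : torus s ->
  (s *m A) i j = s i i * A i j.
Proof.
move=> ts; rewrite mxE (bigD1 i) //= big1 ?addr0 // => k ki.
by rewrite torus_diag // eq_sym (negbTE ki) mul0r.
Qed.

Lemma torus_mulr p (s : 'M[C]_n) (A : 'M_(p, n)) i j : torus s ->
  (A *m s) i j = A i j * s j j.
Proof.
move=> ts; rewrite mxE (bigD1 j) //= big1 ?addr0 // => k kj.
by rewrite torus_diag // (negbTE kj) mulr0.
Qed.

Lemma torus_norm (s : 'M[C]_n) i : torus s -> `|s i i| = 1.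
Proof.
move=> ts; apply: normc1_conj; case: (ts) => /matrixP /(_ i i).
by rewrite torus_mull // adjmxE mxE eqxx.
Qed.

Lemma UB_torus_conj B (s A : 'M[C]_n) : torus s -> UB B A ->
  UB B (s *m A *m adjmx s).
Proof.
move=> ts [uA hA]; have [us _] := ts; split.
  by apply: unitaryM; [apply: unitaryM | apply: unitary_adj].
move=> i j ij; rewrite torus_mulr; last exact: torus_adj.
rewrite torus_mull // hA // adjmxE; case: eqP => [->|_].
  by rewrite mulr1 conjc_unit // torus_norm.
by rewrite mulr0 mul0r.
Qed.

Definition avg B := mxint (haar B) rho.

Lemma laplacianE : laplacian w haar rho = \sum_B (w B)%:C *: (1%:M - avg B).
Proof. by []. Qed.

Lemma avg_fixl B A : UB B A -> rho A *m avg B = avg B.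
Proof. exact: (mxint_rep_fixl (hhaar B) hrho (@UB_unitary B)). Qed.

Lemma avg_fixr B A : UB B A -> avg B *m rho A = avg B.
Proof. exact: (mxint_rep_fixr (hhaar B) hrho (@UB_unitary B)). Qed.

Lemma avg_herm B : adjmx (avg B) = avg B.
Proof.
exact: (mxint_rep_herm (hhaar B) hrho (@UB_unitary B) (@UB_adj B)).
Qed.

Lemma avg_idem B : avg B *m avg B = avg B.
Proof. exact: (mxint_rep_idem (hhaar B) hrho (@UB_unitary B)). Qed.

Lemma avg_eq B p q (X : 'M[C]_(p, d)) (Y : 'M[C]_(d, q)) Z :
  (forall A, UB B A -> X *m rho A *m Y = Z) -> X *m avg B *m Y = Z.
Proof. exact: (mxint_rep_eq (hhaar B) hrho (@UB_unitary B)). Qed.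

Lemma avg_fixing B q (Y : 'M[C]_(d, q)) :
  (forall A, UB B A -> rho A *m Y = Y) -> avg B *m Y = Y.
Proof. exact: (mxint_rep_fixing (hhaar B) hrho (@UB_unitary B)). Qed.

(* The torus normalises [U_B]; a Haar integral in the sense of
   [is_haar_integral] is not assumed invariant under such outer conjugations,
   so the commutation is read off from the projections themselves. *)
Lemma avg_torus B s : torus s -> rho s *m avg B = avg B *m rho s.
Proof.
have half z : torus z ->
    avg B *m (rho z *m avg B *m adjmx (rho z)) = rho z *m avg B *m adjmx (rho z).
  move=> tz; have [uz _] := tz; apply: avg_fixing => A hA.
  have uA := UB_unitary hA; have uz' := unitary_adj uz.
  have rz := rep_unitary hrho uz.
  rewrite !mulmxA -(repM hrho uA uz).
  have -> : A *m z = z *m (adjmx z *m A *m adjmx (adjmx z)).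
    by rewrite adjmxK !mulmxA uz mul1mx.
  have hA' := UB_torus_conj (torus_adj tz) hA.
  rewrite (repM hrho uz (UB_unitary hA')) -(mulmxA (rho z)) avg_fixl //.
move=> ts; have [us _] := ts; have rs := rep_unitary hrho us.
(* [h1] puts the range of the conjugate [Q] inside that of [avg B]; [h2], for the inverse of [s],
   gives the reverse inclusion. Two orthogonal projections with the same range are equal. *)
have h1 := half _ ts.
have h2 := half _ (torus_adj ts).
rewrite (rep_adj hrho us) adjmxK in h2.
pose Q := rho s *m avg B *m adjmx (rho s).
have hQ : adjmx Q = Q by rewrite /Q !adjmxM adjmxK avg_herm mulmxA.
have PQ : Q *m avg B = avg B.
  move: h2 => /(congr1 (fun X => rho s *m X *m adjmx (rho s))).
  rewrite -!mulmxA rs mulmx1 !mulmxA rs mul1mx => h2.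
  exact: h2.
have QP : Q *m avg B = Q by rewrite -{1}hQ -(avg_herm B) -adjmxM h1 hQ.
have e : Q = avg B by rewrite -QP.
by rewrite -[in RHS]e /Q -!mulmxA unitary_adjl // mulmx1.
Qed.

Lemma UB1_torus i (A : 'M[C]_n) : UB [set i] A -> torus A.
Proof.
move=> [uA hA]; split=> // j k jk; rewrite hA ?(negbTE jk) // !inE.
by apply/negP => /andP [/eqP ji /eqP ki]; rewrite ji ki eqxx in jk.
Qed.

(** [avg [set i]] integrates [rho] over diagonal unitaries, each of which commutes with [avg B]. *)
Lemma avg1_commute i B : avg [set i] *m avg B = avg B *m avg [set i].
Proof.
have cr := mcont_rep hrho (@UB_unitary [set i]).
rewrite -(mxint_mull (hhaar [set i]) (avg B) cr).
rewrite -(mxint_mulr (hhaar [set i]) (avg B) cr).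
apply: (mxint_local (hhaar [set i])) => [|s hs]; first exact: mcont_mulr.
by rewrite avg_torus //; apply: UB1_torus hs.
Qed.

Lemma avg_sub (B B' : {set 'I_n}) : B \subset B' -> avg B' *m avg B = avg B'.
Proof.
move=> sB; rewrite -[LHS]mulmx1; apply: avg_eq => A hA.
by rewrite mulmx1 avg_fixr //; apply: UB_sub hA.
Qed.

Lemma avg_dual B x : ip x ((1%:M - avg B) *m x) =
  ip ((1%:M - avg B) *m x) ((1%:M - avg B) *m x).
Proof.
rewrite -ip_adjr mulmxA; congr (ip _ (_ *m _)).
rewrite adjmxD adjmxN adjmx1 avg_herm mulmxBl mul1mx mulmxBr mulmx1.
by rewrite avg_idem subrr subr0.
Qed.

Lemma laplacian_herm : adjmx (laplacian w haar rho) = laplacian w haar rho.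
Proof.
rewrite laplacianE adjmx_sum; apply: eq_bigr => B _.
by rewrite adjmxZ conjc_real adjmxD adjmxN adjmx1 avg_herm.
Qed.

Lemma ip_laplacian x : ip x (laplacian w haar rho *m x) =
  \sum_B (w B)%:C * ip x ((1%:M - avg B) *m x).
Proof.
rewrite laplacianE mulmx_suml ip_sumr; apply: eq_bigr => B _.
by rewrite -scalemxAl ipZr.
Qed.

Lemma rayleigh_fixed j a (x : 'cV[C]_d) : x != 0 ->
  (forall A, UB (~: [set j]) A -> rho A *m x = x) ->
  is_min_eigenvalue (laplacian w haar rho) a ->
  a <= \sum_(B : {set 'I_n} | j \in B) (w B)%:C.
Proof.
move=> x0 fx [_ /(_ x)]; rewrite ip_laplacian => h.
rewrite -(ler_pM2r (ip_gt0 x0)); apply: le_trans h _.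
rewrite (bigID (fun B : {set 'I_n} => j \in B)) /= [X in _ + X]big1 => [|B jB].
  rewrite addr0 mulr_suml; apply: ler_sum => B _; rewrite ler_wpM2l ?ler0c //.
  rewrite mulmxBl mul1mx ipBr gerBl -avg_idem -mulmxA -{1}avg_herm ip_adjr.
  exact: ip_ge0.
rewrite mulmxBl mul1mx avg_fixing ?subrr ?ip0r ?mulr0 // => A hA; apply: fx.
by apply: UB_sub hA; rewrite subsetC sub1set inE.
Qed.

Lemma eigen_killed j a (x : 'cV[C]_d) : x != 0 ->
  laplacian w haar rho *m x = a *: x -> avg [set j] *m x = 0 ->
  \sum_(B : {set 'I_n} | j \in B) (w B)%:C <= a.
Proof.
move=> x0 xa jx; rewrite -(ler_pM2r (ip_gt0 x0)) -[leRHS]ipZr -xa ip_laplacian.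
rewrite [leRHS](bigID (fun B : {set 'I_n} => j \in B)) /= mulr_suml.
rewrite -[leLHS]addr0; apply: lerD.
  apply: ler_sum => B jB; rewrite mulmxBl mul1mx -(@avg_sub [set j] B) ?sub1set //.
  by rewrite -mulmxA jx mulmx0 subr0.
apply: sumr_ge0 => B _; rewrite mulr_ge0 ?ler0c // avg_dual; exact: ip_ge0.
Qed.

Lemma laplacian_commute j :
  laplacian w haar rho *m avg [set j] = avg [set j] *m laplacian w haar rho.
Proof.
rewrite laplacianE mulmx_suml mulmx_sumr; apply: eq_bigr => B _.
rewrite -scalemxAl -scalemxAr; congr (_ *: _).
by rewrite mulmxBl mulmxBr mul1mx mulmx1 avg1_commute.
Qed.

Fixpoint iter_avg (s : seq 'I_n) (x : 'cV[C]_d) : 'cV[C]_d :=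
  if s is i :: s' then avg [set i] *m iter_avg s' x else x.

Lemma iter_avg_dichotomy a s (x : 'cV[C]_d) : x != 0 -> laplacian w haar rho *m x = a *: x ->
  (exists j, \sum_(B : {set 'I_n} | j \in B) (w B)%:C <= a) \/ iter_avg s x != 0.
Proof.
move=> x0 xa.
suff [hj|[]] : (exists j, \sum_(B : {set 'I_n} | j \in B) (w B)%:C <= a) \/
   iter_avg s x != 0 /\ laplacian w haar rho *m iter_avg s x = a *: iter_avg s x.
- by left.
- by right.
elim: s => [|i s [hj|[n0 e]]] /=; [by right|by left|].
have [z|nz] := eqVneq (avg [set i] *m iter_avg s x) 0.
  by left; exists i; apply: eigen_killed z.
by right; split=> //; rewrite mulmxA laplacian_commute -mulmxA e scalemxAr.
Qed.

Lemma iter_avg_fixed s i x t : i \in s -> UB [set i] t ->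
  rho t *m iter_avg s x = iter_avg s x.
Proof.
move=> + ht; elim: s => //= j s IH; rewrite inE => /orP [/eqP <-|/IH e].
  by rewrite mulmxA avg_fixl.
by rewrite mulmxA (avg_torus _ (UB1_torus ht)) -mulmxA e.
Qed.

Lemma ip_iter_avg s x y : (forall i t, UB [set i] t -> rho t *m y = y) ->
  ip y (iter_avg s x) = ip y x.
Proof.
move=> fy; elim: s => //= i s IH.
by rewrite -{1}avg_herm ip_adjr avg_fixing // => A; apply: fy.
Qed.

Definition torus1 (s : 'M[C]_n) (i : 'I_n) : 'M[C]_n :=
  diag_mx (\row_j if j == i then s i i else 1).

Lemma torus1E s i j k : torus1 s i j k = (if j == i then s i i else 1) *+ (j == k).
Proof. by rewrite !mxE. Qed.

Lemma torus1_UB s i : torus s -> UB [set i] (torus1 s i).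
Proof.
move=> ts; split; last first.
  move=> j k; rewrite torus1E !inE; have [->|jk] := eqVneq j k.
    by rewrite andbb => /negbTE ->.
  by [].
apply/matrixP => j k; rewrite mxE (bigD1 j) //= big1 ?addr0; last first.
  by move=> l lj; rewrite torus1E (eq_sym j l) (negbTE lj) mulr0n mul0r.
rewrite adjmxE !torus1E eqxx mxE (eq_sym k j) mulr1n.
have [<-|_] := eqVneq j k; last by rewrite !mulr0n conjc0 mulr0.
rewrite !mulr1n; case: ifP => _; last by rewrite conjc1 mulr1.
by rewrite conjc_unit // torus_norm.
Qed.

(** A diagonal unitary is the product of its one-coordinate factors [torus1 s i]; [T r] is the
    partial product over [r]. *)
Lemma torus_fixed (y : 'cV[C]_d) : (forall i t, UB [set i] t -> rho t *m y = y) ->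
  torinv rho y.
Proof.
move=> fy s ts.
pose T (r : seq 'I_n) : 'M[C]_n := diag_mx (\row_j if j \in r then s j j else 1).
suff h (r : seq 'I_n) : uniq r -> unitary (T r) /\ rho (T r) *m y = y.
  have [_ {2}<-] := h _ (enum_uniq 'I_n); congr (rho _ *m _).
  by apply/matrixP => i j; rewrite !mxE mem_enum torus_diag.
elim: r => [_|i r IH /= /andP [ir ur]].
  have -> : T [::] = 1%:M by apply/matrixP => i j; rewrite !mxE.
  by split; [exact: unitary1 | rewrite (rep1 hrho) mul1mx].
have [uT eT] := IH ur.
have hi := torus1_UB i ts; have ui := UB_unitary hi.
have -> : T (i :: r) = torus1 s i *m T r.
  rewrite /T /torus1 mulmx_diag; congr diag_mx; apply/rowP => j.
  rewrite !mxE inE; have [->|_] := eqVneq j i; last by rewrite mul1r.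
  by rewrite (negbTE ir) mulr1.
by split; [exact: unitaryM | rewrite (repM hrho) // -mulmxA eT; apply: fy hi].
Qed.

(** A vector [y] surviving all the singleton averages is torus-invariant. Moving the self-adjoint
    averages to the other side gives [ip y y = ip y v], which is 0 because [v] is orthogonal to the
    invariants; so some average must kill. *)
Lemma perp_eigenvalue_ge a :
  is_eigenvalue_on_torinv_perp rho (laplacian w haar rho) a ->
  exists j, \sum_(B : {set 'I_n} | j \in B) (w B)%:C <= a.
Proof.
move=> [v v0 [perp va]].
have [//|nz] := iter_avg_dichotomy (enum 'I_n) v0 va.
have fy i t : UB [set i] t ->
    rho t *m iter_avg (enum 'I_n) v = iter_avg (enum 'I_n) v.
  by apply: iter_avg_fixed; rewrite mem_enum.
have := ip_iter_avg (enum 'I_n) v fy.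
rewrite {2}/ip (perp _ (torus_fixed fy)) mxE => /eqP.
by rewrite ip_eq0 (negbTE nz).
Qed.

End Laplacian.

(** * Representations of the circle *)

Section Circle.
Variable R : realType.
Local Notation C := R[i].
Local Notation "x ^*" := (@conjc _ x) : ring_scope.

(* A rational parametrisation of the unit circle. *)
Definition cayley (e : R) : C := (1 + 'i * e%:C) / (1 - 'i * e%:C).

Lemma cayley_den (e : R) : 1 - 'i * e%:C != 0.
Proof. by apply/eqP => /eqP; rewrite eq_complex /= => /andP [/eqP]; lra. Qed.

Lemma cayley_conj (e : R) : (1 - 'i * e%:C)^* = 1 + 'i * e%:C.
Proof. by rewrite conjcB conjcM conjc1 conjci conjc_real; ring. Qed.

Lemma cayley_norm (e : R) : `|cayley e| = 1.
Proof.
rewrite /cayley normrM normrV ?unitfE ?cayley_den // -cayley_conj normcJ divff //.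
by rewrite normr_eq0 cayley_den.
Qed.

Lemma cayley_inj : injective cayley.
Proof.
move=> a b; rewrite /cayley => e.
have : (1 + 'i * a%:C) * (1 - 'i * b%:C) = (1 + 'i * b%:C) * (1 - 'i * a%:C).
  by move: e => /eqP; rewrite eqr_div ?cayley_den // => /eqP.
move=> {}e; have : 2 * 'i * (a%:C - b%:C) = 0.
  have -> : 2 * 'i * (a%:C - b%:C) = (1 + 'i * a%:C) * (1 - 'i * b%:C) -
     (1 + 'i * b%:C) * (1 - 'i * a%:C) :> C by ring.
  by rewrite e subrr.
move=> /eqP; rewrite !mulf_eq0 pnatr_eq0 /= subr_eq0 => /orP [|/eqP [] //].
by rewrite eq_complex /= oner_eq0 andbF.
Qed.

(** The injective Cayley map evaluated at integers gives more points of the circle than [p] could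
    have roots. *)
Lemma circle_poly_eq0 (p : {poly C}) : (forall t, `|t| = 1 -> p.[t] = 0) -> p = 0.
Proof.
move=> h; apply/eqP/negPn/negP => p0.
pose rs := [seq cayley k%:R | k <- iota 0 (size p)].
have : (size rs < size p)%N.
  apply: max_poly_roots => //.
    by apply/allP => _ /mapP [k _ ->]; apply/eqP/h/cayley_norm.
  rewrite map_inj_uniq ?iota_uniq // => a b /cayley_inj /eqP.
  by rewrite eqr_nat => /eqP.
by rewrite size_map size_iota ltnn.
Qed.

Lemma circle_poly_eq0_away (p q : {poly C}) : q != 0 ->
  (forall t, `|t| = 1 -> q.[t] != 0 -> p.[t] = 0) -> p = 0.
Proof.
move=> q0 h; have /eqP : p * q = 0.
  apply: circle_poly_eq0 => t t1; rewrite hornerM.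
  by have [->|/h ->] := eqVneq q.[t] 0; rewrite ?mulr0 // mul0r.
by rewrite mulf_eq0 (negbTE q0) orbF => /eqP.
Qed.

Lemma circle_exp_neq1 a b : a != b -> exists2 s : C, `|s| = 1 & s ^+ a != s ^+ b.
Proof.
move=> ab; apply: boolp.contrapT => h.
have /eqP : 'X^a - 'X^b = 0 :> {poly C}.
  apply: circle_poly_eq0 => t t1; rewrite !hornerE.
  apply/eqP; rewrite subr_eq0; apply/negPn/negP => tab; apply: h; by exists t.
rewrite subr_eq0 => /eqP /(congr1 (fun p : {poly C} => p`_a)).
by rewrite !coefXn eqxx (negbTE ab) => /eqP; rewrite oner_eq0.
Qed.

End Circle.

(** * Fourier coefficients of a representation along a coordinate circle *)

Section CircleReps.
Variables (R : realType) (n d : nat).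
Local Notation C := R[i].
Local Notation "x ^*" := (@conjc _ x) : ring_scope.

Definition evec (i : 'I_n) : 'cV[C]_n := delta_mx i 0.

Lemma ip_evec i (v : 'cV[C]_n) : ip (evec i) v = v i 0.
Proof.
rewrite ipE (bigD1 i) //= big1 => [|j ji].
  by rewrite !mxE !eqxx conjc1 mul1r addr0.
by rewrite !mxE (negbTE ji) conjc0 mul0r.
Qed.

Lemma ip_evec1 i : ip (evec i) (evec i) = 1.
Proof. by rewrite ip_evec !mxE !eqxx. Qed.

Lemma mulmx_evec p (A : 'M[C]_(p, n)) i k : (A *m evec i) k 0 = A k i.
Proof. by rewrite /evec -colE mxE. Qed.

Lemma evec_proj i : evec i *m adjmx (evec i) = delta_mx i i.
Proof.
apply/matrixP => k l; rewrite !mxE big_ord1 !mxE !eqxx !andbT.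
by rewrite conjc_nat -natrM mulnb.
Qed.

Lemma refl_evecE i t j k : refl (evec i) t j k =
  (j == k)%:R + (t - 1) * ((j == i) && (k == i))%:R.
Proof. by rewrite /refl evec_proj !mxE. Qed.

Lemma UB1_refl i (A : 'M[C]_n) : UB [set i] A -> A = refl (evec i) (A i i).
Proof.
move=> [uA hA]; apply/matrixP => j k; rewrite refl_evecE.
case ij: ((j == i) && (k == i)).
  by case/andP: ij => /eqP -> /eqP ->; rewrite eqxx mulr1 mulr1n addrC subrK.
by rewrite mulr0 addr0 hA // !inE ij.
Qed.

Lemma UB1_norm i (A : 'M[C]_n) : UB [set i] A -> `|A i i| = 1.
Proof. by move=> hA; apply/torus_norm/UB1_torus/hA. Qed.

Lemma refl_evec_UB i t : `|t| = 1 -> UB [set i] (refl (evec i) t).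
Proof.
move=> t1; split=> [|j k]; first exact/refl_unitary/t1/ip_evec1.
by rewrite refl_evecE !inE => /negbTE ->; rewrite mulr0 addr0.
Qed.

Variables (rho : 'M[C]_n -> 'M[C]_d) (i : 'I_n).
Hypothesis hrho : is_unitary_rep rho.
Variable I : ('M[C]_n -> C) -> C.
Hypothesis hI : is_haar_integral (UB [set i]) I.
Local Notation G := (UB [set i]).
Local Notation tau t := (rho (refl (evec i) t)).

Let cz : scal_cont_on G (fun A : 'M[C]_n => A i i) := @scal_cont_coord _ _ _ i i.

(** On [UB [set i]] this is the character [z ^ (a - b)]; two natural exponents avoid negative powers
    and match the terms of a squared geometric sum. *)
Definition mono a b (A : 'M[C]_n) : C := A i i ^+ a * (A i i)^* ^+ b.

Lemma monoE a b A : mono a b A = A i i ^+ a * (A i i ^+ b)^*.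
Proof. by rewrite /mono conjcX. Qed.

Lemma mono_cont a b : scal_cont_on G (mono a b).
Proof.
by apply: scal_cont_mul; apply: scal_cont_exp => //; apply: scal_cont_conj.
Qed.

Lemma refl_evec_coord s (A : 'M[C]_n) : (refl (evec i) s *m A) i i = s * A i i.
Proof.
rewrite mxE (bigD1 i) //= big1 => [|j ji].
  by rewrite refl_evecE eqxx mulr1 mulr1n addr0 addrC subrK.
by rewrite refl_evecE (negbTE ji) andbF eq_sym (negbTE ji) mulr0 addr0 mul0r.
Qed.

Lemma mono_shift a b s A : `|s| = 1 ->
  mono a b (refl (evec i) s *m A) = s ^+ a * s ^- b * mono a b A.
Proof.
move=> s1; rewrite /mono refl_evec_coord conjcM !exprMn conjc_unitV // exprVn.
ring.
Qed.

(** Translation by [s] multiplies the integral by [s ^ (a - b)], so for [a != b] a suitable [s]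
    forces it to vanish. *)
Lemma haar_mono a b : I (mono a b) = (a == b)%:R.
Proof.
have [<-|ab] := eqVneq a b.
  rewrite -[RHS](haar_const hI); apply: (haar_local hI); first exact: mono_cont.
    exact: scal_cont_const.
  by move=> A hA; rewrite /mono -exprMn conjc_unit ?expr1n // UB1_norm.
have [s s1 sab] := circle_exp_neq1 R ab.
have := haar_linv hI (refl_evec_UB i s1) (mono_cont a b).
rewrite (_ : (fun A => _) = (fun A => s ^+ a * s ^- b * mono a b A)); last first.
  by apply: boolp.funext => A; apply: mono_shift.
rewrite (haar_scale hI); last exact: mono_cont.
move=> /eqP; rewrite -subr_eq0 -{2}[I _]mul1r -mulrBl mulf_eq0 => /orP [|/eqP //].
rewrite subr_eq0 => /eqP e; case/eqP: sab.
have sb : s ^+ b != 0 by rewrite expf_neq0 // unit_neq0.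
by rewrite -[RHS]mul1r -e mulfVK.
Qed.

(** Its range lies in the weight space on which [tau s] acts as [s ^ (b - a)]; [fourier_shift]
    states this without negative exponents. *)
Definition fourier a b := mxint I (fun A => mono a b A *: rho A).

Lemma fourier_cont a b : mcont G (fun A => mono a b A *: rho A).
Proof.
move=> k l; apply: (@scal_cont_ext _ _ _ (fun A => mono a b A * rho A k l)).
  by move=> A _; rewrite mxE.
by apply: scal_cont_mul; [exact: mono_cont | apply: (mcont_rep hrho (@UB_unitary _ _ _))].
Qed.

Lemma fourier_shift a b s : `|s| = 1 ->
  s ^+ a *: (tau s *m fourier a b) = s ^+ b *: fourier a b.
Proof.
move=> s1; have hs := refl_evec_UB i s1; have us := UB_unitary hs.
have sb : s ^+ b != 0 by rewrite expf_neq0 // unit_neq0.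
rewrite [in RHS]/fourier -[in RHS](mxint_linv hI hs (fourier_cont a b)).
have -> : mxint I (fun A => mono a b (refl (evec i) s *m A) *: rho (refl (evec i) s *m A))
   = mxint I (fun A => ((s ^+ a * s ^- b) *: tau s) *m (mono a b A *: rho A)).
  apply/esym/(mxint_local hI) => [|A hA]; first exact/mcont_mull/fourier_cont.
  rewrite mono_shift // (repM hrho us (UB_unitary hA)).
  by rewrite -scalemxAl -scalemxAr scalerA.
rewrite (mxint_mull hI); last exact: fourier_cont.
by rewrite -scalemxAl scalerA mulrCA mulfV ?mulr1.
Qed.


End CircleReps.

(** * Fejer means and the Laurent expansion of a representation *)

Section Laurent.
Variables (R : realType) (n d : nat).
Local Notation C := R[i].
Local Notation "x ^*" := (@conjc _ x) : ring_scope.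

Lemma ip_coord_le m (x : 'cV[C]_m) j : `|x j 0| ^+ 2 <= ip x x.
Proof.
rewrite ipnE (bigD1 j) //= lerDl; apply: sumr_ge0 => k _; exact: exprn_ge0.
Qed.

Lemma coord_le_sqrt m (x : 'cV[C]_m) j : `|x j 0| <= sqrtC (ip x x).
Proof.
rewrite -(@ler_pXn2r _ 2) ?nnegrE ?sqrtC_ge0 ?ip_ge0 // sqrtCK; exact: ip_coord_le.
Qed.

Lemma ip_mul_small m (M : 'M[C]_m) (x : 'cV[C]_m) (eta : C) : 0 <= eta ->
  (forall k l, `|M k l| <= eta) ->
  ip (M *m x) (M *m x) <= (m%:R * eta) ^+ 2 * m%:R * ip x x.
Proof.
move=> eta0 hM; set r := sqrtC (ip x x).
have r0 : 0 <= r by rewrite sqrtC_ge0 ip_ge0.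
have -> : (m%:R * eta) ^+ 2 * m%:R * ip x x = (m%:R * eta * r) ^+ 2 * m%:R.
  by rewrite -[ip x x]sqrtCK -/r !exprMn; ring.
have sc (c : C) : \sum_(k < m) c = m%:R * c.
  by rewrite sumr_const card_ord mulr_natl.
rewrite ipnE [leRHS]mulrC -(sc ((m%:R * eta * r) ^+ 2)).
apply: ler_sum => k _; rewrite ler_pXn2r ?nnegrE ?mulr_ge0 // mxE.
apply: le_trans (ler_norm_sum _ _ _) _.
rewrite -mulrA -(sc (eta * r)).
by apply: ler_sum => j _; rewrite normrM ler_pM // coord_le_sqrt.
Qed.

Variables (rho : 'M[C]_n -> 'M[C]_d) (i : 'I_n).
Hypothesis hrho : is_unitary_rep rho.
Variable I : ('M[C]_n -> C) -> C.
Hypothesis hI : is_haar_integral (UB [set i]) I.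
Local Notation G := (UB [set i]).
Local Notation tau t := (rho (refl (evec R i) t)).

(** The right side is [2 * ip x x] minus the squared length of [rho A *m x - x]. Near the identity
    that length is at most the length of [x], by continuity; away from it the trivial bound
    [- 2 * ip x x] suffices. *)
Lemma rep_near_identity : exists2 K : R, 0 <= K & forall A, G A -> forall x,
  ip x x * (1 - K%:C * `|A i i - 1| ^+ 2) <= ip x (rho A *m x) + ip (rho A *m x) x.
Proof.
have [_ _ /(_ 1%:M (@unitary1 _ _))] := hrho.
(* Chosen so that the bound of [ip_mul_small] becomes [d^3 / (d + 1)^4 <= 1]; using [d + 1] covers
   [d = 0]. *)
pose eta : R := (d.+1%:R ^+ 2)^-1.
have eta0 : 0 < eta by rewrite invr_gt0 exprn_gt0 // ltr0Sn.
case/(_ eta eta0) => dl dl0 hdl.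
(* With this constant the left factor [1 - K r^2] is at most -2 once [r >= dl]. *)
exists (3 / dl ^+ 2) => [|A hA x]; first by rewrite divr_ge0 // ?exprn_ge0 // ltW.
have uA := UB_unitary hA; have uR := rep_unitary hrho uA.
have rx : ip (rho A *m x) (rho A *m x) = ip x x by apply: ip_unitary.
have [r r0 rE] := normc_real (A i i - 1); rewrite rE.
have x0 := ip_ge0 x.
have [rd|rd] := ltP r dl.
  apply: (@le_trans _ _ (ip x x)).
    rewrite -[leRHS]mulr1 ler_wpM2l // gerBl mulr_ge0 // ?exprn_ge0 ?ler0c //.
    by rewrite divr_ge0 // ?exprn_ge0 // ltW.
  have -> : ip x (rho A *m x) + ip (rho A *m x) x =
    2 * ip x x - ip ((rho A - rho 1%:M) *m x) ((rho A - rho 1%:M) *m x).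
    by rewrite (rep1 hrho) mulmxBl mul1mx ipBr !ipBl rx; ring.
  have hs : ip ((rho A - rho 1%:M) *m x) ((rho A - rho 1%:M) *m x) <= ip x x.
    have hent k l : `|(rho A - rho 1%:M) k l| <= eta%:C.
      rewrite !mxE; apply/ltW/hdl => // j j'.
      rewrite (UB1_refl hA) refl_evecE mxE addrAC subrr add0r normrM rE.
      apply: le_lt_trans (_ : _ <= r%:C) _; last by rewrite ltcR.
      by case: (_ && _); rewrite ?normr1 ?normr0 ?mulr1 ?mulr0 ?ler0c.
    apply: le_trans (ip_mul_small x _ hent) _; first by rewrite ler0c ltW.
    rewrite -[leRHS]mul1r ler_wpM2r //.
    have -> : (d%:R * eta%:C) ^+ 2 * d%:R = ((d%:R * eta) ^+ 2 * d%:R)%:C.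
      by rewrite !(rmorphM, rmorphXn, rmorph_nat).
    rewrite [leRHS](_ : 1 = 1%:C) // lecR /eta exprMn -exprVn -exprM.
    set c : R := d.+1%:R; have c1 : 1 <= c by rewrite ler1n.
    have dc : d%:R = c - 1 :> R by rewrite /c -natr1 addrK.
    have c0 : 0 < c ^+ 4 by rewrite exprn_gt0 // (lt_le_trans ltr01).
    rewrite mulrAC exprVn ler_pdivrMr // mul1r dc.
    apply: (@le_trans _ _ (c ^+ 3)).
      by rewrite -exprSr lerXn2r // ?nnegrE ?subr_ge0 // ?gerBl // (le_trans ler01 c1).
    exact: ler_weXn2l.
  by rewrite mulr_natl mulr2n -addrA lerDl subr_ge0.
apply: (@le_trans _ _ (- 2 * ip x x)).
  rewrite [leLHS]mulrC ler_wpM2r // -rmorphXn -rmorphM.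
  rewrite (_ : 1 - _ = (1 - 3 / dl ^+ 2 * r ^+ 2)%:C); last by rewrite rmorphB rmorph1.
  rewrite (_ : - 2 = (- 2)%:C); last by rewrite rmorphN rmorph_nat.
  rewrite lecR.
  have : dl ^+ 2 <= r ^+ 2 by rewrite lerXn2r // nnegrE ltW.
  move=> h; have : 3 <= 3 / dl ^+ 2 * r ^+ 2.
    rewrite mulrAC ler_pdivlMr ?exprn_gt0 //; lra.
  lra.
rewrite -subr_ge0 (_ : _ - _ = ip (x + rho A *m x) (x + rho A *m x)) ?ip_ge0 //.
by rewrite ipDr !ipDl rx; ring.
Qed.

Local Notation mono := (@mono R n i).
Local Notation fourier := (@fourier R n d rho i I).

(** This is [N] times the classical Fejer kernel, that is the squared modulus of a geometric sum. *)
Definition fejer N (A : 'M[C]_n) : C := \sum_(a < N) \sum_(b < N) mono a b A.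

Lemma conjc_sum J (r : seq J) (F : J -> C) :
  (\sum_(j <- r) F j)^* = \sum_(j <- r) (F j)^*.
Proof. exact: (big_morph _ (@conjcD R) (conjc0 R)). Qed.

Lemma fejer_sq N A : fejer N A = (\sum_(a < N) A i i ^+ a) * (\sum_(a < N) A i i ^+ a)^*.
Proof.
rewrite conjc_sum mulr_suml; apply: eq_bigr => a _.
by rewrite mulr_sumr; apply: eq_bigr => b _; rewrite monoE.
Qed.

Lemma fejer_ge0 N A : 0 <= fejer N A.
Proof. by rewrite fejer_sq mulcJ_ge0. Qed.

Lemma fejer_cont N : scal_cont_on G (fejer N).
Proof. by do 2 (apply: scal_cont_sum => ?); exact: mono_cont. Qed.

Lemma haar_fejer N : I (fejer N) = N%:R.
Proof.
rewrite (haar_sum hI) => [|a]; last by apply: scal_cont_sum => b; exact: mono_cont.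
rewrite -[in RHS](card_ord N) -sumr_const; apply: eq_bigr => a _.
rewrite (haar_sum hI) => [|b]; last exact: mono_cont.
rewrite (bigD1 a) //= big1 => [|b ba]; first by rewrite (haar_mono hI) eqxx addr0.
by rewrite (haar_mono hI) eq_sym (negbTE (ba : val b != val a)).
Qed.

(** The geometric sum telescopes against [z - 1], leaving the squared modulus of [z ^ N - 1]. Its
    integral is 2 whatever [N > 0] is, whereas the kernel itself has integral [N]. *)
Lemma fejer_sq_dist N A : G A ->
  fejer N A * `|A i i - 1| ^+ 2 = 2 - mono N 0 A - mono 0 N A.
Proof.
move=> hA; rewrite fejer_sq sqr_normc.
set z := A i i; set S := \sum_(a < N) z ^+ a.
have zz : z ^+ N * (z ^+ N)^* = 1 by rewrite conjcX -exprMn conjc_unit ?expr1n ?UB1_norm.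
have -> : S * S^* * ((z - 1) * (z - 1)^*) = ((z - 1) * S) * ((z - 1) * S)^*.
  by rewrite conjcM; ring.
rewrite -subrX1 !monoE conjcB !expr0 conjc1 -/z.
by rewrite mulrBl !mulrBr zz; ring.
Qed.

Lemma haar_fejer_dist N : (0 < N)%N -> I (fun A => fejer N A * `|A i i - 1| ^+ 2) = 2.
Proof.
move=> N0; have cc := @mono_cont R n i.
have c1 : scal_cont_on G (fun A => 2 - mono N 0 A).
  by apply: scal_cont_add; [exact: scal_cont_const | exact/scal_cont_opp/cc].
have c2 : scal_cont_on G (fun A => 2 - mono N 0 A - mono 0 N A).
  by apply: scal_cont_add => //; exact/scal_cont_opp/cc.
rewrite -(haar_local hI c2); last first.
- by move=> A hA; rewrite fejer_sq_dist.
- by apply: scal_cont_ext c2 => A hA; rewrite fejer_sq_dist.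
rewrite (haar_add hI c1); last exact/scal_cont_opp/cc.
rewrite (haar_add hI); [|exact: scal_cont_const|exact/scal_cont_opp/cc].
rewrite !(haar_opp hI) // (haar_const hI) !(haar_mono hI).
by rewrite (gtn_eqF N0) (ltn_eqF N0) !subr0.
Qed.

(* [<x, tau(t) x>] has real part at least [|x|^2 (1 - K |t - 1|^2) / 2], while the
   Fejer kernel of order [N] has integral [N] and integral [2] against [|t - 1|^2]:
   the Fejer mean of the representation has no kernel as soon as [N > 2 K]. *)
Lemma fejer_avg_injective : exists2 N, (0 < N)%N &
  \sum_(a < N) \sum_(b < N) fourier a b \in unitmx.
Proof.
have [K K0 hK] := rep_near_identity.
pose N := (Num.truncn (2 * K)).+1.
have NK : 2 * K < N%:R by apply: truncnS_gt.
exists N => //.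
set E := \sum_(a < N) _.
have cr := mcont_rep hrho (@UB_unitary _ _ [set i]).
have EE : E = mxint I (fun A => fejer N A *: rho A).
  apply/matrixP => k l; rewrite summxE !mxE.
  rewrite (_ : (fun A => _) = fun A => \sum_(a < N) \sum_(b < N) mono a b A * rho A k l).
    rewrite (haar_sum hI) => [|a].
      apply: eq_bigr => a _; rewrite summxE (haar_sum hI) => [|b].
        apply: eq_bigr => b _; rewrite mxE; congr I; apply: boolp.funext => A.
        by rewrite mxE.
      by apply: scal_cont_mul; [exact: mono_cont | exact: cr].
    apply: scal_cont_sum => b.
    by apply: scal_cont_mul; [exact: mono_cont | exact: cr].
  apply: boolp.funext => A; rewrite mxE /fejer mulr_suml; apply: eq_bigr => a _.
  by rewrite mulr_suml.
have cF : mcont G (fun A => fejer N A *: rho A).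
  move=> k l; apply: (@scal_cont_ext _ _ _ (fun A => fejer N A * rho A k l)).
    by move=> A _; rewrite mxE.
  by apply: scal_cont_mul; [exact: fejer_cont | exact: cr].
have kerE (x : 'cV[C]_d) : E *m x = 0 -> x = 0.
  move=> Ex; pose h A := ip x (rho A *m x).
  have ch : scal_cont_on G h.
    exact: (mcont_mull (adjmx x) (mcont_mulr x cr) 0 0).
  have cfh : scal_cont_on G (fun A => fejer N A * h A).
    by apply: scal_cont_mul => //; exact: fejer_cont.
  have Ifh : I (fun A => fejer N A * h A) = 0.
    have : (adjmx x *m E *m x) 0 0 = 0 by rewrite -mulmxA Ex mulmx0 mxE.
    rewrite EE -(mxint_mull hI) // -(mxint_mulr hI); last exact: mcont_mull.
    rewrite mxE => <-; congr I; apply: boolp.funext => A.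
    by rewrite -scalemxAr -scalemxAl mxE /h /ip mulmxA.
  have cfh' := scal_cont_conj cfh.
  have Ifh' : I (fun A => (fejer N A * h A)^*) = 0.
    by rewrite (haar_conj hI) // Ifh conjc0.
  have cd : scal_cont_on G (fun A => fejer N A * `|A i i - 1| ^+ 2).
    apply: scal_cont_mul; first exact: fejer_cont.
    apply: (@scal_cont_ext _ _ _ (fun A : 'M[C]_n => (A i i - 1) * (A i i - 1)^*)).
      by move=> A _; rewrite -sqr_normc.
    have c1 : scal_cont_on G (fun A : 'M[C]_n => A i i - 1).
      exact: (scal_cont_add (@scal_cont_coord _ _ _ i i) (@scal_cont_const _ _ _ (-1))).
    by apply: scal_cont_mul => //; exact: scal_cont_conj.
  pose g A := ip x x * fejer N A + - (ip x x * K%:C) * (fejer N A * `|A i i - 1| ^+ 2).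
  have cg1 : scal_cont_on G (fun A => ip x x * fejer N A).
    by apply: scal_cont_mul; [exact: scal_cont_const | exact: fejer_cont].
  have cg2 : scal_cont_on G (fun A => - (ip x x * K%:C) * (fejer N A * `|A i i - 1| ^+ 2)).
    by apply: scal_cont_mul => //; exact: scal_cont_const.
  have : I g <= I (fun A => fejer N A * h A + (fejer N A * h A)^*).
    apply: (haar_le hI) => [||A hA]; first exact: (scal_cont_add cg1 cg2).
      exact: (scal_cont_add cfh cfh').
    have := ler_wpM2l (fejer_ge0 N A) (hK A hA x).
    rewrite conjcM /h ip_conj.
    have -> : (fejer N A)^* = fejer N A.
      by rewrite fejer_sq conjcM conjcK mulrC.
    by rewrite /g; congr (_ <= _); ring.
  rewrite (haar_add hI cfh cfh') Ifh Ifh' addr0 /g (haar_add hI cg1 cg2).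
  rewrite (haar_scale hI) ?(haar_scale hI) //; last exact: fejer_cont.
  rewrite haar_fejer haar_fejer_dist // => hle.
  apply/eqP; rewrite -ip_eq0; apply/negPn/negP => x0.
  have xgt : 0 < ip x x by rewrite lt_def x0 ip_ge0.
  move: hle; rewrite (_ : _ + _ = ip x x * (N%:R - 2 * K)%:C); last first.
    by rewrite rmorphB rmorphM !rmorph_nat; ring.
  by rewrite pmulr_rle0 // -[0]/(0%:C) lecR subr_le0 leNgt NK.
rewrite -unitmx_tr -row_free_unit -kermx_eq0; apply/eqP/row_matrixP => k.
rewrite row0; apply: trmx_inj; rewrite trmx0; apply: kerE; apply: trmx_inj.
by rewrite trmx_mul trmxK trmx0 -row_mul mulmx_ker row0.
Qed.

(* Composing with an invertible Fejer mean, which is a finite combination of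
   eigenprojections, exhibits the representation itself as a Laurent polynomial;
   this replaces the classification of the continuous characters of the circle. *)
Lemma laurent_rep : exists (M K : nat) (Cm : nat -> 'M[C]_d),
  forall t, `|t| = 1 -> t ^+ M *: tau t = \sum_(m < K) t ^+ m *: Cm m.
Proof.
have [N N0 uE] := fejer_avg_injective; set E := (X in X \in unitmx) in uE.
(* [tau t] multiplies [fourier a b] by [t ^ (b - a)] with [a, b < N], so the prefactor [t ^ N] makes
   all exponents [N - a + b] natural and below [2 * N]. The right factor [invmx E] undoes the Fejer
   mean. *)
exists N, (2 * N)%N, (fun m => (\sum_(p : 'I_N * 'I_N | (N - p.1 + p.2 == m)%N)
   fourier p.1 p.2) *m invmx E) => t t1.
have -> : \sum_(m < 2 * N) t ^+ m *: ((\sum_(p : 'I_N * 'I_N | (N - p.1 + p.2 == m)%N)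
   fourier p.1 p.2) *m invmx E) =
   (\sum_(p : 'I_N * 'I_N) t ^+ (N - p.1 + p.2) *: fourier p.1 p.2) *m invmx E.
  have lt2 (p : 'I_N * 'I_N) : (N - p.1 + p.2 < 2 * N)%N.
    by case: p => [[a ha] [b hb]] /=; rewrite mul2n -addnn -addnS leq_add // leq_subr.
  rewrite (partition_big (fun p => Ordinal (lt2 p)) xpredT) //= mulmx_suml.
  apply: eq_bigr => m _; rewrite scalemxAl; congr (_ *m _); rewrite scaler_sumr.
  by apply: eq_big => [p|p /eqP <-].
rewrite -[LHS](mulmxK uE) -scalemxAl; congr (_ *m _).
rewrite -(pair_bigA _ (fun a b : 'I_N => t ^+ (N - a + b) *: fourier a b)) /=.
rewrite /E mulmx_sumr scaler_sumr; apply: eq_bigr => a _.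
rewrite mulmx_sumr scaler_sumr; apply: eq_bigr => b _.
have -> : t ^+ N = t ^+ (N - a) * t ^+ a by rewrite -exprD subnK // ltnW.
rewrite -scalerA.
by rewrite (fourier_shift hrho hI) // scalerA -exprD.
Qed.

End Laurent.

(** * A submultiplicative matrix norm and Taylor estimates on the circle *)

Section EntryNorm.
Variable R : realType.
Local Notation C := R[i].
Local Notation "x ^*" := (@conjc _ x) : ring_scope.

(** The entrywise l^1 norm is submultiplicative with constant 1, also for rectangular matrices, and
    needs no supremum. *)
Definition mnorm p q (A : 'M[C]_(p, q)) : C := \sum_i \sum_j `|A i j|.

Lemma mnorm_ge0 p q (A : 'M[C]_(p, q)) : 0 <= mnorm A.
Proof. by apply: sumr_ge0 => i _; apply: sumr_ge0. Qed.

Lemma mnorm_entry p q (A : 'M[C]_(p, q)) i j : `|A i j| <= mnorm A.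
Proof.
rewrite /mnorm (bigD1 i) //= (bigD1 j) //= -addrA lerDl addr_ge0 ?sumr_ge0 //.
by move=> k _; apply: sumr_ge0.
Qed.

Lemma mnormD p q (A B : 'M[C]_(p, q)) : mnorm (A + B) <= mnorm A + mnorm B.
Proof.
rewrite /mnorm -big_split; apply: ler_sum => i _; rewrite -big_split.
by apply: ler_sum => j _; rewrite mxE ler_normD.
Qed.

Lemma mnorm0 p q : mnorm (0 : 'M[C]_(p, q)) = 0.
Proof. by rewrite /mnorm big1 // => i _; rewrite big1 // => j _; rewrite mxE normr0. Qed.

Lemma mnormZ p q a (A : 'M[C]_(p, q)) : mnorm (a *: A) = `|a| * mnorm A.
Proof.
rewrite /mnorm mulr_sumr; apply: eq_bigr => i _; rewrite mulr_sumr.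
by apply: eq_bigr => j _; rewrite mxE normrM.
Qed.

Lemma mnormN p q (A : 'M[C]_(p, q)) : mnorm (- A) = mnorm A.
Proof. by rewrite -scaleN1r mnormZ normrN1 mul1r. Qed.

Lemma mnorm_sum p q I (r : seq I) (F : I -> 'M[C]_(p, q)) :
  mnorm (\sum_(i <- r) F i) <= \sum_(i <- r) mnorm (F i).
Proof.
elim: r => [|i r IH]; first by rewrite !big_nil mnorm0.
by rewrite !big_cons; apply: le_trans (mnormD _ _) _; rewrite lerD2l.
Qed.

Lemma mnormM p q r (A : 'M[C]_(p, q)) (B : 'M[C]_(q, r)) :
  mnorm (A *m B) <= mnorm A * mnorm B.
Proof.
apply: (@le_trans _ _ (\sum_i \sum_j \sum_k `|A i k| * `|B k j|)).
  apply: ler_sum => i _; apply: ler_sum => j _; rewrite mxE.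
  apply: le_trans (ler_norm_sum _ _ _) _.
  by apply: ler_sum => k _; rewrite normrM.
rewrite {1}/mnorm mulr_suml; apply: ler_sum => i _.
rewrite exchange_big /= mulr_suml; apply: ler_sum => k _.
rewrite -mulr_sumr ler_wpM2l // /mnorm [leRHS](bigD1 k) //= lerDl sumr_ge0 // => l _.
exact: sumr_ge0.
Qed.

Lemma mnorm_unitary m (A : 'M[C]_m) : unitary A -> mnorm A <= (m * m)%:R.
Proof.
move=> uA; have hA i j : `|A i j| <= 1.
  have := ip_coord_le (A *m evec R j) i.
  rewrite ip_unitary // ip_evec1 mulmx_evec.
  by rewrite expr_le1.
have sc (c : C) : \sum_(k < m) c = m%:R * c by rewrite sumr_const card_ord mulr_natl.
apply: (@le_trans _ _ (\sum_(i < m) \sum_(j < m) 1)).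
  by apply: ler_sum => i _; apply: ler_sum => j _.
by rewrite !sc mulr1 natrM.
Qed.

Lemma mnorm_ip m (A : 'M[C]_m) u : ip u u = 1 -> `|ip u (A *m u)| <= mnorm A.
Proof.
move=> u1; have hu i : `|u i 0| <= 1.
  by have := ip_coord_le u i; rewrite u1 expr_le1.
rewrite ipE; apply: le_trans (ler_norm_sum _ _ _) _; apply: ler_sum => i _.
rewrite normrM normcJ -[leRHS]mul1r ler_pM // mxE.
apply: le_trans (ler_norm_sum _ _ _) _; apply: ler_sum => j _.
by rewrite normrM -[leRHS]mulr1 ler_pM.
Qed.

Lemma expr_sub1_le (t : C) k : `|t| = 1 -> `|t ^+ k - 1| <= k%:R * `|t - 1|.
Proof.
move=> t1; elim: k => [|k IH]; first by rewrite expr0 subrr normr0 mul0r.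
have -> : t ^+ k.+1 - 1 = t * (t ^+ k - 1) + (t - 1) by rewrite exprS; ring.
apply: le_trans (ler_normD _ _) _; rewrite normrM t1 mul1r -natr1 mulrDl mul1r.
by rewrite lerD2r.
Qed.

Lemma expr_taylor1 (t : C) m : `|t| = 1 ->
  `|t ^+ m - 1 - m%:R * (t - 1)| <= (m ^ 2)%:R * `|t - 1| ^+ 2.
Proof.
move=> t1.
elim: m => [|m IH]; first by rewrite expr0 subrr mul0r subr0 normr0 mul0r.
have -> : t ^+ m.+1 - 1 - m.+1%:R * (t - 1) =
  (t ^+ m - 1 - m%:R * (t - 1)) + (t ^+ m - 1) * (t - 1).
  by rewrite exprS -natr1; ring.
apply: le_trans (ler_normD _ _) _.
apply: (@le_trans _ _ ((m ^ 2)%:R * `|t - 1| ^+ 2 + m%:R * `|t - 1| ^+ 2)).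
  by rewrite lerD // normrM expr2 mulrA ler_wpM2r // expr_sub1_le.
rewrite -mulrDl -natrD ler_wpM2r ?exprn_ge0 // ler_nat.
by rewrite -[m.+1]addn1 sqrnD muln1 -addnA leq_add2l mul2n -addnn addnA leq_addl.
Qed.

End EntryNorm.

(** * Derivatives along a circle of reflections *)

Section Generators.
Variables (R : realType) (n d : nat).
Local Notation C := R[i].
Local Notation "x ^*" := (@conjc _ x) : ring_scope.
Variable rho : 'M[C]_n -> 'M[C]_d.
Hypothesis hrho : is_unitary_rep rho.

Definition laurent (u : 'cV[C]_n) (M K : nat) (Cm : nat -> 'M[C]_d) :=
  forall t, `|t| = 1 -> t ^+ M *: rho (refl u t) = \sum_(m < K) t ^+ m *: Cm m.

(** Expand [tau (t * s) = tau t *m tau s] in powers of [s] and compare coefficients: [Cm m] takes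
    values in the weight space of [t ^ (m - M)]. *)
Lemma laurent_coef u M K Cm : ip u u = 1 -> laurent u M K Cm ->
  forall t m, `|t| = 1 -> (m < K)%N ->
  t ^+ M *: (rho (refl u t) *m Cm m) = t ^+ m *: Cm m.
Proof.
move=> u1 hL t m t1 mK; apply/matrixP => k l.
pose p := \poly_(a < K) ((t ^+ M *: (rho (refl u t) *m Cm a) - t ^+ a *: Cm a) k l).
suff /(congr1 (fun q : {poly C} => q`_m)) : p = 0.
  by rewrite coef_poly mK coef0 !mxE => /eqP; rewrite subr_eq0 => /eqP.
apply: circle_poly_eq0 => s s1; rewrite horner_poly.
have st1 : `|t * s| = 1 by rewrite normrM t1 s1 mulr1.
have := hL _ st1.
rewrite -reflM // repM //; try exact: refl_unitary.
rewrite exprMn -scalerA scalemxAr hL //.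
rewrite mulmx_sumr scaler_sumr => /matrixP /(_ k l).
rewrite !summxE => e; apply/eqP; rewrite (eq_bigr (fun a : 'I_K =>
  (t ^+ M *: (rho (refl u t) *m (s ^+ a *: Cm a))) k l - ((t * s) ^+ a *: Cm a) k l)).
  by rewrite sumrB e subrr.
move=> a _; rewrite -scalemxAr !mxE exprMn; ring.
Qed.

Lemma laurent_sum1 u M K Cm : laurent u M K Cm -> \sum_(m < K) Cm m = 1%:M.
Proof.
move=> hL; have := hL 1; rewrite normr1 expr1n scale1r refl1 (rep1 hrho).
move=> -> //; by apply: eq_bigr => m _; rewrite expr1n scale1r.
Qed.

(* [N] is the derivative at [t = 1] of [rho (refl u t)], that is the image of
   [u u^*] under the (complexified) differential of [rho]. *)
Definition generates (u : 'cV[C]_n) (N : 'M[C]_d) :=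
  exists2 L : C, 0 <= L & forall t, `|t| = 1 ->
    mnorm (rho (refl u t) - 1%:M - (t - 1) *: N) <= L * `|t - 1| ^+ 2.

(** The termwise derivative at 1 of the sum of [t ^ (m - M) *: Cm m]. *)
Definition laurent_gen (M K : nat) (Cm : nat -> 'M[C]_d) : 'M[C]_d :=
  \sum_(m < K) (m%:R - M%:R) *: Cm m.

Lemma laurent_generates u M K Cm : ip u u = 1 -> laurent u M K Cm ->
  generates u (laurent_gen M K Cm).
Proof.
move=> u1 hL.
pose L : C := \sum_(m < K) ((m ^ 2)%:R + (M ^ 2)%:R + M%:R * `|m%:R - M%:R|) * mnorm (Cm m).
exists L => [|t t1].
  by apply: sumr_ge0 => m _; rewrite mulr_ge0 ?mnorm_ge0 // !addr_ge0 // mulr_ge0.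
have tM : `|t ^+ M| = 1 by rewrite normrX t1 expr1n.
have scale (X : 'M[C]_d) : mnorm X = mnorm (t ^+ M *: X) by rewrite mnormZ tM mul1r.
rewrite scale !scalerBr hL // -(laurent_sum1 hL) scaler_sumr.
rewrite /laurent_gen scalerA scaler_sumr -!sumrB mulr_suml.
apply: le_trans (mnorm_sum _ _) _; apply: ler_sum => m _.
rewrite scalerA -!scalerBl mnormZ [leRHS]mulrAC ler_wpM2r ?mnorm_ge0 //.
(* Multiplication by the unimodular [t ^+ M] has cleared the denominators. What remains is two
   second order Taylor remainders and a cross term from replacing [t ^+ M] by 1. *)
have -> : t ^+ m - t ^+ M - t ^+ M * (t - 1) * (m%:R - M%:R) =
  (t ^+ m - 1 - m%:R * (t - 1)) - (t ^+ M - 1 - M%:R * (t - 1))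
   - (t ^+ M - 1) * (t - 1) * (m%:R - M%:R) by ring.
rewrite [leRHS]mulrDl; apply: le_trans (ler_normB _ _) _; apply: lerD.
  rewrite [leRHS]mulrDl; apply: le_trans (ler_normB _ _) _.
  by apply: lerD; apply: expr_taylor1.
rewrite !normrM; have -> : M%:R * `|m%:R - M%:R| * `|t - 1| ^+ 2 =
  (M%:R * `|t - 1|) * `|t - 1| * `|m%:R - M%:R| :> C by ring.
by rewrite ler_wpM2r // ler_wpM2r // expr_sub1_le.
Qed.

End Generators.

(** * Differential of a representation *)

Section ReflectionProducts.
Variables (R : realType) (n : nat).
Local Notation C := R[i].
Local Notation "x ^*" := (@conjc _ x) : ring_scope.
Local Notation evec := (@evec R n).

Lemma evec_transitive (u : 'cV[C]_n) i : ip u u = 1 ->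
  exists2 A, unitary A & A *m evec i = u.
Proof.
move=> u1; have [<-|eu] := eqVneq (evec i) u.
  by exists 1%:M; [exact: unitary1 | rewrite mul1mx].
have [v [t [v1 t1 e _]]] := refl_transitive (ip_evec1 R i) u1 eu.
by exists (refl v t) => //; apply: refl_unitary.
Qed.

Lemma unit_vector_index (u : 'cV[C]_n) : ip u u = 1 -> exists i : 'I_n, True.
Proof.
case: (pickP (@predT 'I_n)) => [i _ _|no]; first by exists i.
by rewrite ipE big_pred0 // => /eqP; rewrite eq_sym oner_eq0.
Qed.

Definition refl_prod (s : seq ('cV[C]_n * C)) : 'M[C]_n :=
  foldr (fun p B => refl p.1 p.2 *m B) 1%:M s.

Lemma refl_evec_diag i t :
  refl (evec i) t = diag_mx (\row_j if j == i then t else 1).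
Proof.
apply/matrixP => j k; rewrite refl_evecE !mxE.
have [<-|jk] := eqVneq j k.
  by rewrite andbb mulr1n; case: eqP => _; rewrite ?mulr1 ?mulr0 ?addr0 // addrC subrK.
rewrite mulr0n add0r; have [ji|_] /= := eqVneq j i; last by rewrite mulr0.
by rewrite -ji eq_sym (negbTE jk) mulr0.
Qed.

Definition eigen_refl (A : 'M[C]_n) (p : 'cV[C]_n * C) : Prop :=
  [/\ ip p.1 p.1 = 1, `|p.2| = 1 & A *m p.1 = p.2 *: p.1].

(** These are the reflections along an orthonormal eigenbasis of [A]. Keeping the eigenvector
    property bounds each [p.2 - 1] by [A - 1], and makes the factors with [p.2 != 1] orthogonal to
    the fixed vectors of [A]. *)
Lemma unitary_refl_prod A : unitary A -> exists s : seq ('cV[C]_n * C),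
  [/\ size s = n, A = refl_prod s & forall p, List.In p s -> eigen_refl A p].
Proof.
move=> uA; have [U [t [uU AE]]] : exists (U : 'M[C]_n) (t : 'rV[C]_n),
    unitary U /\ A = U *m diag_mx t *m adjmx U.
  by apply: spectral_decomposition; rewrite unitary_adjl.
have eig i : A *m (U *m evec i) = t 0 i *: (U *m evec i).
  rewrite AE -!mulmxA (mulmxA (adjmx U)) unitary_adjl // mul1mx scalemxAr.
  congr (_ *m _); apply/colP => k; rewrite !mxE (bigD1 k) //= big1 => [|j jk].
    rewrite !mxE eqxx addr0 andbT mulr1n; case: eqP => [->|_]; first by rewrite mulr1.
    by rewrite !mulr0.
  by rewrite !mxE eq_sym (negbTE jk) mulr0n mul0r.
have u1 i : ip (U *m evec i) (U *m evec i) = 1 by rewrite ip_unitary // ip_evec1.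
exists [seq (U *m evec i, t 0 i) | i <- enum 'I_n]; split.
- by rewrite size_map size_enum_ord.
- suff h (r : seq 'I_n) : uniq r -> refl_prod [seq (U *m evec i, t 0 i) | i <- r] =
     U *m diag_mx (\row_j if j \in r then t 0 j else 1) *m adjmx U.
    rewrite h ?enum_uniq // AE; congr (_ *m diag_mx _ *m _).
    by apply/rowP => j; rewrite !mxE mem_enum.
  elim: r => [_|i r IH /= /andP [ir ur]].
    rewrite /= (_ : diag_mx _ = 1%:M) ?mulmx1 ?uU //.
    by apply/matrixP => j k; rewrite !mxE.
  rewrite IH // refl_conj // -!mulmxA (mulmxA (adjmx U)) unitary_adjl // mul1mx.
  rewrite (mulmxA (refl _ _)) refl_evec_diag mulmx_diag.
  congr (_ *m (diag_mx _ *m _)); apply/rowP => j; rewrite !mxE inE.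
  by have [->|_] := eqVneq j i; rewrite ?mul1r // (negbTE ir) mulr1.
- move=> p /List.in_map_iff [i [<- _]]; split=> //=.
  have := u1 i; rewrite -(ip_unitary _ _ uA) eig ipZl ipZr u1 mulr1 mulrC.
  exact: normc1_conj.
Qed.

End ReflectionProducts.

(** * A Lipschitz bound at the identity *)

Section Lipschitz.
Variables (R : realType) (n d : nat).
Local Notation C := R[i].
Local Notation "x ^*" := (@conjc _ x) : ring_scope.
Local Notation evec := (@evec R n).
Variable haar : {set 'I_n} -> ('M[C]_n -> C) -> C.
Hypothesis hhaar : forall B, is_haar_integral (UB B) (haar B).
Variable rho : 'M[C]_n -> 'M[C]_d.
Hypothesis hrho : is_unitary_rep rho.

Lemma rep_refl_conj A u t : unitary A -> ip u u = 1 -> `|t| = 1 ->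
  rho (refl (A *m u) t) = rho A *m rho (refl u t) *m adjmx (rho A).
Proof.
move=> uA u1 t1; rewrite refl_conj // -(rep_adj hrho) //.
have ur := refl_unitary u1 t1; have ua := unitary_adj uA.
by rewrite (repM hrho (unitaryM uA ur) ua) (repM hrho).
Qed.

Lemma laurent_exists u : ip u u = 1 -> exists M K Cm, laurent rho u M K Cm.
Proof.
move=> u1; have [i _] := unit_vector_index u1.
have [A uA <-] := evec_transitive i u1.
have [M [K [Cm h]]] := laurent_rep hrho (hhaar [set i]).
exists M, K, (fun m => rho A *m Cm m *m adjmx (rho A)) => t t1.
rewrite rep_refl_conj ?ip_evec1 // scalemxAl scalemxAr h //.
rewrite mulmx_sumr mulmx_suml; apply: eq_bigr => m _.
by rewrite -scalemxAr -scalemxAl.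
Qed.

Lemma generates_exists u : ip u u = 1 -> exists N, generates rho u N.
Proof.
move=> u1; have [M [K [Cm h]]] := laurent_exists u1.
by exists (laurent_gen M K Cm); apply: laurent_generates.
Qed.

(** The constant is uniform in [u] because all reflections with the same [t] are conjugate, and
    conjugating by a unitary matrix costs a factor depending only on [d]. *)
Lemma rep_refl_lipschitz : exists2 L : C, 0 <= L & forall u t, ip u u = 1 ->
  `|t| = 1 -> mnorm (rho (refl u t) - 1%:M) <= L * `|t - 1|.
Proof.
(* For [n = 0] there are no unit vectors, and the constant 0 works. *)
case: (pickP (@predT 'I_n)) => [i _|no]; last first.
  exists 0 => // u t u1; have [i _] := unit_vector_index u1.
  by have := no i.
have [N [L L0 hN]] := generates_exists (ip_evec1 R i).
pose D : C := (d * d)%:R.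
exists (D * (mnorm N + 2 * L) * D) => [|u t u1 t1].
  by rewrite !mulr_ge0 ?addr_ge0 ?mnorm_ge0 // mulr_ge0.
have [A uA <-] := evec_transitive i u1.
rewrite rep_refl_conj ?ip_evec1 //.
have rA := rep_unitary hrho uA.
have -> : rho A *m rho (refl (evec i) t) *m adjmx (rho A) - 1%:M =
  rho A *m (rho (refl (evec i) t) - 1%:M) *m adjmx (rho A).
  by rewrite mulmxBr mulmxBl mulmx1 rA.
have t2 : `|t - 1| <= 2.
  by apply: le_trans (ler_normB _ _) _; rewrite t1 normr1.
apply: le_trans (mnormM _ _) _; rewrite [leRHS]mulrAC.
apply: ler_pM; rewrite ?mnorm_ge0 //; last exact/mnorm_unitary/unitary_adj.
apply: le_trans (mnormM _ _) _; rewrite -mulrA.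
apply: ler_pM; rewrite ?mnorm_ge0 //; first exact: mnorm_unitary.
have -> : rho (refl (evec i) t) - 1%:M =
  (rho (refl (evec i) t) - 1%:M - (t - 1) *: N) + (t - 1) *: N by rewrite subrK.
apply: le_trans (mnormD _ _) _; rewrite mnormZ.
apply: le_trans (lerD (hN t t1) (lexx _)) _.
have -> : (mnorm N + 2 * L) * `|t - 1| = L * (2 * `|t - 1|) + `|t - 1| * mnorm N by ring.
by rewrite lerD2r ler_wpM2l // expr2 ler_wpM2r.
Qed.

(** Factor [A] into reflections along its eigenvectors. Each [p.2 - 1] is [ip p.1 ((A - 1) *m p.1)],
    so every factor is as close to the identity as [A], and the [n] errors add up. *)
Lemma rep_lipschitz : exists2 L : C, 0 <= L & forall A, unitary A ->
  mnorm (rho A - 1%:M) <= L * mnorm (A - 1%:M).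
Proof.
have [L L0 hL] := rep_refl_lipschitz.
pose D : C := (d * d)%:R.
exists (n%:R * (L * D)) => [|A uA]; first by rewrite !mulr_ge0.
have [s [sz AE hs]] := unitary_refl_prod uA.
have dist p : List.In p s -> `|p.2 - 1| <= mnorm (A - 1%:M).
  move=> /hs [p1 _ ep]; have := mnorm_ip (A - 1%:M) p1.
  by rewrite mulmxBl mul1mx ep ipBr ipZr p1 mulr1.
suff [_] : unitary (refl_prod s) /\ mnorm (rho (refl_prod s) - 1%:M) <=
   (size s)%:R * (L * D) * mnorm (A - 1%:M).
  by rewrite -AE sz.
have {sz AE} : forall p, List.In p s ->
   [/\ ip p.1 p.1 = 1, `|p.2| = 1 & `|p.2 - 1| <= mnorm (A - 1%:M)].
  by move=> p ps; have [p1 p2 _] := hs p ps; split=> //; apply: dist.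
elim: s {hs dist} => [_|p s IH hp] /=.
  by rewrite (rep1 hrho) subrr mnorm0 !mul0r; split=> //; exact: unitary1.
have [p1 p2 pd] := hp p (or_introl erefl).
have [us hs] := IH (fun q qs => hp q (or_intror qs)).
have ur := refl_unitary p1 p2; split; first exact: unitaryM.
rewrite (repM hrho) //.
have -> : rho (refl p.1 p.2) *m rho (refl_prod s) - 1%:M =
  (rho (refl p.1 p.2) - 1%:M) *m rho (refl_prod s) + (rho (refl_prod s) - 1%:M).
  by rewrite mulmxBl mul1mx addrA subrK.
apply: le_trans (mnormD _ _) _.
rewrite -natr1 !mulrDl addrC; apply: lerD => //.
rewrite mul1r; apply: le_trans (mnormM _ _) _.
rewrite mulrAC; apply: ler_pM; rewrite ?mnorm_ge0 //.
  by apply: le_trans (hL _ _ p1 p2) _; rewrite ler_wpM2l.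
exact/mnorm_unitary/rep_unitary.
Qed.

End Lipschitz.

(** * First order expansions of matrix curves *)

Section Tangents.
Variable R : realType.
Local Notation C := R[i].
Local Notation "x ^*" := (@conjc _ x) : ring_scope.

Lemma small_mx_eq0 p q (X : 'M[C]_(p, q)) (K : C) : 0 <= K ->
  (forall e : R, 0 < e -> e <= 1 -> mnorm X <= K * e%:C) -> X = 0.
Proof.
move=> K0 h.
have /complex_realP [k kE] := ger0_real K0.
have /complex_realP [r rE] := ger0_real (mnorm_ge0 X).
have r0 : 0 <= r by rewrite -ler0c -rE mnorm_ge0.
have k0 : 0 <= k by rewrite -ler0c -kE.
suff z : r = 0.
  apply/matrixP => i j; rewrite mxE; apply/eqP; rewrite -normr_le0.
  by apply: le_trans (mnorm_entry _ _ _) _; rewrite rE z.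
apply/eqP/negPn/negP => rn; have rp : 0 < r by rewrite lt_def rn.
pose e := Num.min 1 (r / (2 * (k + 1))).
have e0 : 0 < e by rewrite lt_min ltr01 divr_gt0 //; lra.
have e1 : e <= 1 by rewrite ge_min lexx.
have er : e * (2 * (k + 1)) <= r by rewrite -ler_pdivlMr ?ge_min ?lexx ?orbT //; lra.
have := h e e0 e1; rewrite rE kE -rmorphM lecR; nra.
Qed.

Lemma cayley_sub1 (x : R) : cayley x - 1 = 2 * 'i * x%:C / (1 - 'i * x%:C).
Proof. by rewrite /cayley; field; exact: cayley_den. Qed.

Lemma cayley_den_ge1 (x : R) : 1 <= `|1 - 'i * x%:C|.
Proof.
rewrite -(@expr_ge1 _ 2) // sqr_normc cayley_conj.
have -> : (1 - 'i * x%:C) * (1 + 'i * x%:C) = (1 + x ^+ 2)%:C.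
  rewrite rmorphD rmorph1 rmorphXn.
  have -> : (1 - 'i * x%:C) * (1 + 'i * x%:C) = 1 - 'i ^+ 2 * x%:C ^+ 2 by ring.
  by rewrite sqr_i; ring.
by rewrite [leLHS](_ : 1 = 1%:C) // lecR lerDl sqr_ge0.
Qed.

Lemma normi : `|'i : C| = 1.
Proof. by apply: normc1_conj; rewrite conjci mulrN -expr2 sqr_i opprK. Qed.

Lemma norm_real_complex (x : R) : `|x%:C| = `|x|%:C.
Proof. by rewrite normc_def /= expr0n addr0 sqrtr_sqr. Qed.

Lemma cayley_sub1_le (x : R) : `|cayley x - 1| <= 2 * `|x|%:C.
Proof.
rewrite cayley_sub1 !normrM normi mulr1 normr_nat norm_real_complex -[leRHS]mulr1.
rewrite ler_wpM2l ?mulr_ge0 ?ler0c // normfV invf_le1 ?cayley_den_ge1 //.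
exact: (lt_le_trans ltr01 (cayley_den_ge1 x)).
Qed.

Lemma cayley_taylor1 (x : R) : `|cayley x - 1 - 2 * 'i * x%:C| <= 2 * `|x|%:C ^+ 2.
Proof.
have -> : cayley x - 1 - 2 * 'i * x%:C = (cayley x - 1) * ('i * x%:C).
  by rewrite cayley_sub1; field; exact: cayley_den.
rewrite normrM normrM normi mul1r norm_real_complex expr2 mulrA.
by rewrite ler_wpM2r ?ler0c // cayley_sub1_le.
Qed.

Lemma cayley_neq1 (x : R) : 0 < x -> cayley x - 1 != 0.
Proof.
move=> x0; rewrite cayley_sub1 !mulf_neq0 ?pnatr_eq0 ?invr_neq0 ?cayley_den //.
  by rewrite -normr_eq0 normi oner_eq0.
by rewrite -(rmorph0 (real_complex R)) (inj_eq (@complexI R)) gt_eqF.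
Qed.

Lemma circle_limit_eq0 p q (X : 'M[C]_(p, q)) (L : C) : 0 <= L ->
  (forall t, `|t| = 1 -> mnorm ((t - 1) *: X) <= L * `|t - 1| ^+ 2) -> X = 0.
Proof.
move=> L0 h; apply: (@small_mx_eq0 _ _ _ (L * 2)) => [|e e0 e1].
  by rewrite mulr_ge0.
have := h _ (cayley_norm e); rewrite mnormZ expr2 mulrA [leLHS]mulrC.
rewrite ler_pM2r ?normr_gt0 ?cayley_neq1 // => {}h.
apply: le_trans h _; rewrite -mulrA ler_wpM2l //.
by apply: le_trans (cayley_sub1_le e) _; rewrite gtr0_norm.
Qed.

(** A quadratic remainder with an explicit constant replaces a limit; it is stable under products
    and still determines [X]. *)
Definition tangent m (F : R -> 'M[C]_m) (X : 'M[C]_m) :=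
  exists2 K : C, 0 <= K & forall e : R, 0 < e -> e <= 1 ->
    mnorm (F e - 1%:M - e%:C *: X) <= K * e%:C ^+ 2.

Lemma tangent_unique m (F : R -> 'M[C]_m) X Y :
  tangent F X -> tangent F Y -> X = Y.
Proof.
move=> [K K0 hX] [L L0 hY]; apply/eqP; rewrite -subr_eq0; apply/eqP.
apply: (@small_mx_eq0 _ _ _ (L + K)) => [|e e0 e1]; first exact: addr_ge0.
have ec0 : 0 < e%:C :> C by rewrite ltcR.
rewrite -(ler_pM2l ec0); have -> : e%:C * mnorm (X - Y) = mnorm (e%:C *: (X - Y)).
  by rewrite mnormZ ger0_norm // ltW.
have -> : e%:C *: (X - Y) = (F e - 1%:M - e%:C *: Y) - (F e - 1%:M - e%:C *: X).
  by rewrite scalerBr opprB [RHS]addrC [in RHS]addrA subrK.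
apply: le_trans (mnormD _ _) _; rewrite mnormN.
have -> : e%:C * ((L + K) * e%:C) = L * e%:C ^+ 2 + K * e%:C ^+ 2 by ring.
by apply: lerD; [apply: hY | apply: hX].
Qed.

Lemma mnorm1 m : mnorm (1%:M : 'M[C]_m) = m%:R.
Proof.
rewrite /mnorm (eq_bigr (fun=> 1)) ?sumr_const ?card_ord // => i _.
rewrite (bigD1 i) //= big1 => [|j ji]; first by rewrite mxE eqxx normr1 addr0.
by rewrite mxE eq_sym (negbTE ji) normr0.
Qed.

Lemma tangentM m (F G : R -> 'M[C]_m) X Y :
  tangent F X -> tangent G Y -> tangent (fun e => F e *m G e) (X + Y).
Proof.
move=> [K K0 hF] [L L0 hG].
pose B := m%:R + mnorm Y + L; pose D := m%:R + mnorm X.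
have B0 : 0 <= B by rewrite !addr_ge0 ?mnorm_ge0.
have D0 : 0 <= D by rewrite !addr_ge0 ?mnorm_ge0.
exists (K * B + D * L + mnorm X * mnorm Y) => [|e e0 e1].
  by rewrite !addr_ge0 ?mulr_ge0 ?mnorm_ge0.
have ec0 : 0 <= e%:C :> C by rewrite ler0c ltW.
have ec1 : e%:C <= 1 :> C by rewrite [leRHS](_ : 1 = 1%:C) // lecR.
have e2 : e%:C ^+ 2 <= 1 :> C by rewrite expr_le1.
set f := F e - 1%:M - e%:C *: X; set g := G e - 1%:M - e%:C *: Y.
have fE : F e = 1%:M + e%:C *: X + f by rewrite /f [RHS]addrC [1%:M + _]addrC addrA !subrK.
have gE : G e = 1%:M + e%:C *: Y + g by rewrite /g [RHS]addrC [1%:M + _]addrC addrA !subrK.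
have -> : F e *m G e - 1%:M - e%:C *: (X + Y) =
   f *m G e + (1%:M + e%:C *: X) *m g + (e%:C ^+ 2) *: (X *m Y).
  have -> : F e *m G e = (1%:M + e%:C *: X) *m (1%:M + e%:C *: Y) +
      (1%:M + e%:C *: X) *m g + f *m G e.
    by rewrite {1}fE mulmxDl {1}gE mulmxDr.
  have -> : (1%:M + e%:C *: X) *m (1%:M + e%:C *: Y) =
      1%:M + e%:C *: (X + Y) + (e%:C ^+ 2) *: (X *m Y).
    rewrite mulmxDl mul1mx mulmxDr mulmx1 -scalemxAl -scalemxAr scalerA -expr2.
    by rewrite scalerDr !addrA; congr (_ + _); rewrite addrAC.
  move: (f *m G e) (_ *m g) (X *m Y) => P Q Z.
  by apply/matrixP => i j; rewrite !mxE; ring.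
have hX : mnorm (1%:M + e%:C *: X) <= D.
  apply: le_trans (mnormD _ _) _; rewrite mnorm1 lerD2l mnormZ ger0_norm //.
  by rewrite ler_piMl // mnorm_ge0.
have hGe : mnorm (G e) <= B.
  rewrite gE; apply: le_trans (mnormD _ _) _; apply: lerD.
    apply: le_trans (mnormD _ _) _; rewrite mnorm1 lerD2l mnormZ ger0_norm //.
    by rewrite ler_piMl // mnorm_ge0.
  by apply: le_trans (hG e e0 e1) _; rewrite ler_piMr.
apply: le_trans (mnormD _ _) _; rewrite [leRHS]mulrDl; apply: lerD; last first.
  by rewrite mnormZ normrX ger0_norm // mulrC ler_wpM2r ?exprn_ge0 // mnormM.
apply: le_trans (mnormD _ _) _; rewrite [leRHS]mulrDl; apply: lerD.
  apply: le_trans (mnormM _ _) _; rewrite mulrAC.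
  by apply: ler_pM; rewrite ?mnorm_ge0 // hF.
apply: le_trans (mnormM _ _) _; rewrite -mulrA.
by apply: ler_pM; rewrite ?mnorm_ge0 // hG.
Qed.

Lemma tangent1 m : tangent (fun=> 1%:M : 'M[C]_m) 0.
Proof. by exists 0 => // e _ _; rewrite subrr scaler0 subr0 mnorm0 mul0r. Qed.

(** The factor [2 * 'i] is the derivative of [cayley] at 0; [c] is a real speed along the circle. *)
Lemma tangent_cayley m (F : C -> 'M[C]_m) N (L : C) (c : R) : 0 <= L ->
  (forall t, `|t| = 1 -> mnorm (F t - 1%:M - (t - 1) *: N) <= L * `|t - 1| ^+ 2) ->
  tangent (fun e => F (cayley (c * e))) ((2 * 'i * c%:C) *: N).
Proof.
move=> L0 h; pose c2 : C := `|c|%:C ^+ 2.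
have c20 : 0 <= c2 by rewrite exprn_ge0 // ler0c.
have nce e : 0 < e -> `|c * e|%:C ^+ 2 = c2 * e%:C ^+ 2 :> C.
  by move=> e0; rewrite normrM (gtr0_norm e0) rmorphM exprMn.
clearbody c2; exists (L * (4 * c2) + 2 * c2 * mnorm N) => [|e e0 e1].
  by rewrite addr_ge0 ?mulr_ge0 ?mnorm_ge0.
set t := cayley _.
have -> : F t - 1%:M - e%:C *: ((2 * 'i * c%:C) *: N) =
  (F t - 1%:M - (t - 1) *: N) + (t - 1 - 2 * 'i * (c * e)%:C) *: N.
  by apply/matrixP => i j; rewrite !mxE rmorphM; ring.
apply: le_trans (mnormD _ _) _; rewrite [leRHS]mulrDl; apply: lerD.
  apply: le_trans (h _ (cayley_norm _)) _; rewrite -mulrA ler_wpM2l //.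
  have -> : 4 * c2 * e%:C ^+ 2 = (2 * `|c * e|%:C) ^+ 2 by rewrite exprMn nce //; ring.
  have h1 := cayley_sub1_le (c * e).
  by rewrite lerXn2r ?nnegrE // (le_trans _ h1).
rewrite mnormZ [leRHS]mulrAC ler_wpM2r ?mnorm_ge0 //.
by apply: le_trans (cayley_taylor1 _) _; rewrite nce // mulrA.
Qed.

End Tangents.

(** * Construction of the differential on all complex matrices *)

Section Differential.
Variables (R : realType) (n d : nat).
Local Notation C := R[i].
Local Notation "x ^*" := (@conjc _ x) : ring_scope.
Local Notation evec := (@evec R n).
Variable haar : {set 'I_n} -> ('M[C]_n -> C) -> C.
Hypothesis hhaar : forall B, is_haar_integral (UB B) (haar B).
Variable rho : 'M[C]_n -> 'M[C]_d.
Hypothesis hrho : is_unitary_rep rho.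

Lemma generates_unique u N N' : generates rho u N -> generates rho u N' -> N = N'.
Proof.
move=> [L L0 h] [L' L0' h']; apply/eqP; rewrite -subr_eq0; apply/eqP.
apply: (@circle_limit_eq0 _ _ _ _ (L' + L)) => [|t t1]; first exact: addr_ge0.
have -> : (t - 1) *: (N - N') = (rho (refl u t) - 1%:M - (t - 1) *: N') -
   (rho (refl u t) - 1%:M - (t - 1) *: N).
  by apply/matrixP => i j; rewrite !mxE; ring.
apply: le_trans (mnormD _ _) _; rewrite mnormN mulrDl.
by apply: lerD; [apply: h' | apply: h].
Qed.

(* The product of the reflections [refl (u j) (cayley (c j * e))] is [1 + O(e^2)]
   when the real combination of projections vanishes, and so is its image since
   [rho] is Lipschitz at [1]; the first order term of the image is the
   combination of the generators. *)
Lemma generator_relation_real (J : Type) (r : seq J) (c : J -> R)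
    (u : J -> 'cV[C]_n) (N : J -> 'M[C]_d) :
  (forall j, ip (u j) (u j) = 1) -> (forall j, generates rho (u j) (N j)) ->
  \sum_(j <- r) (c j)%:C *: (u j *m adjmx (u j)) = 0 ->
  \sum_(j <- r) (c j)%:C *: N j = 0.
Proof.
move=> u1 gN rel.
pose A e := foldr (fun j B => refl (u j) (cayley (c j * e)) *m B) 1%:M r.
have uA e : unitary (A e).
  rewrite /A; elim: (r) => [|j s IH] /=; first exact: unitary1.
  by apply: unitaryM => //; apply: refl_unitary => //; apply: cayley_norm.
have tA : tangent A ((2 * 'i) *: (\sum_(j <- r) (c j)%:C *: (u j *m adjmx (u j)))).
  rewrite /A; elim: (r) => [|j s IH] /=.
    by rewrite big_nil scaler0; exact: tangent1.
  rewrite big_cons scalerDr scalerA.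
  have h t : `|t| = 1 -> mnorm (refl (u j) t - 1%:M -
      (t - 1) *: (u j *m adjmx (u j))) <= 0 * `|t - 1| ^+ 2.
    move=> _; rewrite mul0r (_ : _ - _ - _ = 0) ?mnorm0 //.
    by rewrite /refl [1%:M + _]addrC addrK subrr.
  exact: (tangentM (tangent_cayley (F := refl (u j)) (c j) (lexx 0) h) IH).
have tR : tangent (fun e => rho (A e)) ((2 * 'i) *: (\sum_(j <- r) (c j)%:C *: N j)).
  suff [//] : tangent (fun e => rho (A e)) ((2 * 'i) *: (\sum_(j <- r) (c j)%:C *: N j)) /\
    forall e, unitary (A e).
  rewrite /A; elim: (r) => [|j s [IH us]] /=.
    rewrite big_nil scaler0 (rep1 hrho); split; [exact: tangent1 | move=> e; exact: unitary1].
  have ur e : unitary (refl (u j) (cayley (c j * e))).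
    by apply: refl_unitary => //; apply: cayley_norm.
  split=> [|e]; last exact: unitaryM.
  rewrite big_cons scalerDr scalerA.
  have [L L0 hL] := gN j.
  have [K K0 hK] := tangentM (tangent_cayley (c j) L0 hL) IH.
  by exists K => // e e0 e1; rewrite (repM hrho) //; apply: hK.
have tR0 : tangent (fun e => rho (A e)) 0.
  have [K K0 hK] := tA; have [L L0 hL] := rep_lipschitz hhaar hrho.
  exists (L * K) => [|e e0 e1]; first exact: mulr_ge0.
  rewrite scaler0 subr0; apply: le_trans (hL _ (uA e)) _.
  rewrite -mulrA ler_wpM2l //; have := hK e e0 e1.
  by rewrite rel !scaler0 subr0.
have /eqP := tangent_unique tR tR0.
rewrite scaler_eq0 mulf_eq0 pnatr_eq0 /= => /orP [|/eqP //].
by rewrite -normr_eq0 normi oner_eq0.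
Qed.

(** Speeds along the circle are real, so complex coefficients are split. The projections are
    self-adjoint, hence the conjugate coefficients satisfy the same relation, and so do the real and
    imaginary parts. *)
Lemma generator_relation (J : Type) (r : seq J) (c : J -> C)
    (u : J -> 'cV[C]_n) (N : J -> 'M[C]_d) :
  (forall j, ip (u j) (u j) = 1) -> (forall j, generates rho (u j) (N j)) ->
  \sum_(j <- r) c j *: (u j *m adjmx (u j)) = 0 ->
  \sum_(j <- r) c j *: N j = 0.
Proof.
move=> u1 gN rel.
have rel' : \sum_(j <- r) (c j)^* *: (u j *m adjmx (u j)) = 0.
  transitivity (adjmx (\sum_(j <- r) c j *: (u j *m adjmx (u j))));
    last by rewrite rel adjmx0.
  rewrite adjmx_sum; apply: eq_bigr => j _.
  by rewrite adjmxZ adjmxM adjmxK.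
have reR : \sum_(j <- r) (complex.Re (c j))%:C *: (u j *m adjmx (u j)) = 0.
  transitivity (2^-1 *: (\sum_(j <- r) c j *: (u j *m adjmx (u j)) +
     \sum_(j <- r) (c j)^* *: (u j *m adjmx (u j))));
    last by rewrite rel rel' addr0 scaler0.
  rewrite -big_split scaler_sumr; apply: eq_bigr => j _ /=.
  by rewrite -scalerDl scalerA ReJ_add mulrC.
have imR : \sum_(j <- r) (complex.Im (c j))%:C *: (u j *m adjmx (u j)) = 0.
  transitivity (('i / 2) *: (\sum_(j <- r) (c j)^* *: (u j *m adjmx (u j)) -
     \sum_(j <- r) c j *: (u j *m adjmx (u j))));
    last by rewrite rel rel' subr0 scaler0.
  rewrite -sumrB scaler_sumr; apply: eq_bigr => j _ /=.
  by rewrite -scalerBl scalerA ImJ_sub; congr (_ *: _); rewrite mulrC mulrAC mulrA.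
have eR := generator_relation_real u1 gN reR.
have eI := generator_relation_real u1 gN imR.
transitivity (\sum_(j <- r) (complex.Re (c j))%:C *: N j +
   'i *: \sum_(j <- r) (complex.Im (c j))%:C *: N j);
  last by rewrite eR eI scaler0 addr0.
rewrite scaler_sumr -big_split; apply: eq_bigr => j _ /=.
by rewrite scalerA -scalerDl -complexE.
Qed.

(** The Pythagorean pair 3/5, 4/5 gives unit vectors without square roots; ['i ^+ r] runs through
    the fourth roots of unity. *)
Definition pol_vec (i j : 'I_n) (r : 'I_4) : 'cV[C]_n :=
  if i == j then evec i else (3 / 5) *: evec i + (4 / 5 * 'i ^+ r) *: evec j.

(** [25 / 48] is the inverse of [4 * (3 / 5) * (4 / 5)]: four terms, each contributing the product
    of the two coordinates. On the diagonal only [r = 0] counts. *)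
Definition pol_coef (i j : 'I_n) (r : 'I_4) : C :=
  if i == j then (r == 0)%:R else 25 / 48 * 'i ^+ r.

Lemma conj_iX r : ('i ^+ r)^* * 'i ^+ r = 1 :> C.
Proof. by rewrite mulrC -sqr_normc normrX normi !expr1n. Qed.

Lemma pol_vec_unit i j r : ip (pol_vec i j r) (pol_vec i j r) = 1.
Proof.
rewrite /pol_vec; case: eqP => [_|/eqP ij]; first exact: ip_evec1.
rewrite ipDl !ipDr !ipZl !ipZr !ip_evec1.
have e0 : ip (evec i) (evec j) = 0 by rewrite ip_evec !mxE (negbTE ij).
have e1 : ip (evec j) (evec i) = 0 by rewrite ip_evec !mxE eq_sym (negbTE ij).
rewrite e0 e1 !conjcM !conjcV !conjc_nat !mulr0 addr0 add0r !mulr1.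
have -> : 4 / 5 * ('i ^+ r)^* * (4 / 5 * 'i ^+ r) =
   (4 / 5) ^+ 2 * (('i ^+ r)^* * 'i ^+ r) :> C by ring.
by rewrite conj_iX; field.
Qed.

Lemma outer_comb m (x y : 'cV[C]_m) a b :
  (a *: x + b *: y) *m adjmx (a *: x + b *: y) =
  (a * a^*) *: (x *m adjmx x) + (a * b^*) *: (x *m adjmx y) +
  (b * a^*) *: (y *m adjmx x) + (b * b^*) *: (y *m adjmx y).
Proof.
rewrite adjmxD !adjmxZ mulmxDl !mulmxDr -!scalemxAl -!scalemxAr !scalerA.
by rewrite !addrA.
Qed.

(** Summing over the fourth roots of unity with weight ['i ^+ r] kills the diagonal terms (sum of
    ['i ^+ r]) and the [delta_mx j i] term (sum of their squares), and keeps [delta_mx i j]. *)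
Lemma polarization i j : delta_mx i j =
  \sum_r pol_coef i j r *: (pol_vec i j r *m adjmx (pol_vec i j r)).
Proof.
rewrite /pol_vec /pol_coef; have [<-|ij] := eqVneq i j.
  rewrite (bigD1 0) //= big1 => [|r /negbTE ->]; last by rewrite scale0r.
  by rewrite ?eqxx mulr1n scale1r addr0 evec_proj.
have ee k l : evec k *m adjmx (evec l) = delta_mx k l.
  apply/matrixP => a b; rewrite !mxE big_ord1 !mxE !eqxx !andbT.
  by rewrite conjc_nat -natrM mulnb.
have addE (P Q : 'M[C]_n) a b : (P + Q) a b = P a b + Q a b by rewrite mxE.
have scaleE c (P : 'M[C]_n) a b : (c *: P) a b = c * P a b by rewrite mxE.
have expand r : (25 / 48 * 'i ^+ r) *:
  (((3 / 5) *: evec i + (4 / 5 * 'i ^+ r) *: evec j) *m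
    adjmx ((3 / 5) *: evec i + (4 / 5 * 'i ^+ r) *: evec j)) =
  4^-1 *: (delta_mx i j : 'M[C]_n) +
  (25 / 48 * 'i ^+ r) *: ((9 / 25) *: delta_mx i i + (16 / 25) *: delta_mx j j) +
  (4^-1 * ('i ^+ r * 'i ^+ r)) *: delta_mx j i.
  rewrite outer_comb !ee.
  rewrite !conjcM !conjcV !conjc_nat.
  have h := conj_iX r; set w := 'i ^+ r in h *; set w' := w^* in h *.
  clearbody w'; clearbody w.
  transitivity ((4^-1 * (w' * w)) *: (delta_mx i j : 'M[C]_n) +
    (25 / 48 * w) *: ((9 / 25) *: delta_mx i i + (16 / 25 * (w' * w)) *: delta_mx j j) +
    (4^-1 * (w * w)) *: delta_mx j i); last by rewrite h !mulr1.
  move: (delta_mx i i) (delta_mx i j) (delta_mx j i) (delta_mx j j) => X Y Z T.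
  by apply/matrixP => a b; rewrite !(addE, scaleE); field.
under eq_bigr => r _ do rewrite expand.
have i2 : 'i ^+ 2 = -1 :> C by exact: sqr_i.
rewrite !big_split -!scaler_suml -!mulr_sumr /=.
have -> : \sum_(r < 4) 'i ^+ r = 0 :> C.
  rewrite !big_ord_recl big_ord0 /= /bump /= !exprS expr0.
  have -> : 1 + ('i * 1 + ('i * ('i * 1) + ('i * ('i * ('i * 1)) + 0))) =
     (1 + 'i) * (1 + 'i ^+ 2) :> C by ring.
  by rewrite i2 subrr mulr0.
have -> : \sum_(r < 4) 'i ^+ r * 'i ^+ r = 0 :> C.
  rewrite !big_ord_recl big_ord0 /= /bump /= !exprS expr0.
  set X := (X in X = 0); have -> : X = (1 + 'i ^+ 2) * (1 + 'i ^+ 4) by rewrite /X; ring.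
  by rewrite i2 subrr mul0r.
rewrite !mulr0 !scale0r !addr0 sumr_const card_ord -[_ *+ 4]mulr_natr mulVf ?scale1r //.
by rewrite pnatr_eq0.
Qed.

Lemma matrix_polarization (Z : 'M[C]_n) : Z = \sum_i \sum_j \sum_r
  (Z i j * pol_coef i j r) *: (pol_vec i j r *m adjmx (pol_vec i j r)).
Proof.
rewrite [LHS]matrix_sum_delta; apply: eq_bigr => i _; apply: eq_bigr => j _.
rewrite [in LHS]polarization scaler_sumr; apply: eq_bigr => r _.
by rewrite scalerA.
Qed.

Lemma linear_ext m (f g : 'M[C]_n -> 'M[C]_m) :
  (forall a X Y, f (a *: X + Y) = a *: f X + f Y) ->
  (forall a X Y, g (a *: X + Y) = a *: g X + g Y) ->
  (forall u, ip u u = 1 -> f (u *m adjmx u) = g (u *m adjmx u)) ->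
  forall Z, f Z = g Z.
Proof.
move=> lf lg fg Z.
have l0 (h : 'M[C]_n -> 'M[C]_m) : (forall a X Y, h (a *: X + Y) = a *: h X + h Y) -> h 0 = 0.
  move=> lh; have := lh (-1) 0 0; rewrite scaler0 addr0 scaleN1r addNr; exact.
have ext J (r : seq J) (P : pred J) F : (forall j, f (F j) = g (F j)) ->
    f (\sum_(j <- r | P j) F j) = g (\sum_(j <- r | P j) F j).
  move=> e; elim: r => [|j r IH]; first by rewrite !big_nil !l0.
  rewrite !big_cons; case: ifP => // _.
  by rewrite -[F j]scale1r lf lg e IH.
rewrite (matrix_polarization Z).
apply: (ext) => i; apply: (ext) => j; apply: (ext) => r.
rewrite -[_ *: _]addr0 lf lg !l0 // !addr0 fg //; exact: pol_vec_unit.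
Qed.

(** Polarization defines [dr] linearly from chosen generators. That it returns the generator of an
    arbitrary unit [u] is the image of the relation expressing [u *m adjmx u] through the polarizing
    projections. *)
Lemma differential_exists : exists dr : 'M[C]_n -> 'M[C]_d,
  (forall a X Y, dr (a *: X + Y) = a *: dr X + dr Y) /\
  (forall u, ip u u = 1 -> generates rho u (dr (u *m adjmx u))).
Proof.
have /boolp.choice [N hN] : forall u, exists N, ip u u = 1 -> generates rho u N.
  move=> u; have [u1|nu] := boolp.pselect (ip u u = 1); last by exists 0.
  by have [N] := generates_exists hhaar hrho u1; exists N.
pose dr Z := \sum_i \sum_j \sum_r (Z i j * pol_coef i j r) *: N (pol_vec i j r).
exists dr; split=> [a X Y|u u1].
  rewrite /dr scaler_sumr -big_split; apply: eq_bigr => i _ /=.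
  rewrite scaler_sumr -big_split; apply: eq_bigr => j _ /=.
  rewrite scaler_sumr -big_split; apply: eq_bigr => r _ /=.
  by rewrite !mxE mulrDl scalerDl scalerA mulrA.
suff -> : dr (u *m adjmx u) = N u by apply: hN.
(* [None] stands for [u] itself with coefficient -1; the other indices carry its polarization, so
   the total vanishes. *)
pose J := option ('I_n * 'I_n * 'I_4)%type.
pose c (o : J) := if o is Some (i, j, r) then (u *m adjmx u) i j * pol_coef i j r else -1.
pose v (o : J) := if o is Some (i, j, r) then pol_vec i j r else u.
have v1 o : ip (v o) (v o) = 1 by case: o => [[[i j] r]|] //=; exact: pol_vec_unit.
have split_sum p q (F : J -> 'M[C]_(p, q)) : \sum_(o <- None :: [seq Some x | x <- enum {: 'I_n * 'I_n * 'I_4}]) F o =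
   F None + \sum_i \sum_j \sum_r F (Some (i, j, r)).
  rewrite big_cons big_map big_enum /=; congr (_ + _).
  by rewrite pair_bigA /= pair_bigA; apply: eq_bigr => -[[i j] r].
have := @generator_relation J (None :: [seq Some x | x <- enum {: 'I_n * 'I_n * 'I_4}])
  c v (fun o => N (v o)) v1 (fun o => hN _ (v1 o)).
rewrite !split_sum /= -matrix_polarization !scaleN1r addNr => /(_ erefl) /eqP.
by rewrite addrC subr_eq0 => /eqP.
Qed.

End Differential.

Section IntegerPowers.
Variable R : realType.
Local Notation C := R[i].
Local Notation "x ^*" := (@conjc _ x) : ring_scope.

Lemma expz_taylor1 (t : C) (z : int) : `|t| = 1 ->
  `|t ^ z - 1 - z%:~R * (t - 1)| <= (2 * `|z| ^ 2)%:R * `|t - 1| ^+ 2.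
Proof.
move=> t1; have t0 := unit_neq0 t1.
have sq0 : 0 <= `|t - 1| ^+ 2 by rewrite exprn_ge0.
case: z => m.
  rewrite -exprnP; apply: le_trans (expr_taylor1 m t1) _.
  by rewrite ler_wpM2r // ler_nat /= leq_pmull.
rewrite NegzE -exprnN abszN absz_nat; set a := m.+1.
have ta : t ^+ a != 0 by rewrite expf_neq0.
have -> : t ^- a - 1 - (- a%:Z)%:~R * (t - 1) =
  (a%:R * (t ^+ a - 1) * (t - 1) - (t ^+ a - 1 - a%:R * (t - 1))) / t ^+ a.
  by rewrite rmorphN /= -pmulrn; field.
rewrite normrM normfV normrX t1 expr1n invr1 mulr1.
apply: le_trans (ler_normB _ _) _.
rewrite mul2n -addnn natrD mulrDl; apply: lerD; last exact: expr_taylor1.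
rewrite !normrM normr_nat expr2 mulrA -mulnn natrM ler_wpM2r // -mulrA.
by rewrite ler_wpM2l // expr_sub1_le.
Qed.

End IntegerPowers.

(** * Equivariance, adjoints and integration of the differential *)

Section DifferentialTheory.
Variables (R : realType) (n d : nat).
Local Notation C := R[i].
Local Notation "x ^*" := (@conjc _ x) : ring_scope.
Local Notation evec := (@evec R n).
Variable haar : {set 'I_n} -> ('M[C]_n -> C) -> C.
Hypothesis hhaar : forall B, is_haar_integral (UB B) (haar B).
Variable rho : 'M[C]_n -> 'M[C]_d.
Hypothesis hrho : is_unitary_rep rho.
Variable dr : 'M[C]_n -> 'M[C]_d.
Hypothesis dr_lin : forall a X Y, dr (a *: X + Y) = a *: dr X + dr Y.
Hypothesis dr_gen : forall u, ip u u = 1 -> generates rho u (dr (u *m adjmx u)).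

Lemma dr0 : dr 0 = 0.
Proof. by have := dr_lin (-1) 0 0; rewrite scaler0 addr0 scaleN1r addNr. Qed.

Lemma drD X Y : dr (X + Y) = dr X + dr Y.
Proof. by rewrite -[X]scale1r dr_lin !scale1r. Qed.

Lemma drZ a X : dr (a *: X) = a *: dr X.
Proof. by rewrite -[_ *: X]addr0 dr_lin dr0 addr0. Qed.

Lemma dr_sum J (r : seq J) (P : pred J) F :
  dr (\sum_(j <- r | P j) F j) = \sum_(j <- r | P j) dr (F j).
Proof. exact: (big_morph _ drD dr0). Qed.

Lemma generates_conj u N A : unitary A -> ip u u = 1 -> generates rho u N ->
  generates rho (A *m u) (rho A *m N *m adjmx (rho A)).
Proof.
move=> uA u1 [L L0 hL]; have rA := rep_unitary hrho uA.
exists ((d * d)%:R * L * (d * d)%:R) => [|t t1]; first by rewrite !mulr_ge0.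
rewrite (rep_refl_conj hrho) //.
have -> : rho A *m rho (refl u t) *m adjmx (rho A) - 1%:M -
   (t - 1) *: (rho A *m N *m adjmx (rho A)) =
   rho A *m (rho (refl u t) - 1%:M - (t - 1) *: N) *m adjmx (rho A).
  by rewrite !mulmxBr !mulmxBl mulmx1 rA -scalemxAr -scalemxAl.
apply: le_trans (mnormM _ _) _; rewrite [leRHS]mulrAC.
apply: ler_pM; rewrite ?mnorm_ge0 //; last exact/mnorm_unitary/unitary_adj.
apply: le_trans (mnormM _ _) _; rewrite -mulrA.
by apply: ler_pM; rewrite ?mnorm_ge0 ?mnorm_unitary ?hL.
Qed.

(** By linearity it is enough to take a projection, where both sides generate the circle of
    reflections along [A *m u]. *)
Lemma dr_conj A Z : unitary A ->
  dr (A *m Z *m adjmx A) = rho A *m dr Z *m adjmx (rho A).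
Proof.
move=> uA; apply: (linear_ext (f := fun Z => dr (A *m Z *m adjmx A))
   (g := fun Z => rho A *m dr Z *m adjmx (rho A))) => [a X Y|a X Y|u u1].
- by rewrite mulmxDr mulmxDl -scalemxAr -scalemxAl dr_lin.
- by rewrite dr_lin mulmxDr mulmxDl -scalemxAr -scalemxAl.
apply: (@generates_unique _ _ _ rho (A *m u)).
  have -> : A *m (u *m adjmx u) *m adjmx A = (A *m u) *m adjmx (A *m u).
    by rewrite adjmxM !mulmxA.
  by apply: dr_gen; rewrite ip_unitary.
by apply: generates_conj => //; apply: dr_gen.
Qed.

Lemma mnorm_adj p q (X : 'M[C]_(p, q)) : mnorm (adjmx X) = mnorm X.
Proof.
rewrite /mnorm exchange_big /=; apply: eq_bigr => i _; apply: eq_bigr => j _.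
by rewrite adjmxE normcJ.
Qed.

Lemma generates_adj u N : ip u u = 1 -> generates rho u N ->
  generates rho u (adjmx N).
Proof.
move=> u1 [L L0 hL]; exists L => // t t1.
have tc : `|t^*| = 1 by rewrite normcJ.
rewrite -mnorm_adj !adjmxD !adjmxN adjmx1 adjmxZ adjmxK conjcB1.
rewrite -(rep_adj hrho) ?adj_refl; last exact: refl_unitary.
rewrite (_ : `|t - 1| = `|t^* - 1|); first exact: hL.
by rewrite -conjcB1 normcJ.
Qed.

Lemma dr_adj Z : dr (adjmx Z) = adjmx (dr Z).
Proof.
rewrite -[LHS]adjmxK; congr adjmx.
apply: (linear_ext (f := fun Z => adjmx (dr (adjmx Z)))) => // [a X Y|u u1].
  by rewrite adjmxD adjmxZ dr_lin adjmxD adjmxZ conjcK.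
rewrite adjmxM adjmxK; apply: (@generates_unique _ _ _ rho u); last exact: dr_gen.
by apply: generates_adj => //; apply: dr_gen.
Qed.

Lemma dr_laurent u M K Cm t : ip u u = 1 -> laurent rho u M K Cm -> `|t| = 1 ->
  t ^+ M *: (rho (refl u t) *m dr (u *m adjmx u)) =
  \sum_(m < K) t ^+ m *: ((m%:R - M%:R) *: Cm m).
Proof.
move=> u1 hL t1.
rewrite (generates_unique (dr_gen u1) (laurent_generates hrho u1 hL)).
rewrite /laurent_gen mulmx_sumr scaler_sumr; apply: eq_bigr => m _.
rewrite -scalemxAr scalerA [t ^+ M * _]mulrC -scalerA (laurent_coef hrho u1 hL) //.
by rewrite !scalerA mulrC.
Qed.

(** Comparing Laurent coefficients in [dr_laurent] applied to [v] gives [(m - M) Cm m v = 0]. Only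
    the term [m = M], of trivial weight, survives. *)
Lemma refl_fixed u t (v : 'cV[C]_d) : ip u u = 1 -> `|t| = 1 ->
  dr (u *m adjmx u) *m v = 0 -> rho (refl u t) *m v = v.
Proof.
move=> u1 t1 hv; have [M [K [Cm hL]]] := laurent_exists hhaar hrho u1.
have coef m : (m < K)%N -> (m%:R - M%:R) *: (Cm m *m v) = 0.
  move=> mK; apply/colP => k; rewrite mxE.
  pose p := \poly_(a < K) ((a%:R - M%:R) *: (Cm a *m v)) k 0.
  suff /(congr1 (fun q : {poly C} => q`_m)) : p = 0.
    by rewrite coef_poly mK coef0 mxE => ->; rewrite mxE.
  apply: circle_poly_eq0 => s s1; rewrite horner_poly.
  have /(congr1 (fun X => (X *m v) k 0)) := dr_laurent u1 hL s1.
  rewrite -scalemxAl -mulmxA hv mulmx0 scaler0 mxE mulmx_suml summxE => e.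
  rewrite [RHS]e; apply: eq_bigr => a _.
  by rewrite -!scalemxAl [in RHS]mxE mulrC.
have tM : t ^+ M != 0 by rewrite expf_neq0 // unit_neq0.
apply: (scalerI tM); rewrite scalemxAl hL // mulmx_suml.
rewrite -[v in RHS]mul1mx -(laurent_sum1 hrho hL) mulmx_suml scaler_sumr.
apply: eq_bigr => m _; rewrite -scalemxAl.
have /eqP := coef m (ltn_ord m); rewrite scaler_eq0 subr_eq0 eqr_nat.
by move=> /orP [/eqP ->|/eqP ->] //; rewrite !scaler0.
Qed.

Lemma dr_weight u (v : 'cV[C]_d) (z : int) : ip u u = 1 ->
  (forall t, `|t| = 1 -> rho (refl u t) *m v = t ^ z *: v) ->
  dr (u *m adjmx u) *m v = z%:~R *: v.
Proof.
move=> u1 hv; have [L L0 hL] := dr_gen u1; set N := dr _ in hL *.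
apply/eqP; rewrite -subr_eq0; apply/eqP.
apply: (@circle_limit_eq0 _ _ _ _ ((2 * `|z| ^ 2)%:R * mnorm v + L * mnorm v)) => [|t t1].
  by rewrite addr_ge0 // mulr_ge0 ?mnorm_ge0.
have -> : (t - 1) *: (N *m v - z%:~R *: v) =
   (t ^ z - 1 - z%:~R * (t - 1)) *: v - (rho (refl u t) - 1%:M - (t - 1) *: N) *m v.
  rewrite !mulmxBl mul1mx hv // -scalemxAl; move: (N *m v) => y.
  by apply/colP => k; rewrite !mxE; ring.
apply: le_trans (mnormD _ _) _; rewrite mnormN [leRHS]mulrDl; apply: lerD.
  rewrite mnormZ [leRHS]mulrAC ler_wpM2r ?mnorm_ge0 //; exact: expz_taylor1.
apply: le_trans (mnormM _ _) _; rewrite [leRHS]mulrAC.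
by rewrite ler_wpM2r ?mnorm_ge0 // hL.
Qed.

End DifferentialTheory.

(** * Highest weight vectors *)

Section HighestWeight.
Variables (R : realType) (n d : nat).
Local Notation C := R[i].
Local Notation "x ^*" := (@conjc _ x) : ring_scope.
Local Notation evec := (@evec R n).
Variable haar : {set 'I_n} -> ('M[C]_n -> C) -> C.
Hypothesis hhaar : forall B, is_haar_integral (UB B) (haar B).
Variable rho : 'M[C]_n -> 'M[C]_d.
Hypothesis hrho : is_unitary_rep rho.
Variable dr : 'M[C]_n -> 'M[C]_d.
Hypothesis dr_lin : forall a X Y, dr (a *: X + Y) = a *: dr X + dr Y.
Hypothesis dr_gen : forall u, ip u u = 1 -> generates rho u (dr (u *m adjmx u)).

Definition weight_vector (lam : 'I_n -> int) (v : 'cV[C]_d) :=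
  forall t : 'I_n -> C, (forall i, `|t i| = 1) ->
    rho (diag_mx (\row_i t i)) *m v = (\prod_i t i ^ lam i) *: v.

Lemma diag_unitary (t : 'I_n -> C) : (forall i, `|t i| = 1) ->
  unitary (diag_mx (\row_i t i)).
Proof.
move=> t1; rewrite /unitary; have -> : adjmx (diag_mx (\row_i t i)) = diag_mx (\row_i (t i)^*).
  apply/matrixP => j k; rewrite adjmxE !mxE eq_sym.
  by case: eqP => [->|_]; rewrite ?mulr1n ?mulr0n ?conjc0.
rewrite mulmx_diag; apply/matrixP => j k; rewrite !mxE.
by case: eqP => [->|_]; rewrite ?mulr1n ?mulr0n // conjc_unit.
Qed.

Lemma diag_conj_delta (t : 'I_n -> C) i j : (forall i, `|t i| = 1) ->
  diag_mx (\row_i t i) *m delta_mx i j *m adjmx (diag_mx (\row_i t i)) =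
  (t i * (t j)^-1) *: delta_mx i j.
Proof.
move=> t1; have tD : torus (diag_mx (\row_i t i)).
  split; first exact: diag_unitary.
  by move=> k l /negbTE kl; rewrite !mxE kl.
apply/matrixP => k l; rewrite torus_mulr; last exact: torus_adj.
rewrite torus_mull // adjmxE !mxE !eqxx !mulr1n.
case: eqP => [->|_] /=; last by rewrite !mulr0 mul0r.
case: eqP => [->|_] /=; last by rewrite !mulr0 mul0r.
by rewrite !mulr1 conjc_unitV.
Qed.

(** Conjugation by a diagonal unitary scales [delta_mx i j] by [t i / t j]: it is a root vector for
    [e_i - e_j]. *)
Lemma dr_delta_weight lam v i j : weight_vector lam v ->
  weight_vector (fun l => lam l + (l == i)%:Z - (l == j)%:Z) (dr (delta_mx i j) *m v).
Proof.
move=> hv t t1; have uT := diag_unitary t1.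
have rT := rep_unitary hrho uT; set T := diag_mx _ in uT rT *.
have e : rho T *m dr (delta_mx i j) = (t i * (t j)^-1) *: (dr (delta_mx i j) *m rho T).
  have := dr_conj hrho dr_lin dr_gen (delta_mx i j) uT.
  rewrite diag_conj_delta // (drZ dr_lin).
  move=> /(congr1 (fun X => X *m rho T)).
  by rewrite -mulmxA (unitary_adjl rT) mulmx1 -scalemxAl => ->.
rewrite mulmxA e -scalemxAl -mulmxA (hv t t1) -scalemxAr scalerA; congr (_ *: _).
have prod1 (k : 'I_n) (f : C -> C) : f 1 = 1 ->
   \prod_l f (t l ^+ (l == k)) = f (t k).
  move=> f1; rewrite (bigD1 k) //= big1 ?mulr1 ?eqxx //.
  by move=> l /negbTE ->; rewrite expr0.
rewrite -(prod1 i id) // -(prod1 j (fun x => x^-1)) ?invr1 // -!big_split /=.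
apply: eq_bigr => l _; rewrite mulrC mulrA expfzDr ?unit_neq0 // expfzDr ?unit_neq0 //.
by rewrite exprnN -exprnP.
Qed.

Lemma dr_diag_weight lam v i : weight_vector lam v ->
  dr (delta_mx i i) *m v = (lam i)%:~R *: v.
Proof.
move=> hv; rewrite -evec_proj.
apply: (dr_weight dr_gen (ip_evec1 R i)) => t t1.
rewrite refl_evec_diag hv => [|j]; last by case: ifP => _ //; rewrite normr1.
congr (_ *: _); rewrite (bigD1 i) //= eqxx big1 ?mulr1 // => j /negbTE ->.
by rewrite exp1rz.
Qed.

Section Dominant.
Variable mu : 'I_n -> int.
Hypothesis hdom : forall lam, is_weight rho lam -> dominated lam mu.

(** Otherwise [mu + e_i - e_j] would be a weight, and its partial sum over indices below [j] would
    exceed that of [mu] by 1. *)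
Lemma raise_kills v (i j : 'I_n) : weight_vector mu v -> (i < j)%N ->
  dr (delta_mx i j) *m v = 0.
Proof.
move=> hv ij; apply/eqP/negPn/negP => nz.
have [|_ /(_ j)] := hdom (lam := fun l => mu l + (l == i)%:Z - (l == j)%:Z).
  by exists (dr (delta_mx i j) *m v) => // t t1; apply: (dr_delta_weight i j hv).
rewrite -subr_le0 -sumrB (eq_bigr (fun l => (l == i)%:Z)) => [|l lj]; last first.
  have -> : (l == j) = false by apply/negbTE; apply: contraTneq lj => ->; rewrite ltnn.
  by rewrite subr0 addrC addKr.
rewrite (bigD1 i) //= eqxx big1 => [|l /andP [_ /negbTE ->] //].
by rewrite addr0.
Qed.

Lemma adj_perm_mx (s : 'S_n) : adjmx (perm_mx s : 'M[C]_n) = perm_mx s^-1.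
Proof.
apply/matrixP => j k; rewrite adjmxE !mxE conjc_nat.
by rewrite (can2_eq (permK s) (permKV s)) eq_sym.
Qed.

Lemma perm_unitary (s : 'S_n) : unitary (perm_mx s : 'M[C]_n).
Proof. by rewrite /unitary adj_perm_mx -perm_mxM mulgV perm_mx1. Qed.

Lemma perm_mx_mull p (s : 'S_n) (A : 'M[C]_(n, p)) k l :
  (perm_mx s *m A) k l = A (s k) l.
Proof. by rewrite -row_permE mxE. Qed.

Lemma perm_mx_mulr p (s : 'S_n) (A : 'M[C]_(p, n)) k l :
  (A *m adjmx (perm_mx s)) k l = A k (s l).
Proof.
by rewrite adj_perm_mx -col_permE mxE.
Qed.

(** The transposition of [i] and [j] preserves [mu], hence maps weight vectors for [mu] to such
    vectors, and it exchanges lowering with raising. *)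
Lemma equal_weights_kill v (i j : 'I_n) : weight_vector mu v -> i != j ->
  mu i = mu j -> dr (delta_mx i j) *m v = 0.
Proof.
move=> hv; case: (ltngtP i j) => [ij _ _|ji ij mij|/val_inj -> /eqP //].
  exact: raise_kills.
pose s := tperm i j; pose S : 'M[C]_n := perm_mx s.
have uS : unitary S := perm_unitary s.
have rS := rep_unitary hrho uS.
have mus l : mu (s l) = mu l by rewrite /s; case: tpermP => [->|->|].
have hv' : weight_vector mu (rho S *m v).
  move=> t t1; rewrite mulmxA -(repM hrho) //; last exact: diag_unitary.
  have ts1 k : `|t (s k)| = 1 by [].
  have -> : diag_mx (\row_k t k) *m S = S *m diag_mx (\row_k t (s k)).
    apply/matrixP => k l; rewrite perm_mx_mull mul_diag_mx !mxE tpermK.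
    by rewrite mulr_natr.
  rewrite (repM hrho) //; last exact: diag_unitary.
  rewrite -mulmxA (hv _ ts1) -scalemxAr; congr (_ *: _).
  by rewrite [RHS](reindex_inj (@perm_inj _ s)) /=; apply: eq_bigr => k _; rewrite mus.
have := raise_kills hv' ji.
have -> : delta_mx j i = S *m delta_mx i j *m adjmx S :> 'M[C]_n.
  apply/matrixP => k l; rewrite perm_mx_mulr perm_mx_mull !mxE.
  by rewrite !(can2_eq (tpermK i j) (tpermK i j)) tpermL tpermR.
rewrite (dr_conj hrho dr_lin dr_gen) // mulmxA -!mulmxA (mulmxA (adjmx _)).
rewrite (unitary_adjl rS) mul1mx => /(congr1 (mulmx (adjmx (rho S)))).
by rewrite mulmxA (unitary_adjl rS) mul1mx mulmx0.
Qed.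

End Dominant.

Variables (f l : 'I_n) (k : nat).
Hypothesis f0 : val f = 0%N.
Hypothesis ln : val l = n.-1.
Hypothesis fl : f != l.
Hypothesis hdom : forall lam, is_weight rho lam -> dominated lam (@wk n k).

(** Off the diagonal, an entry of [Z] that may be nonzero is either raising or joins two indices
    other than [f] and [l], where the weight is 0. Both kinds kill [v], so only the diagonal
    acts. *)
Lemma parabolic_weight v (Z : 'M[C]_n) : weight_vector (@wk n k) v ->
  (forall i, i != f -> Z i f = 0) -> (forall j, j != l -> Z l j = 0) ->
  dr Z *m v = (k%:R * (Z f f - Z l l)) *: v.
Proof.
move=> hv Zf Zl.
have wf : wk k f = k%:Z by rewrite /wk f0.
have wl : wk k l = - k%:Z.
  by rewrite /wk ln -[n.-1 == 0%N]/(_) -ln -f0 (inj_eq val_inj) eq_sym (negbTE fl) eqxx.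
have wm i : i != f -> i != l -> wk k i = 0.
  by move=> nf nl; rewrite /wk -f0 -ln !(inj_eq val_inj) (negbTE nf) (negbTE nl).
have term i j : Z i j *: (dr (delta_mx i j) *m v) =
    (if i == j then Z i i * (wk k i)%:~R else 0) *: v.
  have [<-|ij] := eqVneq i j; first by rewrite (dr_diag_weight i hv) scalerA.
  rewrite scale0r; case: (ltngtP i j) => [lt|gt|/val_inj /eqP]; last by rewrite (negbTE ij).
    by rewrite (raise_kills hdom hv lt) scaler0.
  have [jf|nf] := eqVneq j f; first by rewrite jf Zf ?scale0r // -jf.
  have [il|nl] := eqVneq i l; first by rewrite il Zl ?scale0r // -il eq_sym.
  rewrite (equal_weights_kill hdom hv ij) ?scaler0 // !wm //.
    by apply: contraTneq gt => ->; rewrite -leqNgt ln -ltnS prednK ?ltn_ord // (leq_trans _ (ltn_ord j)).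
  by apply: contraTneq gt => ->; rewrite f0.
rewrite [Z in dr Z]matrix_sum_delta (dr_sum dr_lin) mulmx_suml.
transitivity (\sum_i (Z i i * (wk k i)%:~R) *: v).
  apply: eq_bigr => i _; rewrite (dr_sum dr_lin) mulmx_suml (bigD1 i) //= big1 => [|j ji].
    by rewrite (drZ dr_lin) -scalemxAl term eqxx addr0.
  by rewrite (drZ dr_lin) -scalemxAl term eq_sym (negbTE ji) scale0r.
rewrite -scaler_suml; congr (_ *: _).
rewrite (bigD1 f) //= (bigD1 l) 1?eq_sym //= big1 => [|i /andP [nf nl]].
  by rewrite wf wl rmorphN /= -pmulrn addr0; ring.
by rewrite wm // mulr0.
Qed.

(** Transport by [h] removes the coordinates: only the line of [h e_f] and the hyperplane orthogonal
    to [h e_l] need to be preserved by [Z]. *)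
Lemma parabolic_weight_conj v (Z h : 'M[C]_n) al be : weight_vector (@wk n k) v ->
  unitary h -> Z *m (h *m evec f) = al *: (h *m evec f) ->
  adjmx (h *m evec l) *m Z = be *: adjmx (h *m evec l) ->
  dr Z *m (rho h *m v) = (k%:R * (al - be)) *: (rho h *m v).
Proof.
move=> hv uh Za Zc; have rh := rep_unitary hrho uh.
pose Z' := adjmx h *m Z *m h.
have ZE : Z = h *m Z' *m adjmx h.
  by rewrite /Z' !mulmxA uh mul1mx -mulmxA uh mulmx1.
have hf i : Z' i f = al * (i == f)%:R.
  rewrite -mulmx_evec /Z' -!mulmxA Za -scalemxAr mulmxA (unitary_adjl uh) mul1mx !mxE.
  by rewrite eqxx andbT.
have hl j : Z' l j = be * (l == j)%:R.
  have -> : Z' l j = (adjmx (evec l) *m Z') 0 j.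
    rewrite [RHS]mxE (bigD1 l) //= big1 => [|i il].
      by rewrite adjmxE [evec l _ _]mxE !eqxx conjc1 mul1r addr0.
    by rewrite adjmxE !mxE (negbTE il) conjc0 mul0r.
  rewrite /Z' !mulmxA -adjmxM Zc -scalemxAl adjmxM -mulmxA (unitary_adjl uh) mulmx1 mxE.
  by rewrite adjmxE !mxE eqxx andbT conjc_nat eq_sym.
have -> : al - be = Z' f f - Z' l l by rewrite hf hl !eqxx !mulr1.
rewrite ZE (dr_conj hrho dr_lin dr_gen) // -!mulmxA (mulmxA (adjmx (rho h))).
rewrite (unitary_adjl rh) mul1mx (parabolic_weight hv) -?scalemxAr //.
  by move=> i /negbTE nf; rewrite hf nf mulr0.
by move=> j nl; rewrite hl eq_sym (negbTE nl) mulr0.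
Qed.

(** An eigenvector of [A] for an eigenvalue other than 1 is orthogonal to the fixed vectors [e_f]
    and [e_l], so its projection acts by 0 on [v] and its reflections fix [v]. Their product is
    [A]. *)
Lemma middle_fixed v A : weight_vector (@wk n k) v -> unitary A ->
  A *m evec f = evec f -> A *m evec l = evec l -> rho A *m v = v.
Proof.
move=> hv uA Af Al; have [s [_ AE hs]] := unitary_refl_prod uA.
have perp e p : A *m e = e -> eigen_refl A p -> p.2 != 1 -> ip p.1 e = 0.
  move=> Ae [p1 p2 Ap] np; have := ip_unitary p.1 e uA.
  rewrite Ae Ap ipZl => /eqP; rewrite -subr_eq0 -{2}[ip _ _]mul1r -mulrBl mulf_eq0.
  rewrite subr_eq0 => /orP [/eqP h|/eqP //]; case/eqP: np.
  by rewrite -[p.2]conjcK h conjc1.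
have fixr p : List.In p s -> rho (refl p.1 p.2) *m v = v.
  move=> /hs ep; have [p1 p2 _] := ep.
  have [->|np] := eqVneq p.2 1; first by rewrite refl1 (rep1 hrho) mul1mx.
  apply: (refl_fixed hhaar hrho dr_gen) => //.
  have u0 i : ip p.1 (evec i) = 0 -> p.1 i 0 = 0.
    by move=> e; rewrite -ip_evec -ip_conj e conjc0.
  have pf := u0 _ (perp _ _ Af ep np); have pl := u0 _ (perp _ _ Al ep np).
  rewrite (parabolic_weight hv) => [|i _|j _].
  - by rewrite mxE big_ord1 pf mul0r mxE big_ord1 pl mul0r subrr mulr0 scale0r.
  - by rewrite mxE big_ord1 adjmxE pf conjc0 mulr0.
  - by rewrite mxE big_ord1 pl mul0r.
have ur p : List.In p s -> unitary (refl p.1 p.2).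
  by move=> /hs [p1 p2 _]; apply: refl_unitary.
rewrite AE; suff [//] : rho (refl_prod s) *m v = v /\ unitary (refl_prod s).
elim: s {AE hs} ur fixr => [_ _|p s IH ur fx] /=.
  by rewrite (rep1 hrho) mul1mx; split=> //; exact: unitary1.
have [e us] := IH (fun q qs => ur q (or_intror qs)) (fun q qs => fx q (or_intror qs)).
have up := ur p (or_introl erefl); split; last exact: unitaryM.
by rewrite (repM hrho) // -mulmxA e fx //; left.
Qed.

End HighestWeight.

(** * The spherical vector *)

Section Wronskian.
Variable F : numFieldType.
Implicit Types p q : {poly F}.

(* A zero of [p] of order [m] contributes [m] to the residue of [p'/p = q'/q]. *)
Lemma wronskian_root p q a : p^`() * q = p * q^`() -> q.[a] != 0 -> p.[a] = 0 ->
  p = 0.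
Proof.
move=> w qa pa; apply/eqP/negPn/negP => p0.
have [m [r ra pE]] := multiplicity_XsubC p a.
move: ra; rewrite p0 /= => ra.
case: m pE => [|m] pE; first by case/negP: ra; rewrite /root -[r]mulr1 -pE pa.
have nz : ('X - a%:P) ^+ m != 0 by rewrite expf_neq0 // polyXsubC_eq0.
move: w; rewrite pE derivM deriv_exp derivXsubC mul1r /= exprS => w.
have /(mulfI nz) : ('X - a%:P) ^+ m * ((r^`() * ('X - a%:P) + r *+ m.+1) * q) =
    ('X - a%:P) ^+ m * (r * ('X - a%:P) * q^`()).
  transitivity ((r^`() * (('X - a%:P) * ('X - a%:P) ^+ m) + r * (('X - a%:P) ^+ m *+ m.+1)) * q).
    by rewrite -[r *+ _]mulr_natr -[_ ^+ m *+ _]mulr_natr; ring.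
  by rewrite w; ring.
move=> /(congr1 (fun r : {poly F} => r.[a])); 
rewrite /= !(hornerXsubC, hornerM, hornerD, hornerMn) subrr !(mulr0, mul0r, add0r).
move=> /eqP; rewrite !mulf_eq0 mulrn_eq0 (negbTE qa) orbF => /orP [] //.
by move=> h; case/negP: ra.
Qed.

(** The combination [q(a) p - p(a) q] satisfies the same relation and vanishes at [a]. *)
Lemma wronskian_proportional p q a : p^`() * q = p * q^`() -> q.[a] != 0 ->
  q.[a] *: p = p.[a] *: q.
Proof.
move=> w qa; apply/eqP; rewrite -subr_eq0; apply/eqP.
apply: (@wronskian_root _ q a) => //; last by rewrite !hornerE mulrC subrr.
rewrite derivB !derivZ mulrBl mulrBl -!scalerAl w.
by rewrite [q * _]mulrC.
Qed.

(** For real [s], [Q] is [X] times the conjugate of [L] on the circle, and [P] is to be [X^M] times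
    a matrix coefficient; the factor [X^k] clears the denominator of [|L|^(2k)]. Both sides have the
    same logarithmic derivative and agree at 1. *)
Lemma product_ode (L Q P : {poly F}) (s : F) (M k : nat) :
  L = 1 + s%:P * ('X - 1) -> Q = 'X + s%:P * (1 - 'X) ->
  ('X * P^`() - M%:R * P) * (L * Q) = k%:R * s%:P * ('X * Q - L) * P ->
  'X^k * P = P.[1] *: ('X^M * (L ^+ k * Q ^+ k)).
Proof.
move=> LE QE ode; pose Y1 := 'X^k * P; pose Y2 := 'X^M * (L ^+ k * Q ^+ k).
have L1 : L.[1] = 1 by rewrite LE !hornerE subrr mulr0 addr0.
have Q1 : Q.[1] = 1 by rewrite QE !hornerE subrr mulr0 addr0.
have Y21 : Y2.[1] = 1 by rewrite !(hornerM, horner_exp, hornerX) L1 Q1 !expr1n !mulr1.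
have Y11 : Y1.[1] = P.[1] by rewrite !(hornerM, horner_exp, hornerX) expr1n mul1r.
have L0 : L != 0 by apply/eqP => L0; have := L1; rewrite L0 horner0 => /eqP; rewrite eq_sym oner_eq0.
have Q0 : Q != 0 by apply/eqP => Q0; have := Q1; rewrite Q0 horner0 => /eqP; rewrite eq_sym oner_eq0.
have dexp (G : {poly F}) m : G * (G ^+ m)^`() = m%:R * (G^`() * G ^+ m).
  rewrite deriv_exp mulr_natl; case: m => [|m]; first by rewrite !mulr0n mulr0.
  by rewrite mulrnAr /= exprS; congr (_ *+ _); ring.
have dX1 : (1 : {poly F})^`() = 0 by exact: derivC.
have dL : L^`() = s%:P.
  by rewrite LE derivD derivM derivB derivX !derivC ?dX1 mul0r !add0r subr0 mulr1.
have dQ : Q^`() = 1 - s%:P.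
  by rewrite QE derivD derivM derivB derivX !derivC ?dX1 mul0r !add0r mulrN1.
suff w : Y1^`() * Y2 = Y1 * Y2^`().
  have := @wronskian_proportional Y1 Y2 1 w; rewrite Y21 Y11 scale1r; apply.
  exact: oner_neq0.
have nz : 'X * (L * Q) != 0 by rewrite !mulf_neq0 // polyX_eq0.
apply: (mulfI nz).
have e1 : 'X * Y1^`() = k%:R * Y1 + 'X^k * ('X * P^`()).
  by rewrite /Y1 derivM mulrDr mulrA dexp derivX mul1r; ring.
have e2 : 'X * (L * Q) * Y2^`() = M%:R * (L * Q) * Y2 +
   'X^M * 'X * (k%:R * (s%:P * Q + (1 - s%:P) * L)) * (L ^+ k * Q ^+ k).
  rewrite /Y2 !derivM.
  transitivity ((L * Q) * ('X * ('X^M)^`()) * (L ^+ k * Q ^+ k) +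
     'X^M * 'X * (Q * (L * (L ^+ k)^`()) * Q ^+ k + L * L ^+ k * (Q * (Q ^+ k)^`()))).
    by ring.
  by rewrite !dexp derivX dL dQ mul1r; ring.
transitivity (L * Q * ('X * Y1^`()) * Y2); first by ring.
transitivity (Y1 * ('X * (L * Q) * Y2^`())); last by ring.
rewrite e1 e2 mulrDr mulrDl.
transitivity (k%:R * (L * Q) * Y1 * Y2 + 'X^k * Y2 * (('X * P^`() - M%:R * P) * (L * Q)) +
   M%:R * (L * Q) * Y1 * Y2); first by rewrite /Y1; ring.
rewrite ode.
have rel : L * Q + s%:P * ('X * Q - L) = 'X * (s%:P * Q + (1 - s%:P) * L).
  by rewrite QE; ring.
transitivity (Y1 * Y2 * (k%:R * (L * Q + s%:P * ('X * Q - L)) + M%:R * (L * Q))).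
  by rewrite /Y1; ring.
by rewrite rel /Y2; ring.
Qed.

End Wronskian.

(** * Orthonormal pairs and a splitting of rank-one projections *)

Section RankOne.
Variables (R : realType) (n : nat).
Local Notation C := R[i].
Local Notation "x ^*" := (@conjc _ x) : ring_scope.
Local Notation evec := (@evec R n).

Lemma orthonormal_pair (a c : 'cV[C]_n) f l : f != l ->
  ip a a = 1 -> ip c c = 1 -> ip a c = 0 ->
  exists h, [/\ unitary h, h *m evec f = a & h *m evec l = c].
Proof.
move=> fl a1 c1 ac; have [A uA Aa] := evec_transitive f a1.
have [e|ne] := eqVneq (A *m evec l) c; first by exists A.
have el1 : ip (A *m evec l) (A *m evec l) = 1 by rewrite ip_unitary // ip_evec1.
(* [a] is orthogonal to both [A e_l] and [c], hence to the reflecting direction, so this second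
   reflection does not move [a]. *)
have [u [t [u1 t1 hc hu]]] := refl_transitive el1 c1 ne.
have ael : ip a (A *m evec l) = 0.
  by rewrite -Aa ip_unitary // ip_evec !mxE (negbTE fl).
have ua : ip u a = 0 by rewrite -ip_conj hu ?conjc0 // ael ac.
exists (refl u t *m A); split.
- by apply: unitaryM => //; apply: refl_unitary.
- by rewrite -mulmxA Aa refl_mul ua mulr0 scale0r addr0.
- by rewrite -mulmxA hc.
Qed.

Lemma outer_mul (x y z : 'cV[C]_n) : x *m adjmx y *m z = ip y z *: x.
Proof. by rewrite -mulmxA ip_mx mul_mx_scalar. Qed.

Lemma mul_outer (x y z : 'cV[C]_n) : adjmx z *m (x *m adjmx y) = ip z x *: adjmx y.
Proof. by rewrite mulmxA ip_mx mul_scalar_mx. Qed.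

(* With [D = refl u t], the projection [u u^*] is split as [Z + D^-1 Z' D] where
   [Z] lies in the parabolic subalgebra fixing the line of [a] and the hyperplane
   orthogonal to [c], and [Z'] in its opposite. *)
Lemma parabolic_split (a c u : 'cV[C]_n) (t : C) :
  let s := ip a u * (ip a u)^* in
  let dl := 1 + (t - 1) * s in let gm := 1 + (t^-1 - 1) * s in
  ip u u = 1 -> ip a a = 1 -> ip c c = 1 -> ip a c = 0 -> ip c u = - ip a u ->
  t != 0 -> dl != 0 -> gm != 0 ->
  exists Z : 'M[C]_n, [/\ Z *m a = (t * s / dl) *: a,
    adjmx c *m Z = (t^-1 * s / gm) *: adjmx c,
    adjmx a *m refl u t *m (u *m adjmx u - Z) = 0 &
    (u *m adjmx u - Z) *m (refl u t^-1 *m c) = 0].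
Proof.
set p := ip a u; move=> s dl gm u1 a1 c1 ac cu t0 dl0 gm0.
have ca : ip c a = 0 by rewrite -ip_conj ac conjc0.
have uc : ip u c = - p^* by rewrite -ip_conj cu conjcN.
have ua : ip u a = p^* by rewrite -ip_conj.
(* The coefficients solve the last two requirements: killing [refl u t^-1 *m c] determines [A1]
   through [gm], and vanishing after [adjmx a *m refl u t] determines [A2] and then [A3] through
   [dl]. *)
pose A1 := - (t^-1 * p^* / gm); pose A2 := t * p / dl; pose A3 := s / (dl * gm).
exists (A1 *: (u *m adjmx c) + A2 *: (a *m adjmx u) + A3 *: (a *m adjmx c)).
have Za : (A1 *: (u *m adjmx c) + A2 *: (a *m adjmx u) + A3 *: (a *m adjmx c)) *m a
    = (A2 * p^*) *: a.
  rewrite !mulmxDl -!scalemxAl !outer_mul ca ua !scale0r !scaler0 add0r addr0.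
  by rewrite scalerA.
have Zc : (A1 *: (u *m adjmx c) + A2 *: (a *m adjmx u) + A3 *: (a *m adjmx c)) *m c
    = A1 *: u + (A3 - A2 * p^*) *: a.
  rewrite !mulmxDl -!scalemxAl !outer_mul c1 uc !scale1r.
  by apply/colP => i; rewrite !mxE; ring.
have Zu : (A1 *: (u *m adjmx c) + A2 *: (a *m adjmx u) + A3 *: (a *m adjmx c)) *m u
    = (- (A1 * p)) *: u + (A2 - A3 * p) *: a.
  rewrite !mulmxDl -!scalemxAl !outer_mul u1 cu !scale1r.
  by apply/colP => i; rewrite !mxE; ring.
have aZ : adjmx a *m (A1 *: (u *m adjmx c) + A2 *: (a *m adjmx u) + A3 *: (a *m adjmx c))
    = (A1 * p + A3) *: adjmx c + A2 *: adjmx u.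
  rewrite !mulmxDr -!scalemxAr !mul_outer a1 -/p !scale1r.
  by move: (adjmx c) (adjmx u) => y z; apply/rowP => i; rewrite !mxE; ring.
have uZ : adjmx u *m (A1 *: (u *m adjmx c) + A2 *: (a *m adjmx u) + A3 *: (a *m adjmx c))
    = (A1 + A3 * p^*) *: adjmx c + (A2 * p^*) *: adjmx u.
  rewrite !mulmxDr -!scalemxAr !mul_outer u1 ua !scale1r.
  by move: (adjmx c) (adjmx u) => y z; apply/rowP => i; rewrite !mxE; ring.
have cZ : adjmx c *m (A1 *: (u *m adjmx c) + A2 *: (a *m adjmx u) + A3 *: (a *m adjmx c))
    = (- (A1 * p)) *: adjmx c.
  rewrite !mulmxDr -!scalemxAr !mul_outer ca cu !scale0r !scaler0 !addr0 scalerA.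
  by rewrite mulrN.
have gmt : t + (1 + -1 * t) * (p * p^*) != 0.
  have -> : t + (1 + -1 * t) * (p * p^*) = t * gm by rewrite /gm /s; field.
  by rewrite mulf_neq0.
move: (_ + _ + _) Za Zc Zu aZ uZ cZ => Z Za Zc Zu aZ uZ cZ; split.
- by rewrite Za /A2; congr (_ *: _); rewrite /s; field.
- by rewrite cZ /A1; congr (_ *: _); rewrite /s; field; rewrite gm0 t0.
- have -> : adjmx a *m refl u t = adjmx a + ((t - 1) * p) *: adjmx u.
    by rewrite /refl mulmxDr mulmx1 -scalemxAr mul_outer scalerA.
  rewrite mulmxDl !mulmxBr -!scalemxAl aZ uZ !mul_outer u1 -/p scale1r.
  have e1 : p + (t - 1) * p * (1 - A2 * p^*) - A2 = 0.
    by rewrite /A2 /dl /s; field; exact: dl0.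
  have e2 : A1 * p + A3 + (t - 1) * p * (A1 + A3 * p^*) = 0.
    rewrite /A1 /A3 /dl /gm /s; field.
    by apply/and3P; split; [exact: t0 | exact: gmt | exact: dl0].
  transitivity ((p + (t - 1) * p * (1 - A2 * p^*) - A2) *: adjmx u -
    (A1 * p + A3 + (t - 1) * p * (A1 + A3 * p^*)) *: adjmx c); last first.
    by rewrite e1 e2 !scale0r subrr.
  by move: (adjmx c) (adjmx u) => y z; apply/rowP => i; rewrite !mxE; ring.
- rewrite refl_mul uc mulmxDr -scalemxAr !mulmxBl !outer_mul Zc Zu u1 uc scale1r.
  have e1 : - p^* - A1 + (t^-1 - 1) * (- p^*) * (1 + A1 * p) = 0.
    rewrite /A1 /gm /s; field.
    by apply/andP; split; [exact: t0 | exact: gmt].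
  have e2 : A3 - A2 * p^* + (t^-1 - 1) * (- p^*) * (A2 - A3 * p) = 0.
    rewrite /A2 /A3 /dl /gm /s; field.
    by apply/and3P; split; [exact: t0 | exact: gmt | exact: dl0].
  transitivity ((- p^* - A1 + (t^-1 - 1) * (- p^*) * (1 + A1 * p)) *: u -
    (A3 - A2 * p^* + (t^-1 - 1) * (- p^*) * (A2 - A3 * p)) *: a); last first.
    by rewrite e1 e2 !scale0r subrr.
  by apply/colP => i; rewrite !mxE; ring.
Qed.

End RankOne.

(** * The matrix coefficient of a translated highest weight vector *)

Section Spherical.
Variables (R : realType) (n d : nat).
Local Notation C := R[i].
Local Notation "x ^*" := (@conjc _ x) : ring_scope.
Local Notation evec := (@evec R n).
Variable haar : {set 'I_n} -> ('M[C]_n -> C) -> C.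
Hypothesis hhaar : forall B, is_haar_integral (UB B) (haar B).
Variable rho : 'M[C]_n -> 'M[C]_d.
Hypothesis hrho : is_unitary_rep rho.
Variables (f l : 'I_n) (k : nat).
Hypothesis f0 : val f = 0%N.
Hypothesis ln : val l = n.-1.
Hypothesis fl : f != l.
Hypothesis hdom : forall lam, is_weight rho lam -> dominated lam (@wk n k).
Variable v : 'cV[C]_d.
Hypothesis hv : weight_vector rho (@wk n k) v.

Section Coefficient.
Variable dr : 'M[C]_n -> 'M[C]_d.
Hypothesis dr_lin : forall a X Y, dr (a *: X + Y) = a *: dr X + dr Y.
Hypothesis dr_gen : forall u, ip u u = 1 -> generates rho u (dr (u *m adjmx u)).
Variable h : 'M[C]_n.
Hypothesis uh : unitary h.
Let a := h *m evec f.
Let c := h *m evec l.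
Let x := rho h *m v.

Let a1 : ip a a = 1. Proof. by rewrite /a ip_unitary // ip_evec1. Qed.
Let c1 : ip c c = 1. Proof. by rewrite /c ip_unitary // ip_evec1. Qed.
Let ac : ip a c = 0.
Proof. by rewrite /a /c ip_unitary // ip_evec !mxE (negbTE fl). Qed.

Lemma refl_inv (u : 'cV[C]_n) t : ip u u = 1 -> `|t| = 1 ->
  refl u t^-1 = adjmx (refl u t).
Proof. by move=> u1 t1; rewrite adj_refl conjc_unitV. Qed.

(** In the splitting of [u *m adjmx u], [dr Z] multiplies [x] by the scalar on the right. The other
    part, moved across [rho D], becomes [dr W], whose adjoint kills [x], so it does not contribute
    to the inner product. *)
Lemma coefficient_ode u t : ip u u = 1 -> ip c u = - ip a u -> `|t| = 1 ->
  let s := ip a u * (ip a u)^* in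
  let dl := 1 + (t - 1) * s in let gm := 1 + (t^-1 - 1) * s in
  dl != 0 -> gm != 0 ->
  ip x (rho (refl u t) *m dr (u *m adjmx u) *m x) =
    k%:R * (t * s / dl - t^-1 * s / gm) * ip x (rho (refl u t) *m x).
Proof.
move=> u1 cu t1 s dl gm dl0 gm0; have t0 := unit_neq0 t1.
have [Z [Za cZ aW Wc]] := parabolic_split u1 a1 c1 ac cu t0 dl0 gm0.
rewrite -/s -/dl -/gm in Za cZ.
pose D := refl u t; have uD : unitary D := refl_unitary u1 t1.
pose W := D *m (u *m adjmx u - Z) *m adjmx D.
have rD := rep_unitary hrho uD.
have dW : rho D *m dr (u *m adjmx u - Z) = dr W *m rho D.
  rewrite /W (dr_conj hrho dr_lin dr_gen) // -mulmxA (unitary_adjl rD) mulmx1 //.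
(* [adjmx W] annihilates [a] on its right and [adjmx c] on its left, so [x] is an eigenvector of its
   image with eigenvalue [k * (0 - 0)]. *)
have Wx : adjmx (dr W) *m x = 0.
  rewrite -(dr_adj hrho dr_lin dr_gen).
  rewrite (parabolic_weight_conj hrho dr_lin dr_gen f0 ln fl hdom (al := 0) (be := 0) hv uh).
  - by rewrite subrr mulr0 scale0r.
  - rewrite scale0r -[LHS]adjmxK adjmxM adjmxK /W -/a 2!mulmxA.
    by rewrite aW mul0mx adjmx0.
  - rewrite scale0r -/c -adjmxM /W -!mulmxA -(refl_inv u1 t1) Wc mulmx0.
    by rewrite adjmx0.
have Zx : dr Z *m x = (k%:R * (t * s / dl - t^-1 * s / gm)) *: x.
  exact: (parabolic_weight_conj hrho dr_lin dr_gen f0 ln fl hdom hv uh Za cZ).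
have -> : rho (refl u t) *m dr (u *m adjmx u) *m x =
   rho D *m (dr Z *m x) + dr W *m rho D *m x.
  rewrite -dW -!mulmxA -mulmxDr -mulmxDl -(drD dr_lin).
  by rewrite [Z + _]addrC subrK.
by rewrite ipDr Zx -scalemxAr ipZr -mulmxA -ip_adjl Wx ip0l addr0.
Qed.

(** [1 + (t - 1) * s] is both [ip a (refl u t *m a)] and [ip c (refl u t *m c)], as
    [ip c u = - ip a u]; this is the formula of the symmetric power model. *)
Lemma coefficient_refl u t : ip u u = 1 -> ip c u = - ip a u -> `|t| = 1 ->
  ip x (rho (refl u t) *m x) = ip x x *
    ((1 + (t - 1) * (ip a u * (ip a u)^*)) * (1 + (t - 1) * (ip a u * (ip a u)^*))^*) ^+ k.
Proof.
move=> u1 cu t1; set s := ip a u * (ip a u)^*.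
have sc : s^* = s by rewrite /s conjcM conjcK mulrC.
have [M [K [Cm hL]]] := laurent_exists hhaar hrho u1.
pose P := \poly_(m < K) ip x (Cm m *m x).
have PE y : `|y| = 1 -> P.[y] = y ^+ M * ip x (rho (refl u y) *m x).
  move=> y1; rewrite horner_poly -ipZr scalemxAl hL // mulmx_suml ip_sumr.
  by apply: eq_bigr => m _; rewrite -scalemxAl ipZr mulrC.
have dPE y : `|y| = 1 -> y * P^`().[y] - M%:R * P.[y] =
    y ^+ M * ip x (rho (refl u y) *m dr (u *m adjmx u) *m x).
  move=> y1; rewrite -ipZr scalemxAl (dr_laurent hrho dr_gen u1 hL y1).
  rewrite mulmx_suml ip_sumr.
  have -> : P = \sum_(m < K) ip x (Cm m *m x) *: 'X^m by rewrite /P poly_def.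
  rewrite raddf_sum !horner_sum !mulr_sumr -sumrB; apply: eq_bigr => m _ /=.
  rewrite -!scalemxAl !ipZr derivZ derivXn !hornerE hornerMn !hornerXn.
  case: (val m) => [|j] /=; first by rewrite mulr0n; ring.
  by rewrite -mulr_natr exprS; ring.
pose L : {poly C} := 1 + s%:P * ('X - 1); pose Q : {poly C} := 'X + s%:P * (1 - 'X).
have LE y : L.[y] = 1 + (y - 1) * s by rewrite /L !(hornerD, hornerN, hornerM, hornerC, hornerX); ring.
have QE y : Q.[y] = y + s * (1 - y) by rewrite /Q !(hornerD, hornerN, hornerM, hornerC, hornerX).
have nz : L * Q != 0.
  apply/eqP => z; have : (L * Q).[1] = 0 by rewrite z horner0.
  rewrite hornerM LE QE !subrr mul0r mulr0 !addr0 mulr1 => /eqP.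
  by rewrite oner_eq0.
have ode : ('X * P^`() - M%:R * P) * (L * Q) = k%:R * s%:P * ('X * Q - L) * P.
  apply/eqP; rewrite -subr_eq0; apply/eqP.
  (* The equation for the coefficient divides by [dl] and [gm], so it is known only off the zeros of
     [L * Q]; as a polynomial identity it extends to them. *)
  apply: (circle_poly_eq0_away nz) => y y1.
  rewrite hornerM LE QE mulf_eq0 negb_or => /andP [dl0 Q0].
  have y0 := unit_neq0 y1.
  have gmE : 1 + (y^-1 - 1) * s = (y + s * (1 - y)) / y by field.
  have gm0 : 1 + (y^-1 - 1) * s != 0 by rewrite gmE mulf_neq0 // invr_eq0.
  have := dPE y y1; rewrite (coefficient_ode u1 cu y1) //.
  rewrite -/s gmE mulrCA -(PE y y1).
  rewrite !(hornerD, hornerN, hornerM, hornerX, hornerC, LE, QE).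
  have hn (m : nat) : (m%:R : {poly C}).[y] = m%:R by rewrite -polyC_natr hornerC.
  rewrite !hn => ->; field; by rewrite y0 dl0 Q0.
have := product_ode (erefl L) (erefl Q) ode => /(congr1 (fun p : {poly C} => p.[t])).
have -> : P.[1] = ip x x.
  by rewrite PE ?normr1 // expr1n mul1r refl1 (rep1 hrho) mul1mx.
rewrite hornerZ !(hornerM, horner_exp, hornerX) LE QE (PE t t1) => e.
have t0 := unit_neq0 t1.
have tM : t ^+ k * t ^+ M != 0 by rewrite mulf_neq0 // expf_neq0.
apply: (mulfI tM); rewrite -mulrA e exprMn.
have -> : (1 + (t - 1) * s)^* = (t + s * (1 - t)) / t.
  by rewrite conjcD conjc1 conjcM conjcB1 sc conjc_unitV //; field.
rewrite [(_ / t) ^+ k]exprMn exprVn; field.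
by rewrite expf_neq0.
Qed.

End Coefficient.
End Spherical.

(** * A vector fixed by the stabiliser of a basis vector *)

Section SphericalVector.
Variables (R : realType) (n d : nat).
Local Notation C := R[i].
Local Notation "x ^*" := (@conjc _ x) : ring_scope.
Local Notation evec := (@evec R n).
Variable haar : {set 'I_n} -> ('M[C]_n -> C) -> C.
Hypothesis hhaar : forall B, is_haar_integral (UB B) (haar B).
Variable rho : 'M[C]_n -> 'M[C]_d.
Hypothesis hrho : is_unitary_rep rho.
Variables (f l : 'I_n) (k : nat).
Hypothesis f0 : val f = 0%N.
Hypothesis ln : val l = n.-1.
Hypothesis fl : f != l.
Hypothesis hdom : forall lam, is_weight rho lam -> dominated lam (@wk n k).
Variable v : 'cV[C]_d.
Hypothesis hv : weight_vector rho (@wk n k) v.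
Hypothesis v0 : v != 0.
Variables j q : 'I_n.
Hypothesis jq : j != q.

Lemma UB_compl1_fix g : UB (~: [set j]) g -> g *m evec j = evec j.
Proof.
move=> [_ hg]; apply/colP => i; rewrite mulmx_evec mxE hg.
  by rewrite eqxx andbT.
by rewrite !inE eqxx andbF.
Qed.

Lemma spherical_coefficient : exists2 x : 'cV[C]_d, x != 0 &
  forall g, UB (~: [set j]) g ->
    ip x (rho g *m x) = ip x x * ((1 + g q q) / 2 * ((1 + g q q) / 2)^*) ^+ k.
Proof.
pose r : C := sqrtC 2^-1.
have rr : r * r = 2^-1 by rewrite -expr2 sqrtCK.
have r0 : 0 <= r by rewrite sqrtC_ge0 invr_ge0 ler0n.
have rc : r^* = r by have /CrealP := ger0_real r0.
pose a := r *: (evec j + evec q); pose c := r *: (evec j - evec q).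
have qj : q != j by rewrite eq_sym.
have ipa y : ip a y = r * (y j 0 + y q 0) by rewrite /a ipZl ipDl !ip_evec rc.
have ipc y : ip c y = r * (y j 0 - y q 0) by rewrite /c ipZl ipBl !ip_evec rc.
have [ajq cjq] : (a j 0 = r /\ a q 0 = r) /\ (c j 0 = r /\ c q 0 = - r).
  rewrite !mxE !eqxx (negbTE jq) (negbTE qj) /=.
  by rewrite addr0 add0r subr0 sub0r mulrN mulr1.
have a1 : ip a a = 1.
  rewrite ipa; have [-> ->] := ajq.
  by rewrite mulrDr rr; field.
have c1 : ip c c = 1.
  rewrite ipc; have [-> ->] := cjq.
  by rewrite opprK mulrDr rr; field.
have ac : ip a c = 0.
  by rewrite ipa; have [-> ->] := cjq; rewrite subrr mulr0.
have [h [uh ha hc]] := orthonormal_pair fl a1 c1 ac.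
have [dr [dr_lin dr_gen]] := differential_exists hhaar hrho.
have rh := rep_unitary hrho uh.
exists (rho h *m v); first by rewrite -ip_eq0 ip_unitary // ip_eq0.
set x := rho h *m v.
(* Such a [g] fixes both [a] and [c], so its conjugate by [h] fixes [e_f] and [e_l]. *)
have fixx g : unitary g -> g *m evec j = evec j -> g *m evec q = evec q ->
    rho g *m x = x.
  move=> ug gj gq.
  have ga : g *m a = a by rewrite /a -scalemxAr mulmxDr gj gq.
  have gc : g *m c = c by rewrite /c -scalemxAr mulmxBr gj gq.
  have uh' := unitary_adj uh; have ugh := unitaryM ug uh.
  have : rho (adjmx h *m (g *m h)) *m v = v.
    apply: (middle_fixed hhaar hrho dr_lin dr_gen f0 ln fl hdom hv).
    - exact: unitaryM.
    - by rewrite -!mulmxA ha ga -ha mulmxA (unitary_adjl uh) mul1mx.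
    - by rewrite -!mulmxA hc gc -hc mulmxA (unitary_adjl uh) mul1mx.
  rewrite (repM hrho uh' ugh) (repM hrho ug uh) (rep_adj hrho uh).
  move=> /(congr1 (mulmx (rho h))).
  by rewrite !mulmxA rh mul1mx -/x -mulmxA.
move=> g hg; have ug := UB_unitary hg; have gj := UB_compl1_fix hg.
have gqq : g q q = (g *m evec q) q 0 by rewrite mulmx_evec.
have [gq|ngq] := eqVneq (evec q) (g *m evec q).
  rewrite fixx // gqq -gq !mxE !eqxx (_ : (1 + 1) / 2 = 1) ?conjc1 ?mulr1 ?expr1n ?mulr1 //.
  by field.
have y1 : ip (g *m evec q) (g *m evec q) = 1 by rewrite ip_unitary // ip_evec1.
(* Reduction to one reflection: [D] moves [e_q] to [g e_q] and fixes [e_j], so [adjmx D *m g] fixes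
   [e_j], [e_q] and hence [x]. *)
have [u [t [u1 t1 hu pu]]] := refl_transitive (ip_evec1 R q) y1 ngq.
have ju : ip (evec j) u = 0.
  by apply: pu; rewrite -{2}gj ip_unitary.
have uj : u j 0 = 0 by rewrite -ip_evec.
pose D := refl u t; have uD : unitary D := refl_unitary u1 t1.
have Dj : D *m evec j = evec j.
  by rewrite refl_mul -ip_conj ju conjc0 mulr0 scale0r addr0.
have uDg : unitary (adjmx D *m g) by apply: unitaryM => //; apply: unitary_adj.
have gE : g = D *m (adjmx D *m g) by rewrite mulmxA uD mul1mx.
have -> : rho g *m x = rho D *m x.
  rewrite gE (repM hrho) // -mulmxA fixx //.
    by rewrite -mulmxA gj -{1}Dj mulmxA (unitary_adjl uD) mul1mx.
  by rewrite -mulmxA -hu -/D mulmxA (unitary_adjl uD) mul1mx.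
have cu : ip (h *m evec l) u = - ip (h *m evec f) u.
  by rewrite ha hc ipa ipc uj; ring.
rewrite (coefficient_refl hhaar hrho f0 ln fl hdom hv dr_lin dr_gen uh u1 cu t1) -/x.
rewrite ha ipa uj add0r gqq -hu refl_mul.
have -> : (evec q + ((t - 1) * ip u (evec q)) *: u) q 0 = 1 + (t - 1) * (u q 0 * (u q 0)^*).
  by rewrite -ip_conj ip_evec !mxE !eqxx /= mulr1n; ring.
have -> : r * u q 0 * (r * u q 0)^* = 2^-1 * (u q 0 * (u q 0)^*).
  by rewrite conjcM rc -rr; ring.
have -> : 1 + (t - 1) * (2^-1 * (u q 0 * (u q 0)^*)) =
   (1 + (1 + (t - 1) * (u q 0 * (u q 0)^*))) / 2 by field.
by [].
Qed.

(** Positivity of the Haar integral is not strict by axiom. Translating by the reflection that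
    changes the sign of [g_qq] replaces [1 + g_qq] by [1 - g_qq] without changing the integral, and
    the two integrands together stay above [4^-k]. So the integral cannot vanish. *)
Lemma spherical_vector : exists2 x : 'cV[C]_d, x != 0 &
  forall A, UB (~: [set j]) A -> rho A *m x = x.
Proof.
have [x x0 hx] := spherical_coefficient.
set K := ~: [set j] in hx *.
exists (avg haar rho K *m x); last first.
  by move=> A hA; rewrite mulmxA (avg_fixl hhaar hrho).
apply/eqP => Px.
have cr := mcont_rep hrho (@UB_unitary _ _ K).
pose N (e : C) (A : 'M[C]_n) := ((1 + e * A q q) / 2 * ((1 + e * A q q) / 2)^*) ^+ k.
have cN e : scal_cont_on (UB K) (N e).
  apply: scal_cont_exp.
  have c1 : scal_cont_on (UB K) (fun A : 'M[C]_n => (1 + e * A q q) / 2).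
    apply: scal_cont_mul; last exact: scal_cont_const.
    apply: scal_cont_add; first exact: scal_cont_const.
    by apply: scal_cont_mul; [exact: scal_cont_const | exact: scal_cont_coord].
  by apply: scal_cont_mul => //; apply: scal_cont_conj.
have I1 : haar K (N 1) = 0.
  have cx : scal_cont_on (UB K) (fun A => ip x (rho A *m x)).
    exact: (mcont_mull (adjmx x) (mcont_mulr x cr) 0 0).
  have : haar K (fun A => ip x (rho A *m x)) = 0.
    have : (adjmx x *m avg haar rho K *m x) 0 0 = 0 by rewrite -mulmxA Px mulmx0 mxE.
    rewrite /avg -(mxint_mull (hhaar K)) // -(mxint_mulr (hhaar K)); last exact: mcont_mull.
    rewrite mxE => <-; congr (haar K _); apply: boolp.funext => A.
    by rewrite /ip mulmxA.
  rewrite (haar_local (hhaar K) cx (g := fun A => ip x x * N 1 A)).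
  - rewrite (haar_scale (hhaar K)) // => /eqP.
    by rewrite mulf_eq0 ip_eq0 (negbTE x0) => /eqP.
  - by apply: scal_cont_mul => //; exact: scal_cont_const.
  - by move=> A hA; rewrite hx // /N mul1r.
have s1 : `|-1 : C| = 1 by rewrite normrN1.
have hs : UB K (refl (evec q) (-1)).
  by apply: (@UB_sub _ _ [set q]); [rewrite sub1set !inE eq_sym | exact: refl_evec_UB].
have I2 : haar K (N (-1)) = 0.
  rewrite -I1 -(haar_linv (hhaar K) hs (cN 1)); congr (haar K _).
  apply: boolp.funext => A; rewrite /N refl_evec_coord mul1r //.
have : (4^-1) ^+ k <= haar K (fun A => N 1 A + N (-1) A).
  rewrite -[leLHS](haar_const (hhaar K)); apply: (haar_le (hhaar K)).
  - exact: scal_cont_const.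
  - exact: scal_cont_add.
  move=> A _; rewrite /N; set z := A q q.
  have nn e : (1 + e * z) / 2 * ((1 + e * z) / 2)^* = `|(1 + e * z) / 2| ^+ 2.
    by rewrite sqr_normc.
  pose u := (1 + 1 * z) / 2 * ((1 + 1 * z) / 2)^*.
  pose w := (1 + -1 * z) / 2 * ((1 + -1 * z) / 2)^*.
  have u0 : 0 <= u by rewrite /u nn exprn_ge0.
  have w0 : 0 <= w by rewrite /w nn exprn_ge0.
  have uw : u + w = 2^-1 + 2^-1 * (z * z^*).
    by rewrite /u /w !(conjcM, conjcD, conjcV, conjc_nat, conjc1, conjcN); field.
  have q0 : 0 <= 4^-1 :> C by rewrite invr_ge0 ler0n.
  (* Since [u + w >= 1/2], one of them is at least [1/4]. *)
  have [ul|lu] := real_leP (ger0_real q0) (ger0_real u0).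
    rewrite -/u -/w -[leLHS]addr0; apply: lerD; last exact: exprn_ge0.
    by rewrite lerXn2r.
  rewrite -/u -/w -[leLHS]add0r; apply: lerD; first exact: exprn_ge0.
  rewrite lerXn2r //; have : 2^-1 <= u + w.
    by rewrite uw lerDl mulr_ge0 ?invr_ge0 ?ler0n // mulcJ_ge0.
  move=> h2; rewrite -(lerD2l u); apply: le_trans h2; apply: (@le_trans _ _ (4^-1 + 4^-1)).
    by rewrite lerD2r ltW.
  by rewrite (_ : 4^-1 + 4^-1 = 2^-1) //; field.
rewrite (haar_add (hhaar K)) // I1 I2 addr0; apply/negP.
by rewrite lt_geF // exprn_gt0 // invr_gt0 ltr0n.
Qed.

End SphericalVector.

(** * Unbalanced representations have no torus invariants *)

Section Unbalanced.
Variables (R : realType) (n d : nat).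
Local Notation C := R[i].
Variable rho : 'M[C]_n -> 'M[C]_d.
Hypothesis hrho : is_unitary_rep rho.
Hypothesis hirr : irreducible_rep rho.

(** Schur's lemma with the eigenvalue supplied: the kernel of [T - chi] is invariant and contains
    [v]. The transposes translate column vectors into row spaces. *)
Lemma irreducible_scalar (T : 'M[C]_d) (chi : C) (v : 'cV[C]_d) :
  (forall A, unitary A -> T *m rho A = rho A *m T) ->
  v != 0 -> T *m v = chi *: v -> T = chi%:M.
Proof.
move=> hT v0 Tv; pose M := (T - chi%:M)^T.
have [_ /(_ (kermx M)^T)] := hirr; case=> [A uA||].
- rewrite trmx_mul trmxK; apply/sub_kermxP; rewrite -mulmxA.
  have -> : (rho A)^T *m M = M *m (rho A)^T.
    rewrite -!trmx_mul; congr trmx; rewrite mulmxBl mulmxBr hT //.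
    by rewrite mul_scalar_mx mul_mx_scalar.
  by rewrite mulmxA mulmx_ker mul0mx.
- rewrite mxrank_tr => /eqP; rewrite mxrank_eq0 => /eqP k0.
  have : (v^T <= kermx M)%MS.
    apply/sub_kermxP; rewrite -trmx_mul mulmxBl Tv mul_scalar_mx subrr.
    by rewrite trmx0.
  rewrite k0 submx0 => /eqP /(congr1 trmx); rewrite trmxK trmx0 => /eqP.
  by rewrite (negbTE v0).
- rewrite mxrank_tr mxrank_ker => e.
  have : \rank M == 0%N by rewrite -(subKn (rank_leq_row M)) e subnn.
  rewrite mxrank_eq0 => /eqP /(congr1 trmx); rewrite trmxK trmx0 => /eqP.
  by rewrite subr_eq0 => /eqP.
Qed.

(** The scalar matrix [z] is central and in the torus; it acts by [z ^ s], read off the highest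
    weight vector. For [s != 0] some unimodular [z] gives a scalar other than 1. *)
Lemma unbalanced_torinv0 mu u : has_highest_weight rho mu -> \sum_i mu i != 0 ->
  torinv rho u -> u = 0.
Proof.
move=> [_ [v v0 hv] _] s0 tu; set s := \sum_i mu i in s0.
have [z z1 zs] : exists2 z : C, `|z| = 1 & z ^ s != 1.
  have sn : `|s|%N != 0%N by rewrite absz_eq0.
  have [z z1 zn] := circle_exp_neq1 R sn; exists z => //; move: zn; rewrite expr0.
  case: (s) => m; first by rewrite absz_nat.
  by rewrite NegzE -exprnN abszN absz_nat invr_eq1.
have z0 := unit_neq0 z1.
pose Z : 'M[C]_n := diag_mx (\row_i z).
have uZ : unitary Z by apply: (diag_unitary (t := fun=> z)).
have tZ : torus Z by split=> // i j /negbTE ij; rewrite !mxE ij.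
have ZC A : Z *m A = A *m Z.
  by apply/matrixP => i j; rewrite torus_mull // torus_mulr // !mxE !eqxx mulrC.
have Zv : rho Z *m v = z ^ s *: v.
  rewrite (hv (fun=> z)) //; congr (_ *: _).
  by rewrite /s (big_morph (fun m : int => z ^ m) (fun a b => expfzDr a b z0) (expr0z z)).
have ZS : rho Z = (z ^ s)%:M.
  apply: irreducible_scalar v0 Zv => A uA.
  by rewrite -(repM hrho uZ uA) -(repM hrho uA uZ) ZC.
have /eqP := tu Z tZ; rewrite ZS mul_scalar_mx -subr_eq0 -{2}[u]scale1r -scalerBl.
by rewrite scaler_eq0 subr_eq0 (negbTE zs) => /eqP.
Qed.

End Unbalanced.

(** * Comparison of the two bounds *)

Theorem theorem1p10 (R : realType) (n : nat) (hn : (2 <= n)%N)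
    (w : {set 'I_n} -> R) (hw : forall B, 0 <= w B)
    (haar : {set 'I_n} -> ('M[R[i]]_n -> R[i]) -> R[i])
    (hhaar : forall B, is_haar_integral (UB B) (haar B))
    (k : nat) (hk : (1 <= k)%N)
    (dk : nat) (rhok : 'M[R[i]]_n -> 'M[R[i]]_dk)
    (hrhok : is_unitary_rep rhok) (hwk : has_highest_weight rhok (@wk n k))
    (d : nat) (rho : 'M[R[i]]_n -> 'M[R[i]]_d)
    (hrho : is_unitary_rep rho) (hirr : irreducible_rep rho) :
  (forall alpha : R[i],
     is_eigenvalue_on_torinv_perp rho (laplacian w haar rho) alpha ->
     exists2 lk : R[i], is_lambda_min (laplacian w haar rhok) lk & lk <= alpha)
  /\
  (forall mu : 'I_n -> int, has_highest_weight rho mu -> \sum_i mu i != 0 ->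
     exists lk l : R[i],
       [/\ is_lambda_min (laplacian w haar rhok) lk,
           is_lambda_min (laplacian w haar rho) l & lk <= l]).
Proof.
have part1 alpha :
    is_eigenvalue_on_torinv_perp rho (laplacian w haar rho) alpha ->
    exists2 lk : R[i], is_lambda_min (laplacian w haar rhok) lk & lk <= alpha.
  move=> /(perp_eigenvalue_ge hw hhaar hrho) [j hj].
  have [[dk0 _] [v v0 hv] hdom] := hwk.
  have [lk hlk] := hermitian_min_eigenvalue dk0 (laplacian_herm w hhaar hrhok).
  exists lk; first by case: hlk.
  apply: le_trans hj.
  have n0 : (0 < n)%N by apply: leq_trans hn.
  have n1 : (n.-1 < n)%N by rewrite prednK.
  pose f := Ordinal n0; pose l := Ordinal n1.
  have fl : f != l by rewrite -val_eqE /= eq_sym -lt0n -ltnS prednK.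
  (* The index [j] is the one produced by the lower bound for [rho]; [2 <= n] supplies a partner for
     it. *)
  have [q jq] : exists q : 'I_n, j != q.
    by have [->|jf] := eqVneq j f; [exists l | exists f].
  have [x x0 hx] := spherical_vector (f := f) (l := l) hhaar hrhok erefl erefl fl hdom hv v0 jq.
  exact: (rayleigh_fixed hw hhaar hrhok x0 hx hlk).
split=> // mu hmu s0; have [d0 _] := hirr.
have [l [hl _]] := hermitian_min_eigenvalue d0 (laplacian_herm w hhaar hrho).
have [[y y0 yl] _] := hl.
(* The torus invariants vanish, so their complement is the whole space and contains an eigenvector
   for the least eigenvalue. *)
have [|lk hlk le] := part1 l; last by exists lk, l.
exists y => //; split=> // u /(unbalanced_torinv0 hrho hirr hmu s0) ->.
by rewrite adjmx0 mul0mx.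
Qed.
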